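(* Let $Z=(X^+,X^-)_\Sigma$ be a planar Filippov system, in coordinates with $h(x,y)=y$, having a $\Sigma$-polycycle $\Gamma$ of type $(ii)$ through $l$ visible regular-tangential singularities $p_1=(0,0)$, $p_i=(a_i,0)$ ($i=2,\dots,l$), of even multiplicities $n_i=2k_i$, $i=1,\dots,l$. Let $n\geq\max_{1\le i\le l}\{n_i\}-1$, let $\Phi\in C^{n-1}_{ST}$, and let $Z_\varepsilon^\Phi$ be the $\Phi$-regularization of $Z$. Then, for $\varepsilon>0$ small enough, $Z_\varepsilon^\Phi$ admits at least one limit cycle $\Gamma_\varepsilon$. Moreover, $\Gamma_\varepsilon$ converges to $\Gamma$ as $\varepsilon\to0$.
   Context: **Filippov systems.** Let $\mathcal D\subset\mathbb R^2$ be open and $h:\mathcal D\to\mathbb R$ a $C^\infty$ function having $0$ as a regular value; $\Sigma=h^{-1}(0)$ is connected and separates $\mathcal D$ into $\Sigma^+=\{h>0\}$ and $\Sigma^-=\{h<0\}$. $Z=(X^+,X^-)_\Sigma$ is the piecewise smooth vector field equal to $X^\pm$ on $\Sigma^\pm$, where $X^\pm=(X_1^\pm,X_2^\pm)$ are of class $C^{r}$ up to $\Sigma$ (extendable across it), $r=\max_i n_i$. $X^\pm h=\langle\nabla h,X^\pm\rangle$, $(X^\pm)^jh=X^\pm((X^\pm)^{j-1}h)$. The flow of $X^\pm$ is $\varphi_{X^\pm}$. Crossing region: $\Sigma^c=\{q\in\Sigma: X^+h(q)\,X^-h(q)>0\}$, where trajectories of $X^+$ and $X^-$ are concatenated. Sliding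 region: $\Sigma^s=\{q\in\Sigma:X^+h(q)X^-h(q)<0\}$, where trajectories follow the sliding vector field $Z^s=\frac{X^-h\,X^+-X^+h\,X^-}{X^-h-X^+h}$. $\Sigma$-singularities include the zeros of $Z^s$ and the tangential points $\{q\in\Sigma: X^+h(q)X^-h(q)=0\}$. **Visible regular-tangential singularity of multiplicity $n_i=2k_i$** at $p_i\in\Sigma$: either $X^+h(p_i)=\dots=(X^+)^{n_i-1}h(p_i)=0$, $(X^+)^{n_i}h(p_i)>0$ and $X^-h(p_i)\neq0$; or, vice versa, $X^-h(p_i)=\dots=(X^-)^{n_i-1}h(p_i)=0$, $(X^-)^{n_i}h(p_i)<0$ and $X^+h(p_i)\neq0$. **$\Sigma$-polycycles.** A regular orbit of $Z$ is a piecewise smooth curve $\gamma$ such that $\gamma\cap\Sigma^\pm$ are unions of regular orbits of $X^\pm$ and $\gamma\cap\Sigma\subset\Sigma^c$. A $\Sigma$-polycycle $\Gamma$ is a closed curve composed of finitely many $\Sigma$-singularities $p_1,\dots,p_l\in\Sigma$ and finitely many regular orbits $\gamma_1,\dots,\gamma_l$, $\gamma_i$ having ending points $p_i$ and $p_{i+1}$ (with $p_{l+1}=p_1$), such that $\Gamma$ is an $S^1$-immersion oriented by increasing time along the regular orbits, and there is a non-constant first return map defined on at least one side of $\Gamma$. **Type $(ii)$.** $\Gamma$ is of type $(ii)$ if its $\Sigma$-singularities are visible regular-tangential singularities $p_1,\dots,p_l$ of multiplicities $n_i=2k_i$; for each $i$ there is a curve $\gamma_i$ connecting $p_i$ to $p_{i+1}$,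 oriented from $p_i$ to $p_{i+1}$, such that $\gamma_i\setminus\{p_i,p_{i+1}\}$ is a regular orbit of $Z$, $\gamma_i$ is tangent to $\Sigma$ at $p_i$ and transversal to $\Sigma$ at $p_{i+1}$ ($p_{l+1}=p_1$); and locally around each $p_i$ the same conditions hold as for a polycycle of type $(b)$, that is (up to interchanging the roles of $X^+$ and $X^-$), $\Gamma$ leaves $p_i$ along the unstable tangential separatrix $W^u_t(p_i)$ (the forward trajectory through $p_i$ of the vector field tangent to $\Sigma$ at $p_i$) and arrives at $p_i$ along the stable transversal separatrix $W^s_{\pitchfork}(p_i)$ (the backward trajectory through $p_i$ of the vector field transversal to $\Sigma$ at $p_i$). **Regularization.** For an integer $r\ge0$, a $C^r$-monotonic transition function is $\Phi(s)=\phi(s)$ for $|s|\le1$, $\Phi(s)=\mathrm{sign}(s)$ for $|s|\ge1$, where $\phi:\mathbb R\to\mathbb R$ is $C^\infty$, $\phi(\pm1)=\pm1$, $\phi^{(j)}(\pm1)=0$ for $j=1,\dots,r$, and $\phi'(s)>0$ on $(-1,1)$. $C^r_{ST}$ is the set of such $\Phi$ that are not $C^{r+1}$ at $\pm1$. For $\varepsilon>0$, $Z_\varepsilon^\Phi=\frac{1+\Phi(h/\varepsilon)}{2}X^++\frac{1-\Phi(h/\varepsilon)}{2}X^-$. **Convergence.** $\Gamma_\varepsilon$ converges to $\Gamma$ if for every open set $\mathcal U\supset\Gamma$ one has $\Gamma_\varepsilon\subset\mathcal U$ for all $\varepsilon>0$ small enough. *)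

(* Defs.v *)
(* Stdlib reals + Coquelicot.  Points and vectors of the plane are pairs
   [R * R], subsets of the plane are predicates. *)
From Stdlib Require Export Reals List Arith.
From Coquelicot Require Export Coquelicot.
Open Scope R_scope.

(** * Calculus in the plane *)

Definition dx (f : R * R -> R) (q : R * R) : R :=
  Derive (fun t => f (t, snd q)) (fst q).

Definition dy (f : R * R -> R) (q : R * R) : R :=
  Derive (fun t => f (fst q, t)) (snd q).

(* Class C^k on the open set U.  The existence clauses are needed because
   [Derive] is total. *)
Fixpoint Ck (k : nat) (U : R * R -> Prop) (f : R * R -> R) : Prop :=
  match k with
  | O => forall q, U q -> continuous f q
  | S k' =>
      (forall q, U q -> ex_derive (fun t => f (t, snd q)) (fst q) /\
                        ex_derive (fun t => f (fst q, t)) (snd q)) /\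
      Ck k' U (dx f) /\ Ck k' U (dy f)
  end.

Definition Ck_field (k : nat) (U : R * R -> Prop) (X : R * R -> R * R) : Prop :=
  Ck k U (fun q => fst (X q)) /\ Ck k U (fun q => snd (X q)).

Definition lie (X : R * R -> R * R) (f : R * R -> R) (q : R * R) : R :=
  fst (X q) * dx f q + snd (X q) * dy f q.

Definition lie_iter (X : R * R -> R * R) (j : nat) (f : R * R -> R) :
    R * R -> R :=
  Nat.iter j (lie X) f.

Definition connected_set (S : R * R -> Prop) : Prop :=
  forall U V : R * R -> Prop, open U -> open V ->
    (forall q, S q -> U q \/ V q) ->
    (forall q, S q -> U q -> V q -> False) ->
    (forall q, S q -> U q) \/ (forall q, S q -> V q).

Definition velocity (c : R -> R * R) (t : R) (w : R * R) : Prop :=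
  is_derive (fun s => fst (c s)) t (fst w) /\
  is_derive (fun s => snd (c s)) t (snd w).

(* One-sided velocities, for F = [at_right t] or F = [at_left t]. *)
Definition side_velocity (F : (R -> Prop) -> Prop) (c : R -> R * R)
    (t : R) (w : R * R) : Prop :=
  filterlim (fun s => (fst (c s) - fst (c t)) / (s - t)) F (locally (fst w)) /\
  filterlim (fun s => (snd (c s) - snd (c t)) / (s - t)) F (locally (snd w)).

(** * Filippov systems *)

(* The switching manifold is the zero set of [sw] in [dom].  The fields are
   total functions; [filippov_system] says where they are smooth. *)
Record pws := Pws {
  dom : R * R -> Prop;
  sw : R * R -> R;
  Xplus : R * R -> R * R;
  Xminus : R * R -> R * R
}.

Definition Sigma (Z : pws) (q : R * R) : Prop := dom Z q /\ sw Z q = 0.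
Definition Sigma_plus (Z : pws) (q : R * R) : Prop := dom Z q /\ 0 < sw Z q.
Definition Sigma_minus (Z : pws) (q : R * R) : Prop := dom Z q /\ sw Z q < 0.

Definition Xph (Z : pws) : R * R -> R := lie (Xplus Z) (sw Z).
Definition Xmh (Z : pws) : R * R -> R := lie (Xminus Z) (sw Z).

Definition crossing (Z : pws) (q : R * R) : Prop :=
  Sigma Z q /\ 0 < Xph Z q * Xmh Z q.

Definition sliding (Z : pws) (q : R * R) : Prop :=
  Sigma Z q /\ Xph Z q * Xmh Z q < 0.

Definition Zs (Z : pws) (q : R * R) : R * R :=
  ((Xmh Z q * fst (Xplus Z q) - Xph Z q * fst (Xminus Z q))
     / (Xmh Z q - Xph Z q),
   (Xmh Z q * snd (Xplus Z q) - Xph Z q * snd (Xminus Z q))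
     / (Xmh Z q - Xph Z q)).

Definition tangential (Z : pws) (q : R * R) : Prop :=
  Sigma Z q /\ Xph Z q * Xmh Z q = 0.

Definition Sigma_singularity (Z : pws) (q : R * R) : Prop :=
  (sliding Z q /\ Zs Z q = (0, 0)) \/ tangential Z q.

(* The fields are C^r up to Sigma and extend across it: each one is C^r on some
   open neighbourhood of its closed side. *)
Definition filippov_system (Z : pws) (r : nat) : Prop :=
  open (dom Z) /\
  (forall m, Ck m (dom Z) (sw Z)) /\
  (forall q, Sigma Z q -> (dx (sw Z) q, dy (sw Z) q) <> (0, 0)) /\
  connected_set (Sigma Z) /\
  (exists q, Sigma_plus Z q) /\ (exists q, Sigma_minus Z q) /\
  (exists U, open U /\ (forall q, dom Z q -> 0 <= sw Z q -> U q) /\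
             Ck_field r U (Xplus Z)) /\
  (exists U, open U /\ (forall q, dom Z q -> sw Z q <= 0 -> U q) /\
             Ck_field r U (Xminus Z)).

Definition visible_regtan_plus (Z : pws) (n : nat) (q : R * R) : Prop :=
  Sigma Z q /\
  (forall j, (1 <= j < n)%nat -> lie_iter (Xplus Z) j (sw Z) q = 0) /\
  0 < lie_iter (Xplus Z) n (sw Z) q /\
  Xmh Z q <> 0.

Definition visible_regtan_minus (Z : pws) (n : nat) (q : R * R) : Prop :=
  Sigma Z q /\
  (forall j, (1 <= j < n)%nat -> lie_iter (Xminus Z) j (sw Z) q = 0) /\
  lie_iter (Xminus Z) n (sw Z) q < 0 /\
  Xph Z q <> 0.

(** * Orbits *)

Definition solves (X : R * R -> R * R) (c : R -> R * R) (a b : R) : Prop :=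
  forall t, a < t < b -> velocity c t (X (c t)).

Definition subdivision (s : nat -> R) (m : nat) (a b : R) : Prop :=
  s O = a /\ s m = b /\ forall j, (j < m)%nat -> s j < s (S j).

Definition plus_piece (Z : pws) (c : R -> R * R) (a b : R) : Prop :=
  (forall t, a < t < b -> Sigma_plus Z (c t)) /\ solves (Xplus Z) c a b.

Definition minus_piece (Z : pws) (c : R -> R * R) (a b : R) : Prop :=
  (forall t, a < t < b -> Sigma_minus Z (c t)) /\ solves (Xminus Z) c a b.

Definition sliding_piece (Z : pws) (c : R -> R * R) (a b : R) : Prop :=
  (forall t, a < t < b -> sliding Z (c t)) /\ solves (Zs Z) c a b.

(* Time-parametrised regular orbit on the open interval (a, b): finitely many
   regular arcs off Sigma, concatenated at crossing points. *)
Definition regular_orbit (Z : pws) (c : R -> R * R) (a b : R) : Prop :=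
  (forall t, a < t < b -> continuous c t) /\
  exists (m : nat) (s : nat -> R),
    subdivision s m a b /\
    (forall j, (j < m)%nat ->
       (plus_piece Z c (s j) (s (S j)) /\
        forall t, s j < t < s (S j) -> Xplus Z (c t) <> (0, 0)) \/
       (minus_piece Z c (s j) (s (S j)) /\
        forall t, s j < t < s (S j) -> Xminus Z (c t) <> (0, 0))) /\
    (forall j, (0 < j < m)%nat -> crossing Z (c (s j))).

(* Filippov trajectory on [a, b]; it may slide. *)
Definition filippov_trajectory (Z : pws) (c : R -> R * R) (a b : R) : Prop :=
  (forall t, a <= t <= b -> dom Z (c t) /\ continuous c t) /\
  exists (m : nat) (s : nat -> R),
    subdivision s m a b /\
    forall j, (j < m)%nat ->
      plus_piece Z c (s j) (s (S j)) \/
      minus_piece Z c (s j) (s (S j)) \/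
      sliding_piece Z c (s j) (s (S j)).

(** * First return maps *)

Definition sec_pt (q v : R * R) (u : R) : R * R :=
  (fst q + u * fst v, snd q + u * snd v).

Definition det2 (v w : R * R) : R := fst v * snd w - snd v * fst w.

Definition transversal_section (Z : pws) (q v : R * R) (d : R) : Prop :=
  (forall u, Rabs u < d ->
     Sigma_plus Z (sec_pt q v u) /\ det2 v (Xplus Z (sec_pt q v u)) <> 0) \/
  (forall u, Rabs u < d ->
     Sigma_minus Z (sec_pt q v u) /\ det2 v (Xminus Z (sec_pt q v u)) <> 0).

(* Some trajectory starting at parameter [u] of the section returns to it for
   the first time at parameter [u']. *)
Definition first_return (Z : pws) (q v : R * R) (d u u' : R) : Prop :=
  Rabs u' < d /\
  exists (c : R -> R * R) (t1 : R),
    0 < t1 /\ filippov_trajectory Z c 0 t1 /\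
    c 0 = sec_pt q v u /\ c t1 = sec_pt q v u' /\
    forall t, 0 < t < t1 -> forall u'', Rabs u'' < d -> c t <> sec_pt q v u''.

(* The section is based at a point of Gamma; the map is defined on the half
   0 < u < d1, the choice of v selecting the side of Gamma. *)
Definition nonconstant_first_return (Z : pws) (Gamma : R * R -> Prop) : Prop :=
  exists (q v : R * R) (d d1 : R) (P : R -> R),
    Gamma q /\ 0 < d1 <= d /\ transversal_section Z q v d /\
    (forall u, 0 < u < d1 ->
       first_return Z q v d u (P u) /\
       forall u', first_return Z q v d u u' -> u' = P u) /\
    (exists u1 u2, 0 < u1 < d1 /\ 0 < u2 < d1 /\ P u1 <> P u2).

(** * Polycycles *)

Definition range_of (g : R -> R * R) (q : R * R) : Prop := exists t, q = g t.

(* The closed curve is a continuous, locally injective map g, periodic of period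
   tau l; g passes through the singularity p i at time tau i (i < l), and the
   arc gamma_i is g on [tau i, tau (i+1)], parametrised by time.  Finite
   passage times lose nothing for regular-tangential end points. *)
Definition sigma_polycycle (Z : pws) (l : nat) (p : nat -> R * R)
    (g : R -> R * R) (tau : nat -> R) : Prop :=
  (0 < l)%nat /\
  (forall i j, (i < l)%nat -> (j < l)%nat -> p i = p j -> i = j) /\
  (forall i, (i < l)%nat -> Sigma_singularity Z (p i)) /\
  (forall t, dom Z (g t) /\ continuous g t) /\
  (forall t, g (t + tau l) = g t) /\
  (forall t, exists d, 0 < d /\
     forall s s', Rabs (s - t) < d -> Rabs (s' - t) < d -> g s = g s' -> s = s') /\
  tau O = 0 /\
  (forall i, (i < l)%nat -> tau i < tau (S i)) /\
  (forall i, (i < l)%nat -> g (tau i) = p i) /\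
  (forall i, (i < l)%nat -> regular_orbit Z g (tau i) (tau (S i))) /\
  nonconstant_first_return Z (range_of g).

(* Just after t0, g is the forward trajectory of X through g t0. *)
Definition leaves_along (X : R * R -> R * R) (g : R -> R * R) (t0 : R) : Prop :=
  exists (d : R) (y : R -> R * R),
    0 < d /\ solves X y (t0 - d) (t0 + d) /\
    forall t, t0 <= t < t0 + d -> g t = y t.

(* Just before t0, g is the backward trajectory of X through g t0. *)
Definition arrives_along (X : R * R -> R * R) (g : R -> R * R) (t0 : R) : Prop :=
  exists (d : R) (y : R -> R * R),
    0 < d /\ solves X y (t0 - d) (t0 + d) /\
    forall t, t0 - d < t <= t0 -> g t = y t.

Definition leaves_tangentially (Z : pws) (g : R -> R * R) (t0 : R) : Prop :=
  exists w, w <> (0, 0) /\ side_velocity (at_right t0) g t0 w /\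
    fst w * dx (sw Z) (g t0) + snd w * dy (sw Z) (g t0) = 0.

Definition arrives_transversally (Z : pws) (g : R -> R * R) (t0 : R) : Prop :=
  exists w, side_velocity (at_left t0) g t0 w /\
    fst w * dx (sw Z) (g t0) + snd w * dy (sw Z) (g t0) <> 0.

(* For i = 0 the arrival at p 0 is read at time tau 0 = 0, just before which g
   runs through the end of the last arc, by periodicity. *)
Definition polycycle_type_ii (Z : pws) (l : nat) (p : nat -> R * R)
    (k : nat -> nat) (g : R -> R * R) (tau : nat -> R) : Prop :=
  sigma_polycycle Z l p g tau /\
  forall i, (i < l)%nat ->
    (1 <= k i)%nat /\
    leaves_tangentially Z g (tau i) /\
    arrives_transversally Z g (tau (S i)) /\
    ((visible_regtan_plus Z (2 * k i) (p i) /\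
      leaves_along (Xplus Z) g (tau i) /\
      arrives_along (Xminus Z) g (tau i)) \/
     (visible_regtan_minus Z (2 * k i) (p i) /\
      leaves_along (Xminus Z) g (tau i) /\
      arrives_along (Xplus Z) g (tau i))).

Definition max_mult (l : nat) (k : nat -> nat) : nat :=
  fold_right Nat.max O (map (fun i => (2 * k i)%nat) (seq 0 l)).

(** * Regularization *)

Definition monotonic_transition (r : nat) (Phi : R -> R) : Prop :=
  exists phi : R -> R,
    (forall m s, ex_derive_n phi m s) /\
    phi 1 = 1 /\ phi (-1) = -1 /\
    (forall j, (1 <= j <= r)%nat ->
       Derive_n phi j 1 = 0 /\ Derive_n phi j (-1) = 0) /\
    (forall s, -1 < s < 1 -> 0 < Derive phi s) /\
    (forall s, Rabs s <= 1 -> Phi s = phi s) /\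
    (forall s, 1 <= Rabs s -> Phi s = sign s).

Definition Ck_at (m : nat) (f : R -> R) (x : R) : Prop :=
  locally x (fun y => forall j, (j <= m)%nat ->
    ex_derive_n f j y /\ continuous (Derive_n f j) y).

Definition C_ST (r : nat) (Phi : R -> R) : Prop :=
  monotonic_transition r Phi /\
  ~ Ck_at (S r) Phi 1 /\ ~ Ck_at (S r) Phi (-1).

Definition regularization (Z : pws) (Phi : R -> R) (eps : R) (q : R * R) :
    R * R :=
  let a := Phi (sw Z q / eps) in
  ((1 + a) / 2 * fst (Xplus Z q) + (1 - a) / 2 * fst (Xminus Z q),
   (1 + a) / 2 * snd (Xplus Z q) + (1 - a) / 2 * snd (Xminus Z q)).

(** * Limit cycles and convergence *)

Definition periodic_orbit (D : R * R -> Prop) (F : R * R -> R * R)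
    (G : R * R -> Prop) : Prop :=
  exists (y : R -> R * R) (T : R),
    0 < T /\
    (forall t, D (y t) /\ velocity y t (F (y t)) /\ y (t + T) = y t) /\
    (exists t, y t <> y 0) /\
    (forall q, G q <-> range_of y q).

Definition limit_cycle (D : R * R -> Prop) (F : R * R -> R * R)
    (G : R * R -> Prop) : Prop :=
  periodic_orbit D F G /\
  exists W : R * R -> Prop,
    open W /\ (forall q, G q -> W q) /\
    forall G', periodic_orbit D F G' -> (exists q, G' q /\ W q) ->
      forall q, G' q <-> G q.

Definition converges_to (G : R -> R * R -> Prop) (Gamma : R * R -> Prop) : Prop :=
  forall U : R * R -> Prop, open U -> (forall q, Gamma q -> U q) ->
    exists e1, 0 < e1 /\ forall eps, 0 < eps < e1 -> forall q, G eps q -> U q.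

(* Main.v *)
Require Import Defs.
From Stdlib Require Import Reals List Arith ZArith Lra Lia Psatz.
From Stdlib Require Import Classical ClassicalEpsilon.
From Coquelicot Require Import Coquelicot.
Open Scope R_scope.

(** Around each point of Gamma some linear form v increases along the orbits of
    the regularized field, uniformly in eps, so that these orbits are graphs of
    a transversal linear form w over v.  At crossing points the slope of these
    graphs is Lipschitz in w uniformly in eps.  At a tangential singularity it
    is only one-sided Lipschitz: across the strip |h| <= eps the weight of the
    field tangent to Sigma increases with h and the slope decreases with that
    weight.  One-sided Gronwall estimates then show that the orbits stay near
    Gamma.  The decrease of the slope also gives a contraction: measured in the
    coordinate H with H' = 1 + theta ln((1 + eta) / (eta + 1 - b)), b the weight
    and eta a bound for the normal component of the tangent field, distances do
    not grow by more than a fixed factor, whereas H' grows from 1 to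
    1 + theta ln((1 + eta) / eta), which is arbitrarily large in a small box.
    Hence the first return map of the regularized field is a contraction of a
    ball independent of eps; its fixed point is a periodic orbit, unique near
    Gamma. *)

(** * Real analysis *)

(** Two obstacles shape the argument. The Lipschitz constant of the regularized field is of order 1
    / eps, so at a tangential singularity only the sign of the dependence on the weight gives bounds
    uniform in eps. And the return map contracts only if a loss of unknown size along the rest of
    Gamma is compensated. One singularity, p_1, does this: its contraction factor is prescribed
    after the factor of the remaining arc is known. That is possible because the constants c, C, L
    of the boxes at p_1 do not depend on their radius, so shrinking a box does not worsen the other
    factors.

    The logarithm solves a differential inequality. Let f be the slope as a function of the weight b
    and rho = H'; the product rho f must not increase with b. Since f is at most a constant times
    eta + 1 - b and f' is at most a negative constant, rho' = theta / (eta + 1 - b) with theta small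
    gives rho' f <= - f' <= - rho f' wherever rho >= 1, and rho (0) = 1 fixes rho. *)

Ltac use_derive D :=
  match type of D with
  | is_derive _ ?x ?d =>
      match goal with
      | |- context [Derive ?f x] =>
          replace (Derive f x) with d
            by (symmetry; apply is_derive_unique; exact D)
      end
  end.

(** Differentiability is asked only inside the interval: [g] may lack a velocity at a contact with
    Sigma, and such a time becomes an end point in [curve_increments]. *)
Lemma mean_value (f : R -> R) (a b : R) :
  a < b ->
  (forall x, a < x < b -> ex_derive f x) ->
  (forall x, a <= x <= b -> continuous f x) ->
  exists c, a < c < b /\ f b - f a = Derive f c * (b - a).
Proof.
  intros Hab Hd Hc.
  assert (pr1 : forall c, a < c < b -> derivable_pt f c).
  { intros c Hx. apply ex_derive_Reals_0. now apply Hd. }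
  assert (pr2 : forall c, a < c < b -> derivable_pt id c).
  { intros c _. apply derivable_pt_id. }
  destruct (MVT f id a b pr1 pr2 Hab) as [c [P E]].
  - intros c Hx. apply continuity_pt_filterlim. now apply Hc.
  - intros c _. apply derivable_continuous_pt, derivable_pt_id.
  - exists c. split; [exact P|].
    rewrite (derive_pt_eq_0 id c 1 (pr2 c P)) in E by apply derivable_pt_lim_id.
    rewrite <- (Derive_Reals f c (pr1 c P)).
    unfold id in E. lra.
Qed.

Lemma increment_le (f : R -> R) (a b M : R) :
  a <= b ->
  (forall x, a < x < b -> exists d, is_derive f x d /\ d <= M) ->
  (forall x, a <= x <= b -> continuous f x) ->
  f b - f a <= M * (b - a).
Proof.
  intros Hab Hd Hc.
  destruct (Req_dec a b) as [->|Hne]; [lra|].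
  destruct (mean_value f a b) as [c [Hx E]]; [lra| |exact Hc|].
  - intros x Hx. destruct (Hd x Hx) as [d [D _]]. now exists d.
  - rewrite E. destruct (Hd c Hx) as [d [D Hle]].
    rewrite (is_derive_unique _ _ _ D). apply Rmult_le_compat_r; lra.
Qed.

Lemma increment_ge (f : R -> R) (a b M : R) :
  a <= b ->
  (forall x, a < x < b -> exists d, is_derive f x d /\ M <= d) ->
  (forall x, a <= x <= b -> continuous f x) ->
  M * (b - a) <= f b - f a.
Proof.
  intros Hab Hd Hc.
  enough (- f b - - f a <= - M * (b - a)) by lra.
  apply (increment_le (fun x => - f x)); [exact Hab| |].
  - intros x Hx. destruct (Hd x Hx) as [d [D Hle]].
    exists (- d). split; [|lra]. apply (is_derive_opp f x d D).
  - intros x Hx. apply (continuous_opp f x), Hc, Hx.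
Qed.

Lemma increment_abs_le (f : R -> R) (a b M : R) :
  a <= b ->
  (forall x, a < x < b -> exists d, is_derive f x d /\ Rabs d <= M) ->
  (forall x, a <= x <= b -> continuous f x) ->
  Rabs (f b - f a) <= M * (b - a).
Proof.
  intros Hab Hd Hc. apply Rabs_le. split.
  - enough (- M * (b - a) <= f b - f a) by lra.
    apply increment_ge; [exact Hab| |exact Hc].
    intros x Hx. destruct (Hd x Hx) as [d [D Hle]]. exists d.
    apply Rabs_le_between in Hle. split; [exact D|lra].
  - apply increment_le; [exact Hab| |exact Hc].
    intros x Hx. destruct (Hd x Hx) as [d [D Hle]]. exists d.
    apply Rabs_le_between in Hle. split; [exact D|lra].
Qed.

Lemma continuous_eps (f : R -> R) (x : R) :
  continuous f x <->
  forall e, 0 < e -> exists d, 0 < d /\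
    forall y, Rabs (y - x) < d -> Rabs (f y - f x) < e.
Proof.
  split.
  - intros H e He.
    assert (Hl : locally (f x) (fun z => Rabs (z - f x) < e)).
    { exists (mkposreal e He). intros z Hz. exact Hz. }
    destruct (H _ Hl) as [d Hd]. exists d. split; [apply cond_pos|].
    intros y Hy. apply (Hd y). exact Hy.
  - intros H P [e He].
    destruct (H e (cond_pos e)) as [d [Hd K]].
    exists (mkposreal d Hd). intros y Hy. apply He. apply K. exact Hy.
Qed.

Lemma ex_derive_continuous_R (f : R -> R) (x : R) : ex_derive f x -> continuous f x.
Proof. apply (@ex_derive_continuous R_AbsRing R_NormedModule). Qed.

Lemma Rlt_min x a b : x < Rmin a b -> x < a /\ x < b.
Proof. generalize (Rmin_l a b) (Rmin_r a b). lra. Qed.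

(** One choice of a constant below several linear thresholds; idle slots are filled with [1 1]. *)
Lemma small_positive k1 e1 k2 e2 k3 e3 k4 e4 :
  0 < e1 -> 0 < e2 -> 0 < e3 -> 0 < e4 ->
  exists d, 0 < d /\ k1 * d <= e1 /\ k2 * d <= e2 /\ k3 * d <= e3 /\ k4 * d <= e4.
Proof.
  intros H1 H2 H3 H4.
  set (k := 1 + Rabs k1 + Rabs k2 + Rabs k3 + Rabs k4).
  set (e := Rmin (Rmin e1 e2) (Rmin e3 e4)).
  assert (A1 := Rabs_pos k1). assert (A2 := Rabs_pos k2).
  assert (A3 := Rabs_pos k3). assert (A4 := Rabs_pos k4).
  assert (Hk : 0 < k) by (unfold k; lra).
  assert (He : 0 < e) by (unfold e; repeat apply Rmin_pos; assumption).
  assert (Hd : 0 < e / k) by now apply Rdiv_lt_0_compat.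
  assert (K : forall x, Rabs x <= k -> x * (e / k) <= e).
  { intros x Hx. apply Rle_trans with (k * (e / k)).
    - apply Rmult_le_compat_r; [lra|]. generalize (Rle_abs x). lra.
    - right. field. lra. }
  assert (L1 := Rmin_l (Rmin e1 e2) (Rmin e3 e4)). assert (L2 := Rmin_r (Rmin e1 e2) (Rmin e3 e4)).
  assert (M1 := Rmin_l e1 e2). assert (M2 := Rmin_r e1 e2).
  assert (M3 := Rmin_l e3 e4). assert (M4 := Rmin_r e3 e4).
  exists (e / k). split; [exact Hd|].
  repeat split; (eapply Rle_trans; [apply K; unfold k; lra|]); unfold e; lra.
Qed.

Lemma lipschitz_continuous (f : R -> R) (M : R) :
  (forall x y, Rabs (f x - f y) <= M * Rabs (x - y)) ->
  forall x, continuous f x.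
Proof.
  intros H x. apply continuous_eps. intros e He.
  assert (HM : 0 <= M).
  { specialize (H 1 0). rewrite (Rabs_pos_eq (1 - 0)) in H by lra.
    generalize (Rabs_pos (f 1 - f 0)). lra. }
  exists (e / (M + 1)). split; [apply Rdiv_lt_0_compat; lra|].
  intros y Hy. eapply Rle_lt_trans; [apply H|].
  apply Rle_lt_trans with ((M + 1) * Rabs (y - x)).
  - apply Rmult_le_compat_r; [apply Rabs_pos|lra].
  - apply Rlt_le_trans with ((M + 1) * (e / (M + 1))).
    + apply Rmult_lt_compat_l; lra.
    + right. field. lra.
Qed.

(** Compactness of a segment as an induction principle: the supremum of the points reached from [a]
    can always be passed. It yields uniform radii around [g] and chains passages through boxes. *)
Lemma interval_chain (Q : R -> R -> Prop) :
  (forall a b c, a <= b <= c -> Q a b -> Q b c -> Q a c) ->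
  (forall t, exists d, 0 < d /\
     forall a b, t - d < a -> a <= b -> b < t + d -> Q a b) ->
  forall a b, a <= b -> Q a b.
Proof.
  intros Htr Hloc a b Hab.
  set (E := fun x => a <= x <= b /\ Q a x).
  assert (Ha : E a).
  { split; [lra|]. destruct (Hloc a) as [d [Hd K]]. apply K; lra. }
  destruct (completeness E) as [m [Hub Hlub]].
  - exists b. intros x [Hx _]. lra.
  - now exists a.
  - assert (Ham : a <= m) by now apply Hub.
    assert (Hmb : m <= b) by (apply Hlub; intros x [Hx _]; lra).
    destruct (Hloc m) as [d [Hd K]].
    assert (Hex : exists x, E x /\ m - d < x <= m).
    { apply NNPP. intros Hn.
      assert (m <= m - d); [|lra].
      apply Hlub. intros x Hx.
      destruct (Rle_dec x (m - d)) as [|Hlt]; [assumption|].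
      exfalso. apply Hn. exists x. split; [exact Hx|].
      split; [lra|]. now apply Hub. }
    destruct Hex as [x [[Hxb Hx] Hxm]].
    set (z := Rmin b (m + d / 2)).
    assert (Hz : E z).
    { assert (Hxz : x <= z) by (apply Rmin_glb; lra).
      assert (z <= m + d / 2) by apply Rmin_r.
      split; [split; [lra|apply Rmin_l]|].
      apply (Htr a x z); [lra|exact Hx|]. apply K; lra. }
    assert (Hzm : z <= m) by now apply Hub.
    destruct Hz as [_ Hz].
    enough (Ez : z = b) by now rewrite <- Ez.
    unfold z in *. unfold Rmin in *. destruct (Rle_dec b (m + d / 2)); lra.
Qed.

(** The tool for bootstrap arguments: an estimate that holds as long as [phi] is negative can be
    applied up to and including the first zero. *)
Lemma first_exit (phi : R -> R) (T : R) :
  (forall t, continuous phi t) -> phi 0 < 0 -> 0 <= T ->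
  (forall t, 0 <= t <= T -> phi t < 0) \/
  exists t1, 0 < t1 <= T /\ phi t1 = 0 /\ forall t, 0 <= t < t1 -> phi t < 0.
Proof.
  intros Hc H0 HT.
  set (E := fun x => 0 <= x <= T /\ forall t, 0 <= t <= x -> phi t < 0).
  destruct (completeness E) as [m [Hub Hlub]].
  - exists T. intros x [Hx _]. lra.
  - exists 0. split; [lra|]. intros t Ht. now replace t with 0 by lra.
  - assert (H0m : 0 <= m).
    { apply Hub. split; [lra|]. intros t Ht. now replace t with 0 by lra. }
    assert (HmT : m <= T) by (apply Hlub; intros x [Hx _]; lra).
    assert (Hbelow : forall t, 0 <= t < m -> phi t < 0).
    { intros t Ht. apply NNPP. intros Hn.
      assert (m <= t); [|lra]. apply Hlub. intros x [Hx K].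
      destruct (Rle_dec x t) as [|Hlt]; [assumption|].
      exfalso. apply Hn, K. lra. }
    destruct (Rtotal_order (phi m) 0) as [Hneg|[Hz|Hpos]].
    + left.
      destruct (proj1 (continuous_eps phi m) (Hc m) (- phi m)) as [d [Hd K]];
        [lra|].
      assert (Hm : E (Rmin T (m + d / 2))).
      { split.
        - split; [apply Rmin_glb; lra|apply Rmin_l].
        - intros t Ht. assert (t <= m + d / 2) by
            (eapply Rle_trans; [apply Ht|apply Rmin_r]).
          destruct (Rlt_dec t m) as [Hlt|Hge]; [apply Hbelow; lra|].
          assert (Hab : Rabs (t - m) < d) by (rewrite Rabs_pos_eq; lra).
          specialize (K t Hab). apply Rabs_lt_between in K. lra. }
      assert (Hle := Hub _ Hm). destruct Hm as [_ Hm].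
      assert (HTm : T <= m).
      { unfold Rmin in Hle. destruct (Rle_dec T (m + d / 2)); lra. }
      intros t Ht. destruct (Req_dec t m) as [->|]; [exact Hneg|].
      apply Hbelow. lra.
    + right. exists m. split; [|split; assumption].
      split; [|exact HmT]. destruct (Req_dec m 0) as [E0|]; [|lra].
      rewrite E0 in Hz. lra.
    + exfalso.
      assert (Hm0 : 0 < m).
      { destruct (Req_dec m 0) as [E0|]; [|lra]. rewrite E0 in Hpos. lra. }
      destruct (proj1 (continuous_eps phi m) (Hc m) (phi m) Hpos) as [d [Hd K]].
      set (t := Rmax 0 (m - d / 2)).
      assert (Ht : 0 <= t < m).
      { unfold t, Rmax. destruct (Rle_dec 0 (m - d / 2)); lra. }
      assert (Hab : Rabs (t - m) < d).
      { assert (m - d / 2 <= t) by apply Rmax_r.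
        rewrite Rabs_left1; lra. }
      specialize (K t Hab). specialize (Hbelow t Ht).
      apply Rabs_lt_between in K. lra.
Qed.

(** The function D ^ 2 exp (- 2 L x) does not increase. Nothing bounds [D x * d] from below, so two
    curves may approach each other arbitrarily fast, as they do inside the regularization strip. *)
Lemma gronwall_one_sided (D : R -> R) (a b L : R) :
  a <= b ->
  (forall x, a <= x <= b -> continuous D x) ->
  (forall x, a < x < b -> exists d, is_derive D x d /\ D x * d <= L * D x ^ 2) ->
  Rabs (D b) <= exp (L * (b - a)) * Rabs (D a).
Proof.
  intros Hab Hc Hd.
  set (u := fun x => D x ^ 2 * exp (- (2 * L) * x)).
  assert (Hu : u b - u a <= 0 * (b - a)).
  { apply increment_le; [exact Hab| |].
    - intros x Hx. destruct (Hd x Hx) as [d [Dd Hle]].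
      exists ((2 * (D x * d) - 2 * L * D x ^ 2) * exp (- (2 * L) * x)). split.
      + unfold u. auto_derive; [now exists d|].
        use_derive Dd. ring.
      + generalize (exp_pos (- (2 * L) * x)). intros He. nra.
    - intros x Hx. unfold u.
      apply (continuous_mult (fun x => D x ^ 2) (fun x => exp (- (2 * L) * x))).
      + apply (continuous_ext (fun x => D x * D x)).
        { intros z. simpl. ring. }
        apply (continuous_mult D D); now apply Hc.
      + apply ex_derive_continuous_R. auto_derive. exact I. }
  assert (Hu2 : D b ^ 2 * exp (- (2 * L) * b) <= D a ^ 2 * exp (- (2 * L) * a))
    by (unfold u in Hu; lra).
  apply Rsqr_incr_0_var.
  2: { apply Rmult_le_pos; [left; apply exp_pos|apply Rabs_pos]. }
  rewrite Rsqr_mult, <- !Rsqr_abs. unfold Rsqr.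
  assert (E1 : exp (- (2 * L) * a) =
    exp (- (2 * L) * b) * (exp (L * (b - a)) * exp (L * (b - a)))).
  { rewrite <- !exp_plus. f_equal. ring. }
  rewrite E1 in Hu2.
  apply Rmult_le_reg_l with (exp (- (2 * L) * b)); [apply exp_pos|].
  simpl in Hu2. lra.
Qed.

Lemma exp_le (x y : R) : x <= y -> exp x <= exp y.
Proof.
  intros H. destruct (Req_dec x y) as [->|]; [lra|].
  left. apply exp_increasing. lra.
Qed.

(** On the gap [m1, m2] only the Lipschitz bound is available, which costs the additive term. The
    factor 2 in the exponent comes from using Gronwall before and after the gap, each time with the
    length of the whole interval. *)
Lemma gronwall_gap (D : R -> R) (a b L M m1 m2 : R) :
  a <= b -> 0 <= L -> m1 <= m2 ->
  (forall x y, Rabs (D x - D y) <= M * Rabs (x - y)) ->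
  (forall x, a < x < b -> x < m1 \/ m2 < x ->
     exists d, is_derive D x d /\ D x * d <= L * D x ^ 2) ->
  Rabs (D b) <= exp (2 * L * (b - a)) * (Rabs (D a) + M * (m2 - m1)).
Proof.
  intros Hab HL Hm HM Hd.
  assert (Hc : forall x, continuous D x) by now apply lipschitz_continuous with M.
  assert (HM0 : 0 <= M).
  { specialize (HM 1 0). rewrite (Rabs_pos_eq (1 - 0)) in HM by lra.
    generalize (Rabs_pos (D 1 - D 0)). lra. }
  (* The gap may lie partly or wholly outside [a, b]; [p] and [q] are its clamped ends. *)
  set (p := Rmax a (Rmin b m1)). set (q := Rmin b (Rmax p m2)).
  assert (Hp : a <= p <= b /\ (p = a \/ p <= m1)).
  { unfold p, Rmax, Rmin. destruct (Rle_dec b m1); destruct (Rle_dec a _); lra. }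
  assert (Hq : p <= q <= b /\ (q = b \/ m2 <= q) /\ q - p <= m2 - m1).
  { unfold q, p, Rmax, Rmin.
    destruct (Rle_dec b m1); destruct (Rle_dec a _); destruct (Rle_dec _ m2);
      destruct (Rle_dec b _); lra. }
  assert (H1 : Rabs (D p) <= exp (L * (p - a)) * Rabs (D a)).
  { apply gronwall_one_sided; [lra|intros; apply Hc|].
    intros x Hx. apply Hd; lra. }
  assert (H3 : Rabs (D b) <= exp (L * (b - q)) * Rabs (D q)).
  { apply gronwall_one_sided; [lra|intros; apply Hc|].
    intros x Hx. apply Hd; lra. }
  assert (H2 : Rabs (D q) <= Rabs (D p) + M * (m2 - m1)).
  { apply Rle_trans with (Rabs (D p) + Rabs (D q - D p)).
    - replace (D q) with (D p + (D q - D p)) at 1 by ring. apply Rabs_triang.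
    - apply Rplus_le_compat_l. eapply Rle_trans; [apply HM|].
      rewrite Rabs_pos_eq by lra. apply Rmult_le_compat_l; lra. }
  assert (E : forall x, 0 <= x <= b - a -> 1 <= exp (L * x) <= exp (L * (b - a))).
  { intros x Hx. split.
    - rewrite <- exp_0. apply exp_le, Rmult_le_pos; lra.
    - apply exp_le. apply Rmult_le_compat_l; lra. }
  assert (E1 := E (p - a)). assert (E3 := E (b - q)).
  assert (E4 := E (b - a)).
  replace (2 * L * (b - a)) with (L * (b - a) + L * (b - a)) by ring.
  rewrite exp_plus.
  set (e := exp (L * (b - a))) in *.
  assert (Hg : 0 <= M * (m2 - m1)) by (apply Rmult_le_pos; lra).
  assert (A0 := Rabs_pos (D a)).
  apply Rle_trans with (e * (Rabs (D p) + M * (m2 - m1))).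
  - eapply Rle_trans; [exact H3|]. apply Rmult_le_compat; try lra.
    apply Rabs_pos.
  - rewrite Rmult_assoc. apply Rmult_le_compat_l; [lra|].
    rewrite Rmult_plus_distr_l. apply Rplus_le_compat.
    + eapply Rle_trans; [exact H1|]. apply Rmult_le_compat_r; lra.
    + rewrite <- (Rmult_1_l (M * (m2 - m1))) at 1.
      apply Rmult_le_compat_r; lra.
Qed.

(** * The plane with the l1 distance *)

Definition dist1 (p q : R * R) : R :=
  Rabs (fst p - fst q) + Rabs (snd p - snd q).

Lemma dist1_pos p q : 0 <= dist1 p q.
Proof. apply Rplus_le_le_0_compat; apply Rabs_pos. Qed.

Lemma dist1_refl p : dist1 p p = 0.
Proof. unfold dist1. rewrite !Rminus_diag, Rabs_R0. ring. Qed.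

Lemma dist1_sym p q : dist1 p q = dist1 q p.
Proof. unfold dist1. now rewrite (Rabs_minus_sym (fst p)), (Rabs_minus_sym (snd p)). Qed.

Lemma dist1_triangle p q r : dist1 p r <= dist1 p q + dist1 q r.
Proof.
  unfold dist1.
  generalize (Rabs_triang (fst p - fst q) (fst q - fst r)).
  generalize (Rabs_triang (snd p - snd q) (snd q - snd r)).
  replace (fst p - fst q + (fst q - fst r)) with (fst p - fst r) by ring.
  replace (snd p - snd q + (snd q - snd r)) with (snd p - snd r) by ring. lra.
Qed.

Lemma dist1_eq0 p q : dist1 p q <= 0 -> p = q.
Proof.
  unfold dist1. generalize (Rabs_pos (fst p - fst q)) (Rabs_pos (snd p - snd q)).
  intros H1 H2 H. destruct p as [p1 p2], q as [q1 q2]; simpl in *.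
  f_equal; apply Rminus_diag_uniq, NNPP; intros Hn;
    apply Rabs_pos_lt in Hn; lra.
Qed.

Definition coordinate (pi : R * R -> R) : Prop := pi = fst \/ pi = snd.

Lemma dist1_coordinate pi p q : coordinate pi -> Rabs (pi p - pi q) <= dist1 p q.
Proof.
  unfold dist1. generalize (Rabs_pos (fst p - fst q)) (Rabs_pos (snd p - snd q)).
  intros H1 H2 [->| ->]; lra.
Qed.

Lemma dist1_fst p q : Rabs (fst p - fst q) <= dist1 p q.
Proof. apply dist1_coordinate. now left. Qed.

Lemma dist1_snd p q : Rabs (snd p - snd q) <= dist1 p q.
Proof. apply dist1_coordinate. now right. Qed.

Lemma dist1_le p q e :
  (forall pi, coordinate pi -> Rabs (pi p - pi q) <= e) -> dist1 p q <= 2 * e.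
Proof.
  intros H. generalize (H fst (or_introl eq_refl)) (H snd (or_intror eq_refl)).
  unfold dist1. lra.
Qed.

Lemma open_dist1 (U : R * R -> Prop) :
  open U <->
  forall q, U q -> exists r, 0 < r /\ forall q', dist1 q' q < r -> U q'.
Proof.
  split.
  - intros HU q Hq. destruct (HU q Hq) as [r Hr].
    exists r. split; [apply cond_pos|]. intros q' Hd. apply Hr.
    split.
    + apply Rle_lt_trans with (2 := Hd). exact (dist1_fst q' q).
    + apply Rle_lt_trans with (2 := Hd). exact (dist1_snd q' q).
  - intros H q Hq. destruct (H q Hq) as [r [Hr K]].
    assert (Hr2 : 0 < r / 2) by lra.
    exists (mkposreal _ Hr2). intros q' [H1 H2]. apply K.
    change (Rabs (@fst R R q' - @fst R R q) < r / 2) in H1.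
    change (Rabs (@snd R R q' - @snd R R q) < r / 2) in H2.
    unfold dist1. lra.
Qed.

Lemma continuous_curve (c : R -> R * R) (t : R) :
  continuous c t <->
  forall e, 0 < e -> exists d, 0 < d /\
    forall s, Rabs (s - t) < d -> dist1 (c s) (c t) < e.
Proof.
  split.
  - intros H e He.
    assert (Hl : locally (c t) (fun q => dist1 q (c t) < e)).
    { assert (He2 : 0 < e / 2) by lra.
      exists (mkposreal _ He2). intros q [H1 H2].
      change (Rabs (@fst R R q - @fst R R (c t)) < e / 2) in H1.
      change (Rabs (@snd R R q - @snd R R (c t)) < e / 2) in H2.
      unfold dist1. lra. }
    destruct (H _ Hl) as [d Hd]. exists d. split; [apply cond_pos|].
    intros s Hs. apply (Hd s). exact Hs.
  - intros H P [e He].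
    destruct (H e (cond_pos e)) as [d [Hd K]].
    exists (mkposreal d Hd). intros s Hs. apply He. specialize (K s Hs). split.
    + apply Rle_lt_trans with (2 := K). exact (dist1_fst (c s) (c t)).
    + apply Rle_lt_trans with (2 := K). exact (dist1_snd (c s) (c t)).
Qed.

Lemma continuous_coordinate pi (c : R -> R * R) t :
  coordinate pi -> continuous c t -> continuous (fun s => pi (c s)) t.
Proof.
  intros Hpi H. apply continuous_eps. intros e He.
  destruct (proj1 (continuous_curve c t) H e He) as [d [Hd K]].
  exists d. split; [exact Hd|]. intros s Hs.
  eapply Rle_lt_trans; [|exact (K s Hs)]. now apply dist1_coordinate.
Qed.

Lemma continuous_curve_fst (c : R -> R * R) t :
  continuous c t -> continuous (fun s => fst (c s)) t.
Proof. apply (continuous_coordinate fst). now left. Qed.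

Lemma continuous_curve_snd (c : R -> R * R) t :
  continuous c t -> continuous (fun s => snd (c s)) t.
Proof. apply (continuous_coordinate snd). now right. Qed.

Lemma velocity_coordinate pi (c : R -> R * R) t w :
  coordinate pi -> velocity c t w -> is_derive (fun s => pi (c s)) t (pi w).
Proof. intros [->| ->] [H1 H2]; assumption. Qed.

Lemma continuous_dist1 (c1 c2 : R -> R * R) t :
  continuous c1 t -> continuous c2 t ->
  continuous (fun s => dist1 (c1 s) (c2 s)) t.
Proof.
  intros H1 H2. apply continuous_eps. intros e He.
  destruct (proj1 (continuous_curve c1 t) H1 (e / 2)) as [d1 [Hd1 K1]]; [lra|].
  destruct (proj1 (continuous_curve c2 t) H2 (e / 2)) as [d2 [Hd2 K2]]; [lra|].
  exists (Rmin d1 d2). split; [now apply Rmin_pos|]. intros s Hs.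
  apply Rlt_min in Hs. specialize (K1 s (proj1 Hs)). specialize (K2 s (proj2 Hs)).
  generalize (dist1_triangle (c1 s) (c1 t) (c2 s)) (dist1_triangle (c1 t) (c2 t) (c2 s))
    (dist1_triangle (c1 t) (c1 s) (c2 t)) (dist1_triangle (c1 s) (c2 s) (c2 t)).
  rewrite (dist1_sym (c2 t) (c2 s)), (dist1_sym (c1 t) (c1 s)). intros.
  apply Rabs_def1; lra.
Qed.

Lemma velocity_continuous (c : R -> R * R) t w : velocity c t w -> continuous c t.
Proof.
  intros [H1 H2].
  assert (C1 : continuous (fun s => fst (c s)) t).
  { apply ex_derive_continuous_R. now exists (fst w). }
  assert (C2 : continuous (fun s => snd (c s)) t).
  { apply ex_derive_continuous_R. now exists (snd w). }
  apply continuous_curve. intros e He.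
  destruct (proj1 (continuous_eps _ t) C1 (e / 2)) as [d1 [Hd1 K1]]; [lra|].
  destruct (proj1 (continuous_eps _ t) C2 (e / 2)) as [d2 [Hd2 K2]]; [lra|].
  exists (Rmin d1 d2). split; [now apply Rmin_pos|]. intros s Hs.
  apply Rlt_min in Hs. specialize (K1 s (proj1 Hs)). specialize (K2 s (proj2 Hs)).
  unfold dist1. lra.
Qed.

Lemma velocity_unique (c : R -> R * R) t w w' :
  velocity c t w -> velocity c t w' -> w = w'.
Proof.
  intros [H1 H2] [H1' H2']. destruct w as [w1 w2], w' as [w1' w2']; simpl in *.
  apply is_derive_unique in H1, H2, H1', H2'. congruence.
Qed.

Lemma velocity_shift (c : R -> R * R) t T w :
  velocity c (t + T) w -> velocity (fun s => c (s + T)) t w.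
Proof.
  intros [H1 H2].
  assert (Hs : is_derive (fun s => s + T) t 1).
  { auto_derive; [exact I|ring]. }
  split.
  - evar_last; [exact (is_derive_comp (fun s => fst (c s)) (fun s => s + T) t _ _ H1 Hs)|].
    exact (Rmult_1_l _).
  - evar_last; [exact (is_derive_comp (fun s => snd (c s)) (fun s => s + T) t _ _ H2 Hs)|].
    exact (Rmult_1_l _).
Qed.

Lemma velocity_locally (c c' : R -> R * R) t w d :
  0 < d -> (forall s, Rabs (s - t) < d -> c' s = c s) ->
  velocity c t w -> velocity c' t w.
Proof.
  intros Hd E [H1 H2].
  split; [apply is_derive_ext_loc with (2 := H1)|apply is_derive_ext_loc with (2 := H2)];
    exists (mkposreal d Hd); intros s Hs; now rewrite E.
Qed.

Lemma continuous_shift (c : R -> R * R) T :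
  (forall t, continuous c t) -> forall t, continuous (fun s => c (s + T)) t.
Proof.
  intros H t. apply continuous_curve. intros e He.
  destruct (proj1 (continuous_curve c (t + T)) (H (t + T)) e He) as [d [Hd K]].
  exists d. split; [exact Hd|]. intros s Hs. apply K.
  now replace (s + T - (t + T)) with (s - t) by ring.
Qed.

(** * Geometric sequences *)

Lemma pow_half_pos n : 0 < (1 / 2) ^ n.
Proof. apply pow_lt. lra. Qed.

Lemma pow_half_small e : 0 < e -> exists n, (1 / 2) ^ n < e.
Proof.
  intros He. destruct (pow_lt_1_zero (1 / 2)) with e as [N HN]; [rewrite Rabs_pos_eq; lra|exact He|].
  exists N. specialize (HN N (le_n N)). now rewrite Rabs_pos_eq in HN by (left; apply pow_half_pos).
Qed.

(** Replaces passages to the limit: an estimate along geometrically converging approximations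
    carries over to their limit. *)
Lemma le_geometric a b c : (forall n, a <= b + c * (1 / 2) ^ n) -> a <= b.
Proof.
  intros H. destruct (Rle_dec a b) as [|Hn]; [assumption|exfalso].
  destruct (pow_half_small ((a - b) / (Rabs c + 1))) as [n Hk].
  { apply Rdiv_lt_0_compat; [lra|]. generalize (Rabs_pos c). lra. }
  specialize (H n). assert (Hp := pow_half_pos n). assert (Hc := Rle_abs c).
  assert (Hc0 := Rabs_pos c).
  apply (Rmult_lt_compat_l (Rabs c + 1)) in Hk; [|lra].
  replace ((Rabs c + 1) * ((a - b) / (Rabs c + 1))) with (a - b) in Hk by (field; lra).
  nra.
Qed.

Lemma geometric_limit (u : nat -> R) B :
  (forall n, Rabs (u (S n) - u n) <= B * (1 / 2) ^ n) ->
  exists l, forall n, Rabs (u n - l) <= 2 * B * (1 / 2) ^ n.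
Proof.
  intros H.
  assert (HB : 0 <= B).
  { specialize (H O). simpl in H. generalize (Rabs_pos (u 1%nat - u O)). lra. }
  assert (Hk : forall n k, Rabs (u (n + k)%nat - u n) <= 2 * B * ((1 / 2) ^ n - (1 / 2) ^ (n + k))).
  { intros n k. induction k as [|k IH].
    - rewrite Nat.add_0_r, !Rminus_diag, Rabs_R0. lra.
    - rewrite Nat.add_succ_r.
      replace (u (S (n + k)) - u n) with ((u (S (n + k)) - u (n + k)%nat) + (u (n + k)%nat - u n)) by ring.
      eapply Rle_trans; [apply Rabs_triang|].
      specialize (H (n + k)%nat). simpl. lra. }
  assert (Hk' : forall n k, Rabs (u (n + k)%nat - u n) <= 2 * B * (1 / 2) ^ n).
  { intros n k. specialize (Hk n k). generalize (pow_half_pos (n + k)). intros. nra. }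
  assert (Hcv : Cauchy_crit u).
  { intros e He. destruct (pow_half_small (e / (4 * B + 1))) as [N HN].
    { apply Rdiv_lt_0_compat; lra. }
    exists N. intros n m Hn Hm.
    assert (E1 := Hk' N (n - N)%nat). assert (E2 := Hk' N (m - N)%nat).
    replace (N + (n - N))%nat with n in E1 by lia.
    replace (N + (m - N))%nat with m in E2 by lia.
    unfold Rdist. replace (u n - u m) with ((u n - u N) - (u m - u N)) by ring.
    eapply Rle_lt_trans; [apply Rabs_triang|]. rewrite Rabs_Ropp.
    apply (Rmult_lt_compat_l (4 * B + 1)) in HN; [|lra].
    replace ((4 * B + 1) * (e / (4 * B + 1))) with e in HN by (field; lra).
    assert (Hp := pow_half_pos N). nra. }
  destruct (Rcomplete.R_complete u Hcv) as [l Hl].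
  exists l. intros n. apply le_epsilon. intros e He.
  destruct (Hl e He) as [N HN].
  specialize (HN (n + N)%nat). unfold Rdist in HN. specialize (Hk' n N).
  assert (Hlt : Rabs (u (n + N)%nat - l) < e) by (apply HN; lia).
  replace (u n - l) with (- (u (n + N)%nat - u n) + (u (n + N)%nat - l)) by ring.
  eapply Rle_trans; [apply Rabs_triang|]. rewrite Rabs_Ropp. lra.
Qed.

Lemma geometric_limit_plane (q : nat -> R * R) B :
  (forall n, dist1 (q (S n)) (q n) <= B * (1 / 2) ^ n) ->
  exists l, forall n, dist1 (q n) l <= 4 * B * (1 / 2) ^ n.
Proof.
  intros H.
  destruct (geometric_limit (fun n => fst (q n)) B) as [l1 H1].
  { intros n. eapply Rle_trans; [apply dist1_fst|apply H]. }
  destruct (geometric_limit (fun n => snd (q n)) B) as [l2 H2].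
  { intros n. eapply Rle_trans; [apply dist1_snd|apply H]. }
  exists (l1, l2). intros n. specialize (H1 n). specialize (H2 n).
  unfold dist1. simpl in *. lra.
Qed.

(** * Ordinary differential equations in the plane *)

Definition lipschitz_field (L : R) (F : R * R -> R * R) : Prop :=
  forall p q, dist1 (F p) (F q) <= L * dist1 p q.

Lemma is_derive_reverse (f : R -> R) d t :
  is_derive f (- t) d -> is_derive (fun s => f (- s)) t (- d).
Proof.
  intros D. auto_derive; [now exists d|]. use_derive D. ring.
Qed.

(** Integration gains the factor 1 / lam in the norm weighted by exp (- lam |t|), which makes the
    Picard operator contract on the whole line at once. *)
Lemma growth_bound (u : R -> R) K lam t :
  0 < lam -> 0 <= K ->
  (forall s, exists d, is_derive u s d /\ Rabs d <= K * exp (lam * Rabs s)) ->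
  Rabs (u t - u 0) <= K / lam * exp (lam * Rabs t).
Proof.
  intros Hl HK.
  assert (Hpos : forall v t, 0 <= t ->
    (forall s, 0 <= s -> exists d, is_derive v s d /\ d <= K * exp (lam * s)) ->
    v t - v 0 <= K / lam * exp (lam * t)).
  { clear t. intros v t Ht H.
    set (w := fun s => v s - K / lam * exp (lam * s)).
    assert (Hw : w t - w 0 <= 0 * (t - 0)).
    { apply increment_le; [exact Ht| |].
      - intros s Hs. destruct (H s) as [d [D Hd]]; [lra|].
        exists (d - K * exp (lam * s)). split; [|lra].
        unfold w. auto_derive; [now exists d|]. use_derive D. field. lra.
      - intros s Hs. destruct (H s) as [d [D Hd]]; [lra|].
        apply ex_derive_continuous_R.
        unfold w. auto_derive. now exists d. }
    unfold w in Hw. rewrite Rmult_0_r, exp_0 in Hw.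
    assert (0 <= K / lam) by (apply Rdiv_le_0_compat; lra). lra. }
  assert (Habs : forall v t, 0 <= t ->
    (forall s, 0 <= s -> exists d, is_derive v s d /\ Rabs d <= K * exp (lam * s)) ->
    Rabs (v t - v 0) <= K / lam * exp (lam * t)).
  { clear t. intros v t Ht H. apply Rabs_le. split.
    - enough (- v t - - v 0 <= K / lam * exp (lam * t)) by lra.
      apply (Hpos (fun s => - v s)); [exact Ht|].
      intros s Hs. destruct (H s Hs) as [d [D Hd]]. exists (- d).
      split; [apply (is_derive_opp v s d D)|].
      apply Rabs_le_between in Hd. lra.
    - apply Hpos; [exact Ht|]. intros s Hs. destruct (H s Hs) as [d [D Hd]].
      exists d. split; [exact D|]. apply Rabs_le_between in Hd. lra. }
  intros H. destruct (Rle_dec 0 t) as [Ht|Ht].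
  - rewrite (Rabs_pos_eq t Ht). apply Habs; [exact Ht|]. intros s Hs.
    destruct (H s) as [d Hd]. exists d. now rewrite (Rabs_pos_eq s Hs) in Hd.
  - rewrite (Rabs_left1 t) by lra.
    generalize (Habs (fun s => u (- s)) (- t)). simpl.
    rewrite Ropp_involutive, Ropp_0. intros K1. apply K1; [lra|].
    intros s Hs. destruct (H (- s)) as [d [D Hd]]. exists (- d). split.
    + now apply is_derive_reverse.
    + rewrite Rabs_Ropp. now rewrite Rabs_Ropp, (Rabs_pos_eq s Hs) in Hd.
Qed.

Definition picard (F : R * R -> R * R) (q0 : R * R) (y : R -> R * R) (t : R) : R * R :=
  (fst q0 + RInt (fun s => fst (F (y s))) 0 t,
   snd q0 + RInt (fun s => snd (F (y s))) 0 t).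

Definition lipschitz_curve (K : R) (y : R -> R * R) : Prop :=
  forall s t, dist1 (y s) (y t) <= K * Rabs (s - t).

Lemma picard_velocity F L q0 K y t :
  0 <= L -> lipschitz_field L F -> lipschitz_curve K y ->
  velocity (picard F q0 y) t (F (y t)).
Proof.
  intros HL HF Hy.
  assert (Hint : forall (c : R) (f : R -> R), (forall s, continuous f s) ->
    is_derive (fun t => c + RInt f 0 t) t (f t)).
  { intros c f Hf. evar_last.
    - apply (is_derive_plus (fun _ : R => c) (fun t => RInt f 0 t)).
      + apply is_derive_const.
      + apply (is_derive_RInt f (fun t => RInt f 0 t) 0 t).
        * apply filter_forall. intros x. apply (@RInt_correct R_CompleteNormedModule).
          apply (@ex_RInt_continuous R_CompleteNormedModule). intros; apply Hf.
        * apply Hf.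
    - apply (@plus_zero_l R_AbelianMonoid). }
  assert (Hc : forall pi, coordinate pi -> forall s, continuous (fun s => pi (F (y s))) s).
  { intros pi Hpi. apply lipschitz_continuous with (L * K). intros s s'.
    eapply Rle_trans; [now apply dist1_coordinate|]. eapply Rle_trans; [apply HF|].
    rewrite Rmult_assoc. apply Rmult_le_compat_l; [exact HL|apply Hy]. }
  split.
  - apply (Hint (fst q0) (fun s => fst (F (y s)))), (Hc fst). now left.
  - apply (Hint (snd q0) (fun s => snd (F (y s)))), (Hc snd). now right.
Qed.

Lemma picard_0 F q0 y : picard F q0 y 0 = q0.
Proof.
  unfold picard. rewrite !RInt_point. unfold zero; simpl. rewrite !Rplus_0_r. now destruct q0.
Qed.

Lemma velocity_lipschitz (y : R -> R * R) M :
  (forall t, exists w, velocity y t w /\ dist1 w (0, 0) <= M) ->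
  lipschitz_curve (2 * M) y.
Proof.
  intros H.
  assert (Hle : forall s t, s <= t -> dist1 (y t) (y s) <= 2 * M * (t - s)).
  { intros s t Hst.
    replace (2 * M * (t - s)) with (2 * (M * (t - s))) by ring.
    apply dist1_le. intros pi Hpi.
    apply (increment_abs_le (fun r => pi (y r))); [exact Hst| |]; intros x _;
      destruct (H x) as [w [D Hw]].
    - exists (pi w). split; [now apply velocity_coordinate|].
      eapply Rle_trans; [|exact Hw]. generalize (dist1_coordinate pi w (0, 0) Hpi).
      destruct Hpi as [->| ->]; simpl; now rewrite Rminus_0_r.
    - apply continuous_coordinate; [exact Hpi|]. now apply velocity_continuous with w. }
  intros s t. destruct (Rle_dec s t) as [Hst|Hst].
  - rewrite dist1_sym, Rabs_left1 by lra. replace (- (s - t)) with (t - s) by ring.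
    now apply Hle.
  - rewrite Rabs_pos_eq by lra. apply Hle. lra.
Qed.

(** With 4 L <= lam each coordinate contributes L C / lam <= C / 4, and the two coordinates together
    C / 2. *)
Lemma picard_close F L q0 K y z C lam :
  0 <= L -> 0 < lam -> 4 * L <= lam -> 0 <= C ->
  lipschitz_field L F -> lipschitz_curve K y -> lipschitz_curve K z ->
  (forall t, dist1 (y t) (z t) <= C * exp (lam * Rabs t)) ->
  forall t, dist1 (picard F q0 y t) (picard F q0 z t) <= C / 2 * exp (lam * Rabs t).
Proof.
  intros HL Hlam HLl HC HF Hy Hz Hd t.
  assert (E : L * C / lam <= C / 4).
  { apply Rmult_le_reg_r with lam; [exact Hlam|].
    replace (L * C / lam * lam) with (L * C) by (field; lra). nra. }
  assert (He := exp_pos (lam * Rabs t)).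
  assert (HLC : 0 <= L * C) by now apply Rmult_le_pos.
  assert (Hs : forall s, L * dist1 (y s) (z s) <= L * C * exp (lam * Rabs s)).
  { intros s. rewrite Rmult_assoc. apply Rmult_le_compat_l; [exact HL|apply Hd]. }
  replace (C / 2 * exp (lam * Rabs t)) with (2 * (C / 4 * exp (lam * Rabs t))) by field.
  apply dist1_le. intros pi Hpi.
  apply Rle_trans with (L * C / lam * exp (lam * Rabs t)); [|apply Rmult_le_compat_r; lra].
  generalize (growth_bound (fun s => pi (picard F q0 y s) - pi (picard F q0 z s)) (L * C) lam t Hlam HLC).
  rewrite !picard_0, Rminus_diag, Rminus_0_r. intros G. apply G. intros s.
  exists (pi (F (y s)) - pi (F (z s))). split.
  - apply (is_derive_minus (fun s => pi (picard F q0 y s)) (fun s => pi (picard F q0 z s)));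
      (apply velocity_coordinate; [exact Hpi|]); apply (picard_velocity F L q0 K); assumption.
  - eapply Rle_trans; [now apply dist1_coordinate|]. eapply Rle_trans; [apply HF|apply Hs].
Qed.

(** Picard iteration in the weighted norm, so that no continuation of local solutions is needed. The
    bound M makes all iterates and their limit 2 M-Lipschitz, which gives the continuity of the
    integrands. *)
Lemma ode_existence F L M q0 :
  lipschitz_field L F -> (forall q, dist1 (F q) (0, 0) <= M) ->
  exists y, y 0 = q0 /\ forall t, velocity y t (F (y t)).
Proof.
  intros HF HM.
  assert (HL : 0 <= L).
  { specialize (HF (1, 0) (0, 0)). unfold dist1 at 2 in HF. simpl in HF.
    rewrite !Rminus_0_r, Rabs_R1, Rabs_R0 in HF.
    generalize (dist1_pos (F (1, 0)) (F (0, 0))). lra. }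
  assert (HM0 : 0 <= M) by (eapply Rle_trans; [apply dist1_pos|apply (HM (0, 0))]).
  set (lam := 4 * L + 1). assert (Hlam : 0 < lam) by (unfold lam; lra).
  set (Y := fun n => Nat.iter n (picard F q0) (fun _ => q0)).
  assert (HY : forall n, lipschitz_curve (2 * M) (Y n)).
  { induction n as [|n IH].
    - intros s t. simpl. rewrite dist1_refl.
      apply Rmult_le_pos; [lra|apply Rabs_pos].
    - apply velocity_lipschitz. intros t. exists (F (Y n t)). split; [|apply HM].
      apply picard_velocity with L (2 * M); assumption. }
  set (C0 := 2 * M / lam).
  assert (HC0 : 0 <= C0) by (apply Rdiv_le_0_compat; lra).
  assert (Hstep : forall n t, dist1 (Y (S n) t) (Y n t) <= C0 * (1 / 2) ^ n * exp (lam * Rabs t)).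
  { induction n as [|n IH]; intros t.
    - simpl. rewrite Rmult_1_r.
      assert (Hv := picard_velocity F L q0 (2 * M) (fun _ => q0)).
      assert (He : forall s, M <= M * exp (lam * Rabs s)).
      { intros s. rewrite <- (Rmult_1_r M) at 1. apply Rmult_le_compat_l; [exact HM0|].
        rewrite <- exp_0. apply exp_le. apply Rmult_le_pos; [lra|apply Rabs_pos]. }
      unfold C0. replace (2 * M / lam * exp (lam * Rabs t)) with (2 * (M / lam * exp (lam * Rabs t)))
        by (field; lra).
      apply dist1_le. intros pi Hpi.
      generalize (growth_bound (fun s => pi (picard F q0 (fun _ => q0) s)) M lam t Hlam HM0).
      rewrite picard_0. intros G. apply G. intros s. exists (pi (F q0)). split.
      + apply velocity_coordinate; [exact Hpi|]. apply Hv; [exact HL|exact HF|exact (HY O)].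
      + apply Rle_trans with (2 := He s). eapply Rle_trans; [|exact (HM q0)].
        generalize (dist1_coordinate pi (F q0) (0, 0) Hpi).
        destruct Hpi as [->| ->]; simpl; now rewrite Rminus_0_r.
    - replace (C0 * (1 / 2) ^ S n) with (C0 * (1 / 2) ^ n / 2) by (simpl; field).
      apply (picard_close F L q0 (2 * M) (Y (S n)) (Y n)); try assumption.
      + unfold lam; lra.
      + apply Rmult_le_pos; [exact HC0|left; apply pow_half_pos].
      + apply (HY (S n)).
      + apply HY. }
  assert (Hlim : forall t, exists l, forall n, dist1 (Y n t) l <= 4 * (C0 * exp (lam * Rabs t)) * (1 / 2) ^ n).
  { intros t. apply geometric_limit_plane. intros n. eapply Rle_trans; [apply Hstep|].
    right. ring. }
  set (y := fun t => proj1_sig (constructive_indefinite_description _ (Hlim t))).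
  assert (Hy : forall t n, dist1 (Y n t) (y t) <= 4 * (C0 * exp (lam * Rabs t)) * (1 / 2) ^ n).
  { intros t. exact (proj2_sig (constructive_indefinite_description _ (Hlim t))). }
  clearbody y.
  assert (Hyl : lipschitz_curve (2 * M) y).
  { intros s t. apply le_geometric with
      (4 * (C0 * exp (lam * Rabs s)) + 4 * (C0 * exp (lam * Rabs t))).
    intros n. generalize (dist1_triangle (y s) (Y n s) (y t)) (dist1_triangle (Y n s) (Y n t) (y t))
      (Hy s n) (Hy t n) (HY n s t). rewrite (dist1_sym (y s) (Y n s)). lra. }
  assert (Hfix : forall t, picard F q0 y t = y t).
  { intros t. apply dist1_eq0.
    apply le_geometric with (4 * C0 * exp (lam * Rabs t)). intros n.
    assert (H1 := Hy t (S n)).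
    assert (H2 : dist1 (picard F q0 y t) (Y (S n) t) <= 4 * C0 * (1 / 2) ^ n / 2 * exp (lam * Rabs t)).
    { apply (picard_close F L q0 (2 * M) y (Y n)); try assumption.
      - unfold lam; lra.
      - apply Rmult_le_pos; [lra|left; apply pow_half_pos].
      - apply HY.
      - intros s. rewrite dist1_sym. eapply Rle_trans; [apply Hy|]. right; ring. }
    generalize (dist1_triangle (picard F q0 y t) (Y (S n) t) (y t)).
    replace ((1 / 2) ^ S n) with ((1 / 2) ^ n / 2) in H1 by (simpl; field). lra. }
  exists y. split.
  - rewrite <- Hfix. apply picard_0.
  - intros t. apply velocity_locally with (picard F q0 y) 1; [lra| |].
    + intros s _. now rewrite Hfix.
    + apply picard_velocity with L (2 * M); assumption.
Qed.

Lemma is_derive_weighted_squares (f1 f2 f3 f4 : R -> R) d1 d2 d3 d4 k t :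
  is_derive f1 t d1 -> is_derive f2 t d2 -> is_derive f3 t d3 -> is_derive f4 t d4 ->
  is_derive (fun t => ((f1 t - f2 t) ^ 2 + (f3 t - f4 t) ^ 2) * exp (- k * t)) t
    ((2 * (f1 t - f2 t) * (d1 - d2) + 2 * (f3 t - f4 t) * (d3 - d4)
      - k * ((f1 t - f2 t) ^ 2 + (f3 t - f4 t) ^ 2)) * exp (- k * t)).
Proof.
  intros D1 D2 D3 D4. auto_derive.
  - repeat split; eexists; eassumption.
  - use_derive D1. use_derive D2. use_derive D3. use_derive D4. ring.
Qed.

(** Squares replace the l1 distance, which is not differentiable. The rate 4 |L| combines the 2 from
    differentiating squares with (x + w)^2 <= 2 (x^2 + w^2). *)
Lemma ode_uniqueness_on (F : R * R -> R * R) L (y z : R -> R * R) T :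
  0 <= T ->
  (forall t, 0 <= t <= T -> continuous y t /\ continuous z t) ->
  (forall t, 0 < t < T -> exists v w, velocity y t v /\ velocity z t w /\
     dist1 v w <= L * dist1 (y t) (z t)) ->
  y 0 = z 0 -> y T = z T.
Proof.
  intros HT Hc Hd H0.
  set (E := fun t => (fst (y t) - fst (z t)) ^ 2 + (snd (y t) - snd (z t)) ^ 2).
  assert (HL : forall a b c d : R, Rabs a + Rabs b <= L * (Rabs c + Rabs d) ->
    2 * c * a + 2 * d * b <= 4 * Rabs L * (c ^ 2 + d ^ 2)).
  { intros a b c d Hab.
    assert (A := Rabs_pos a). assert (B := Rabs_pos b).
    assert (C := Rabs_pos c). assert (D := Rabs_pos d).
    assert (Hl := Rle_abs L). assert (Hl0 := Rabs_pos L).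
    assert (Hca : c * a <= Rabs c * Rabs a) by (rewrite <- Rabs_mult; apply Rle_abs).
    assert (Hdb : d * b <= Rabs d * Rabs b) by (rewrite <- Rabs_mult; apply Rle_abs).
    rewrite <- (pow2_abs c), <- (pow2_abs d).
    assert (Rabs a + Rabs b <= Rabs L * (Rabs c + Rabs d)) by nra.
    set (x := Rabs c) in *. set (w := Rabs d) in *. set (l := Rabs L) in *.
    assert (x * Rabs a + w * Rabs b <= (x + w) * (l * (x + w))).
    { apply Rle_trans with ((x + w) * (Rabs a + Rabs b)); [nra|].
      apply Rmult_le_compat_l; lra. }
    assert ((x + w) * (x + w) <= 2 * (x ^ 2 + w ^ 2)).
    { generalize (pow2_ge_0 (x - w)). nra. }
    assert (l * ((x + w) * (x + w)) <= l * (2 * (x ^ 2 + w ^ 2))) by (apply Rmult_le_compat_l; lra).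
    lra. }
  set (u := fun t => E t * exp (- (4 * Rabs L) * t)).
  assert (Hu : u T - u 0 <= 0 * (T - 0)).
  { apply increment_le; [exact HT| |].
    - intros t Ht. destruct (Hd t Ht) as [v [w [[D1 D2] [[D3 D4] Hle]]]].
      exists ((2 * (fst (y t) - fst (z t)) * (fst v - fst w)
        + 2 * (snd (y t) - snd (z t)) * (snd v - snd w) - 4 * Rabs L * E t)
        * exp (- (4 * Rabs L) * t)).
      split.
      + unfold u, E.
        apply (is_derive_weighted_squares (fun t => fst (y t)) (fun t => fst (z t))
          (fun t => snd (y t)) (fun t => snd (z t))); assumption.
      + specialize (HL (fst v - fst w) (snd v - snd w) _ _ Hle). unfold E.
        generalize (exp_pos (- (4 * Rabs L) * t)). intros. nra.
    - intros t Ht. destruct (Hc t Ht) as [C1 C2]. unfold u, E.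
      assert (K1 := continuous_curve_fst _ _ C1). assert (K2 := continuous_curve_snd _ _ C1).
      assert (K3 := continuous_curve_fst _ _ C2). assert (K4 := continuous_curve_snd _ _ C2).
      assert (S1 := continuous_minus _ _ _ K1 K3). assert (S2 := continuous_minus _ _ _ K2 K4).
      apply (continuous_mult (fun t => (fst (y t) - fst (z t)) ^ 2 + (snd (y t) - snd (z t)) ^ 2)).
      + apply (continuous_ext (fun t => (fst (y t) - fst (z t)) * (fst (y t) - fst (z t)) +
          (snd (y t) - snd (z t)) * (snd (y t) - snd (z t)))).
        { intros x. match goal with |- @eq _ ?a ?b => change (@eq R a b) end. ring. }
        exact (continuous_plus _ _ _ (continuous_mult _ _ _ S1 S1) (continuous_mult _ _ _ S2 S2)).
      + apply ex_derive_continuous_R. auto_derive. exact I. }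
  unfold u in Hu. assert (E0 : E 0 = 0) by (unfold E; rewrite H0; ring).
  rewrite E0 in Hu.
  assert (HE : E T <= 0).
  { generalize (exp_pos (- (4 * Rabs L) * T)). intros. nra. }
  unfold E in HE.
  destruct (y T) as [a b], (z T) as [c d]; simpl fst in *; simpl snd in *.
  assert (A := pow2_ge_0 (a - c)). assert (B := pow2_ge_0 (b - d)).
  f_equal; apply Rminus_diag_uniq, Rsqr_0_uniq; unfold Rsqr; nra.
Qed.

Lemma velocity_reverse (c : R -> R * R) t w :
  velocity c (- t) w -> velocity (fun s => c (- s)) t (- fst w, - snd w).
Proof.
  intros [H1 H2]. split; simpl.
  - now apply (is_derive_reverse (fun s => fst (c s))).
  - now apply (is_derive_reverse (fun s => snd (c s))).
Qed.

Lemma ode_uniqueness F L (y z : R -> R * R) :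
  lipschitz_field L F ->
  (forall t, velocity y t (F (y t))) -> (forall t, velocity z t (F (z t))) ->
  y 0 = z 0 -> forall t, y t = z t.
Proof.
  intros HF Hy Hz H0 t. destruct (Rle_dec 0 t) as [Ht|Ht].
  - apply (ode_uniqueness_on F L); [exact Ht| | |exact H0].
    + intros s _. split; eapply velocity_continuous; [apply Hy|apply Hz].
    + intros s _. exists (F (y s)), (F (z s)). split; [apply Hy|]. split; [apply Hz|apply HF].
  - replace t with (- - t) by ring.
    apply (ode_uniqueness_on F L (fun s => y (- s)) (fun s => z (- s))); [lra| | |].
    + intros s _. split; eapply velocity_continuous; apply velocity_reverse; [apply Hy|apply Hz].
    + intros s _. eexists. eexists. split; [apply velocity_reverse, Hy|].
      split; [apply velocity_reverse, Hz|].
      eapply Rle_trans; [|apply HF]. unfold dist1; simpl.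
      rewrite <- (Rabs_Ropp (fst (F (y (- s))) - _)), <- (Rabs_Ropp (snd (F (y (- s))) - _)).
      right. apply (f_equal2 Rplus); apply (f_equal Rabs); simpl; ring.
    + now rewrite Ropp_0.
Qed.

(** * Lipschitz estimates for the fields *)

Lemma continuous_plane (f : R * R -> R) (q : R * R) :
  continuous f q <->
  forall e, 0 < e -> exists d, 0 < d /\
    forall p, dist1 p q < d -> Rabs (f p - f q) < e.
Proof.
  split.
  - intros H e He.
    assert (Hl : locally (f q) (fun z => Rabs (z - f q) < e)).
    { exists (mkposreal e He). intros z Hz. exact Hz. }
    destruct (H _ Hl) as [d Hd]. exists d. split; [apply cond_pos|].
    intros p Hp. apply (Hd p). split.
    + apply Rle_lt_trans with (2 := Hp). exact (dist1_fst p q).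
    + apply Rle_lt_trans with (2 := Hp). exact (dist1_snd p q).
  - intros H P [e He].
    destruct (H e (cond_pos e)) as [d [Hd K]].
    assert (Hd2 : 0 < d / 2) by lra.
    exists (mkposreal _ Hd2). intros p [H1 H2]. apply He. apply K.
    change (Rabs (@fst R R p - @fst R R q) < d / 2) in H1.
    change (Rabs (@snd R R p - @snd R R q) < d / 2) in H2.
    unfold dist1. lra.
Qed.

Lemma segment_lipschitz (f : R -> R) M x y :
  (forall z, Rmin x y <= z <= Rmax x y -> ex_derive f z /\ Rabs (Derive f z) <= M) ->
  Rabs (f x - f y) <= M * Rabs (x - y).
Proof.
  revert x y.
  assert (Hle : forall x y, x <= y ->
    (forall z, Rmin x y <= z <= Rmax x y -> ex_derive f z /\ Rabs (Derive f z) <= M) ->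
    Rabs (f y - f x) <= M * Rabs (y - x)).
  { intros x y Hxy H. rewrite (Rabs_pos_eq (y - x)) by lra.
    rewrite Rmin_left, Rmax_right in H by lra.
    apply increment_abs_le; [exact Hxy| |].
    - intros z Hz. destruct (H z) as [[d D] Hb]; [lra|]. exists d.
      split; [exact D|]. now rewrite (is_derive_unique _ _ _ D) in Hb.
    - intros z Hz. apply ex_derive_continuous_R.
      now apply H. }
  intros x y H. destruct (Rle_dec x y) as [Hxy|Hxy].
  - rewrite Rabs_minus_sym, (Rabs_minus_sym x). now apply Hle.
  - apply Hle; [lra|]. now rewrite Rmin_comm, Rmax_comm.
Qed.

(** The path from [p] to [p'] turns at (fst p', snd p), which may leave the l1 ball of radius r but
    not the one of radius 2 r. *)
Lemma partials_lipschitz (f : R * R -> R) q r M :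
  (forall p, dist1 p q < 2 * r ->
     (ex_derive (fun t => f (t, snd p)) (fst p) /\
      ex_derive (fun t => f (fst p, t)) (snd p)) /\
     Rabs (dx f p) <= M /\ Rabs (dy f p) <= M) ->
  forall p p', dist1 p q < r -> dist1 p' q < r ->
  Rabs (f p - f p') <= M * dist1 p p'.
Proof.
  intros H p p' Hp Hp'. unfold dist1 in *.
  assert (Hbet : forall a b c z, Rabs (a - c) < r -> Rabs (b - c) < r ->
    Rmin a b <= z <= Rmax a b -> Rabs (z - c) < r).
  { intros a b c z Ha Hb Hz. apply Rabs_lt_between in Ha, Hb. apply Rabs_lt_between.
    unfold Rmin, Rmax in Hz. destruct (Rle_dec a b); lra. }
  assert (A1 := Rabs_pos (fst p - fst q)). assert (A2 := Rabs_pos (snd p - snd q)).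
  assert (A3 := Rabs_pos (fst p' - fst q)). assert (A4 := Rabs_pos (snd p' - snd q)).
  assert (H1 : Rabs (f (fst p, snd p) - f (fst p', snd p)) <= M * Rabs (fst p - fst p')).
  { apply (segment_lipschitz (fun t => f (t, snd p))). intros z Hz.
    assert (Hzq : Rabs (z - fst q) < r) by (apply (Hbet (fst p) (fst p')); lra).
    destruct (H (z, snd p)) as [[D _] [B _]]; [simpl; lra|]. now split. }
  assert (H2 : Rabs (f (fst p', snd p) - f (fst p', snd p')) <= M * Rabs (snd p - snd p')).
  { apply (segment_lipschitz (fun t => f (fst p', t))). intros z Hz.
    assert (Hzq : Rabs (z - snd q) < r) by (apply (Hbet (snd p) (snd p')); lra).
    destruct (H (fst p', z)) as [[_ D] [_ B]]; [simpl; lra|]. now split. }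
  rewrite <- !surjective_pairing in H1, H2.
  replace (f p - f p') with ((f p - f (fst p', snd p)) + (f (fst p', snd p) - f p')) by ring.
  eapply Rle_trans; [apply Rabs_triang|]. lra.
Qed.

Lemma C1_locally_lipschitz (U : R * R -> Prop) (f : R * R -> R) q :
  open U -> U q ->
  (forall p, U p -> ex_derive (fun t => f (t, snd p)) (fst p) /\
                    ex_derive (fun t => f (fst p, t)) (snd p)) ->
  (forall p, U p -> continuous (dx f) p) -> (forall p, U p -> continuous (dy f) p) ->
  exists r L, 0 < r /\ 0 <= L /\
    forall p p', dist1 p q < r -> dist1 p' q < r -> Rabs (f p - f p') <= L * dist1 p p'.
Proof.
  intros HU Hq Hd Hx Hy.
  destruct (proj1 (open_dist1 U) HU q Hq) as [r0 [Hr0 K0]].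
  destruct (proj1 (continuous_plane _ q) (Hx q Hq) 1) as [r1 [Hr1 K1]]; [lra|].
  destruct (proj1 (continuous_plane _ q) (Hy q Hq) 1) as [r2 [Hr2 K2]]; [lra|].
  set (r := Rmin r0 (Rmin r1 r2)).
  assert (Hr : 0 < r /\ r <= r0 /\ r <= r1 /\ r <= r2).
  { unfold r. split; [repeat apply Rmin_pos; assumption|].
    split; [apply Rmin_l|]. split; (eapply Rle_trans; [apply Rmin_r|]); [apply Rmin_l|apply Rmin_r]. }
  set (L := 1 + Rabs (dx f q) + Rabs (dy f q)).
  exists (r / 2), L. split; [lra|].
  assert (A := Rabs_pos (dx f q)). assert (B := Rabs_pos (dy f q)).
  split; [unfold L; lra|].
  apply partials_lipschitz. intros p Hp.
  split; [apply Hd, K0; lra|].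
  assert (C1 : Rabs (dx f p - dx f q) < 1) by (apply K1; lra).
  assert (C2 : Rabs (dy f p - dy f q) < 1) by (apply K2; lra).
  generalize (Rabs_triang_inv (dx f p) (dx f q)) (Rabs_triang_inv (dy f p) (dy f q)).
  unfold L. lra.
Qed.

(** At a successor order [Ck] speaks of partial derivatives only; the continuity of [f] comes from
    the Lipschitz bound that continuous partial derivatives provide. *)
Lemma Ck_continuous k U f : open U -> Ck k U f -> forall q, U q -> continuous f q.
Proof.
  intros HU. revert f. induction k as [|k IH]; intros f Hf q Hq; [now apply Hf|].
  destruct Hf as [Hd [Hx Hy]].
  destruct (C1_locally_lipschitz U f q HU Hq Hd) as [r [L [Hr [HL K]]]]; try now apply IH.
  apply continuous_plane. intros e He.
  exists (Rmin r (e / (L + 1))). split.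
  - apply Rmin_pos; [exact Hr|]. apply Rdiv_lt_0_compat; lra.
  - intros p Hp.
    destruct (Rlt_min _ _ _ Hp) as [Hp1 Hp2].
    eapply Rle_lt_trans; [apply K; [exact Hp1|rewrite dist1_refl; exact Hr]|].
    apply (Rmult_lt_compat_l (L + 1)) in Hp2; [|lra].
    replace ((L + 1) * (e / (L + 1))) with e in Hp2 by (field; lra).
    generalize (dist1_pos p q). lra.
Qed.

Definition lipschitz_near (X : R * R -> R * R) (q : R * R) (r L : R) : Prop :=
  forall p p', dist1 p q < r -> dist1 p' q < r -> dist1 (X p) (X p') <= L * dist1 p p'.

Lemma Ck_field_lipschitz_near k U X q :
  open U -> Ck_field (S k) U X -> U q ->
  exists r L, 0 < r /\ 0 <= L /\ lipschitz_near X q r L.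
Proof.
  intros HU [[Hd1 [Hx1 Hy1]] [Hd2 [Hx2 Hy2]]] Hq.
  destruct (C1_locally_lipschitz U (fun q => fst (X q)) q HU Hq Hd1) as [r1 [L1 [Hr1 [HL1 K1]]]];
    try (now apply Ck_continuous with k).
  destruct (C1_locally_lipschitz U (fun q => snd (X q)) q HU Hq Hd2) as [r2 [L2 [Hr2 [HL2 K2]]]];
    try (now apply Ck_continuous with k).
  exists (Rmin r1 r2), (L1 + L2). split; [now apply Rmin_pos|]. split; [lra|].
  intros p p' Hp Hp'.
  destruct (Rlt_min _ _ _ Hp) as [A B].
  destruct (Rlt_min _ _ _ Hp') as [A' B'].
  specialize (K1 p p' A A'). specialize (K2 p p' B B'). unfold dist1 at 1. lra.
Qed.

(** * Tubes around a curve and Lipschitz extension of a field *)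

Definition tube (g : R -> R * R) (r : R) (q : R * R) : Prop :=
  exists t, dist1 q (g t) < r.

Lemma distance_to_curve (g : R -> R * R) :
  exists d : R * R -> R,
    (forall p q, Rabs (d p - d q) <= dist1 p q) /\
    (forall q t, d q <= dist1 q (g t)) /\
    (forall q r, d q < r -> tube g r q).
Proof.
  (* The infimum of the distances is taken as minus the supremum of their opposites, the form in
     which [completeness] applies. *)
  assert (Hsup : forall q, exists m, is_lub (fun x => exists t, x = - dist1 q (g t)) m).
  { intros q. destruct (completeness (fun x => exists t, x = - dist1 q (g t))) as [m Hm].
    - exists 0. intros x [t ->]. generalize (dist1_pos q (g t)). lra.
    - eexists. now exists 0.
    - now exists m. }
  set (d := fun q => - proj1_sig (constructive_indefinite_description _ (Hsup q))).
  assert (Hd : forall q, is_lub (fun x => exists t, x = - dist1 q (g t)) (- d q)).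
  { intros q. unfold d. rewrite Ropp_involutive. apply proj2_sig. }
  clearbody d. exists d.
  assert (Hle : forall q t, d q <= dist1 q (g t)).
  { intros q t. destruct (Hd q) as [Hub _].
    enough (- dist1 q (g t) <= - d q) by lra. apply Hub. now exists t. }
  assert (Htube : forall q r, d q < r -> tube g r q).
  { intros q r Hr. apply NNPP. intros Hn.
    destruct (Hd q) as [_ Hlub]. assert (- d q <= - r); [|lra].
    apply Hlub. intros x [t ->]. apply Ropp_le_contravar, Rnot_lt_le.
    intros Hlt. apply Hn. now exists t. }
  split; [|split; assumption].
  assert (Hone : forall p q, d p - d q <= dist1 p q).
  { intros p q. apply le_epsilon. intros e He.
    destruct (Htube q (d q + e)) as [t Ht]; [lra|].
    generalize (Hle p t) (dist1_triangle p q (g t)). lra. }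
  intros p q. apply Rabs_le. generalize (Hone p q) (Hone q p).
  rewrite (dist1_sym q p). lra.
Qed.

(** The factor [chi] is 1 on the tube of radius r and 0 beyond 2 r. If one point lies in the tube of
    radius 2 r and the other is closer to it than r, both lie in a ball of radius 3 r where F is
    Lipschitz; points farther apart are handled by the bound M. *)
Lemma lipschitz_cutoff (g : R -> R * R) (F : R * R -> R * R) r L M :
  0 < r ->
  (forall t, lipschitz_near F (g t) (3 * r) L) ->
  (forall q, tube g (3 * r) q -> dist1 (F q) (0, 0) <= M) ->
  exists G L', lipschitz_field L' G /\ (forall q, dist1 (G q) (0, 0) <= M) /\
    forall q, tube g r q -> G q = F q.
Proof.
  intros Hr HL HM.
  assert (HM0 : 0 <= M).
  { eapply Rle_trans; [apply dist1_pos|apply (HM (g 0))]. exists 0. rewrite dist1_refl. lra. }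
  destruct (distance_to_curve g) as [d [Hlip [Hle Htube]]].
  set (chi := fun q => Rmax 0 (Rmin 1 (2 - d q / r))).
  assert (Hchi01 : forall q, 0 <= chi q <= 1).
  { intros q. unfold chi. split; [apply Rmax_l|]. apply Rmax_lub; [lra|apply Rmin_l]. }
  assert (Hchi : forall p q, Rabs (chi p - chi q) <= / r * dist1 p q).
  { intros p q. apply Rle_trans with (Rabs (2 - d p / r - (2 - d q / r))).
    - unfold chi. generalize (2 - d p / r) (2 - d q / r). intros x y.
      unfold Rmax, Rmin.
      destruct (Rle_dec 1 x); destruct (Rle_dec 1 y);
        repeat match goal with |- context [Rle_dec ?a ?b] => destruct (Rle_dec a b) end;
        unfold Rabs; repeat destruct Rcase_abs; lra.
    - replace (2 - d p / r - (2 - d q / r)) with (- (/ r * (d p - d q))) by (field; lra).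
      assert (Hi : 0 < / r) by now apply Rinv_0_lt_compat.
      rewrite Rabs_Ropp, Rabs_mult, (Rabs_pos_eq (/ r)) by lra.
      apply Rmult_le_compat_l; [lra|apply Hlip]. }
  assert (Hout : forall q, 2 * r <= d q -> chi q = 0).
  { intros q Hq. unfold chi. apply Rmax_left.
    assert (2 <= d q / r).
    { apply Rmult_le_reg_r with r; [exact Hr|].
      replace (d q / r * r) with (d q) by (field; lra). lra. }
    eapply Rle_trans; [apply Rmin_r|]. lra. }
  set (G := fun q => (chi q * fst (F q), chi q * snd (F q))).
  assert (HG0 : forall q, chi q = 0 -> G q = (0, 0)).
  { intros q H. unfold G. rewrite H. now rewrite !Rmult_0_l. }
  assert (HGM : forall q, dist1 (G q) (0, 0) <= M).
  { intros q. destruct (Rle_dec (2 * r) (d q)) as [Hq|Hq].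
    - rewrite HG0 by now apply Hout. now rewrite dist1_refl.
    - assert (HF : dist1 (F q) (0, 0) <= M) by (apply HM, Htube; lra).
      unfold dist1, G in *; simpl in *. rewrite !Rminus_0_r in *.
      rewrite !Rabs_mult, (Rabs_pos_eq (chi q)) by apply Hchi01.
      specialize (Hchi01 q). assert (A := Rabs_pos (fst (F q))). assert (B := Rabs_pos (snd (F q))).
      nra. }
  assert (Hir : 0 < / r) by now apply Rinv_0_lt_compat.
  assert (HL0 : 0 <= Rabs L) by apply Rabs_pos.
  set (L' := 2 * M * / r + Rabs L).
  assert (HrM : 0 <= M * / r) by (apply Rmult_le_pos; lra).
  assert (Hnear : forall p q, d p < 2 * r -> dist1 (G p) (G q) <= L' * dist1 p q).
  { intros p q Hp. assert (Hpq := dist1_pos p q).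
    destruct (Rle_dec r (dist1 p q)) as [Hfar|Hclose].
    - apply Rle_trans with (2 * M).
      + generalize (dist1_triangle (G p) (0, 0) (G q)) (HGM p) (HGM q).
        rewrite (dist1_sym (0, 0) (G q)). lra.
      + unfold L'.
        assert (1 <= / r * dist1 p q).
        { apply Rmult_le_reg_l with r; [exact Hr|].
          rewrite <- Rmult_assoc, Rinv_r by lra. lra. }
        nra.
    - destruct (Htube p _ Hp) as [t Ht].
      assert (Hq : dist1 q (g t) < 3 * r).
      { generalize (dist1_triangle q p (g t)). rewrite (dist1_sym q p). lra. }
      assert (HF := HL t p q ltac:(lra) Hq).
      assert (HFp : dist1 (F p) (0, 0) <= M) by (apply HM; exists t; lra).
      assert (Hc := Hchi p q). assert (Hc01 := Hchi01 q).
      assert (Hone : forall u v, Rabs (chi p * u - chi q * v) <=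
        / r * dist1 p q * Rabs u + Rabs (u - v)).
      { intros u v.
        replace (chi p * u - chi q * v) with ((chi p - chi q) * u + chi q * (u - v)) by ring.
        eapply Rle_trans; [apply Rabs_triang|]. rewrite !Rabs_mult, (Rabs_pos_eq (chi q)) by lra.
        apply Rplus_le_compat.
        - apply Rmult_le_compat_r; [apply Rabs_pos|exact Hc].
        - generalize (Rabs_pos (u - v)). nra. }
      assert (H1 := Hone (fst (F p)) (fst (F q))). assert (H2 := Hone (snd (F p)) (snd (F q))).
      unfold dist1 in HFp. simpl in HFp. rewrite !Rminus_0_r in HFp.
      assert (Hs : dist1 (G p) (G q) <= / r * dist1 p q * (Rabs (fst (F p)) + Rabs (snd (F p)))
        + dist1 (F p) (F q)).
      { unfold dist1 at 1. unfold dist1 at 2. simpl. lra. }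
      assert (Hlab := Rle_abs L).
      assert (0 <= / r * dist1 p q) by (apply Rmult_le_pos; lra).
      unfold L'.
      assert (/ r * dist1 p q * (Rabs (fst (F p)) + Rabs (snd (F p))) <= / r * dist1 p q * M)
        by (apply Rmult_le_compat_l; lra).
      nra. }
  exists G, L'. split; [|split; [exact HGM|]].
  - intros p q. destruct (Rlt_dec (d p) (2 * r)) as [Hp|Hp]; [now apply Hnear|].
    destruct (Rlt_dec (d q) (2 * r)) as [Hq|Hq].
    + rewrite dist1_sym, (dist1_sym p). now apply Hnear.
    + rewrite !HG0 by (apply Hout; lra). rewrite dist1_refl.
      apply Rmult_le_pos; [|apply dist1_pos]. unfold L'. lra.
  - intros q [t Ht].
    assert (Hc : chi q = 1).
    { unfold chi. assert (Hq := Hle q t).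
      assert (d q / r <= 1).
      { apply Rmult_le_reg_r with r; [exact Hr|].
        replace (d q / r * r) with (d q) by (field; lra). lra. }
      rewrite Rmin_left by lra. apply Rmax_right. lra. }
    unfold G. rewrite Hc, !Rmult_1_l. now rewrite <- surjective_pairing.
Qed.

(** * The regularized field *)

Definition blend (b : R) (u v : R * R) : R * R :=
  (b * fst u + (1 - b) * fst v, b * snd u + (1 - b) * snd v).

(** [beta] is the weight of the upper field. Its monotonicity is the source of the one-sided
    estimates, and K / eps enters the Lipschitz constant of the regularized field. *)
Definition transition_weight (K : R) (beta : R -> R) : Prop :=
  (forall s t, Rabs (beta s - beta t) <= K * Rabs (s - t)) /\
  (forall s t, s <= t -> beta s <= beta t) /\
  (forall s, s <= -1 -> beta s = 0) /\
  (forall s, 1 <= s -> beta s = 1).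

Lemma transition_weight_bounds K beta s : transition_weight K beta -> 0 <= beta s <= 1.
Proof.
  intros [_ [Hm [H0 H1]]].
  rewrite <- (H0 (Rmin s (-1))) at 1 by apply Rmin_r.
  rewrite <- (H1 (Rmax s 1)) by apply Rmax_r.
  split; apply Hm; [apply Rmin_l|apply Rmax_l].
Qed.

Lemma monotonic_transition_weight r Phi :
  monotonic_transition r Phi ->
  exists K, transition_weight K (fun s => (1 + Phi s) / 2).
Proof.
  intros [phi [Hsm [H1 [Hm1 [_ [Hpos [Hin Hout]]]]]]].
  assert (Hd : forall s, ex_derive phi s) by (intros s; apply (Hsm 1%nat s)).
  assert (Hdd : forall s, ex_derive (Derive phi) s) by (intros s; apply (Hsm 2%nat s)).
  (* [Phi] is [phi] composed with the clamping to [-1, 1], so bounds on [phi] over [-1, 1]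
     suffice. *)
  set (cl := fun s => Rmax (-1) (Rmin 1 s)).
  assert (Hcl : forall s, -1 <= cl s <= 1).
  { intros s. unfold cl. split; [apply Rmax_l|]. apply Rmax_lub; [lra|apply Rmin_l]. }
  assert (HPhi : forall s, Phi s = phi (cl s)).
  { intros s. destruct (Rle_dec (Rabs s) 1) as [Hs|Hs].
    - rewrite Hin by exact Hs. apply Rabs_le_between in Hs.
      unfold cl. now rewrite Rmin_right, Rmax_right by lra.
    - rewrite Hout by lra. destruct (Rle_dec 0 s) as [Hp|Hp].
      + rewrite Rabs_pos_eq in Hs by lra. unfold cl. rewrite Rmin_left, Rmax_right by lra.
        rewrite H1. apply sign_eq_1. lra.
      + rewrite Rabs_left1 in Hs by lra. unfold cl. rewrite Rmin_right, Rmax_left by lra.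
        rewrite Hm1. apply sign_eq_m1. lra. }
  destruct (continuity_ab_maj (fun s => Rabs (Derive phi s)) (-1) 1) as [z [Hz _]]; [lra| |].
  { intros s _. apply continuity_pt_filterlim.
    apply (continuous_comp (Derive phi) Rabs); [|apply continuous_Rabs].
    apply ex_derive_continuous_R, Hdd. }
  set (K := Rabs (Derive phi z)) in *.
  assert (HK : 0 <= K) by apply Rabs_pos.
  assert (Hbet : forall s t u, Rmin (cl s) (cl t) <= u <= Rmax (cl s) (cl t) -> -1 <= u <= 1).
  { intros s t u Hu. generalize (Hcl s) (Hcl t). revert Hu. unfold Rmin, Rmax.
    destruct (Rle_dec (cl s) (cl t)); lra. }
  exists K. repeat split.
  - intros s t. rewrite !HPhi.
    replace ((1 + phi (cl s)) / 2 - (1 + phi (cl t)) / 2) with ((phi (cl s) - phi (cl t)) / 2) by field.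
    assert (E1 : Rabs (phi (cl s) - phi (cl t)) <= K * Rabs (cl s - cl t)).
    { apply segment_lipschitz. intros u Hu. split; [apply Hd|]. apply Hz. now apply (Hbet s t). }
    assert (E2 : Rabs (cl s - cl t) <= Rabs (s - t)).
    { unfold cl, Rmax, Rmin. destruct (Rle_dec 1 s); destruct (Rle_dec 1 t);
      repeat match goal with |- context [Rle_dec ?a ?b] => destruct (Rle_dec a b) end;
        unfold Rabs; repeat destruct Rcase_abs; lra. }
    unfold Rdiv. rewrite Rabs_mult, (Rabs_pos_eq (/ 2)) by lra.
    apply (Rmult_le_compat_l K) in E2; [|exact HK]. generalize (Rabs_pos (phi (cl s) - phi (cl t))). lra.
  - intros s t Hst. rewrite !HPhi.
    assert (Hc : cl s <= cl t).
    { unfold cl. apply Rle_max_compat_l, Rle_min_compat_l, Hst. }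
    enough (0 * (cl t - cl s) <= phi (cl t) - phi (cl s)) by lra.
    apply increment_ge; [exact Hc| |].
    + intros u Hu. exists (Derive phi u). split; [apply Derive_correct, Hd|].
      left. apply Hpos. generalize (Hcl s) (Hcl t). lra.
    + intros u _. apply ex_derive_continuous_R, Hd.
  - intros s Hs. rewrite HPhi. unfold cl. rewrite Rmin_right, Rmax_left by lra. rewrite Hm1. field.
  - intros s Hs. rewrite HPhi. unfold cl. rewrite Rmin_left, Rmax_right by lra. rewrite H1. field.
Qed.

Lemma regularization_blend D Xp Xm Phi eps q :
  regularization (Pws D snd Xp Xm) Phi eps q =
  blend ((1 + Phi (snd q / eps)) / 2) (Xp q) (Xm q).
Proof. unfold regularization, blend. simpl. f_equal; field. Qed.

(** * Curves as graphs in linear coordinates *)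

Definition lin (v q : R * R) : R := fst v * fst q + snd v * snd q.

Lemma lin_continuous v (c : R -> R * R) t :
  continuous c t -> continuous (fun s => lin v (c s)) t.
Proof.
  intros H. unfold lin.
  apply (continuous_plus (fun s => fst v * fst (c s)) (fun s => snd v * snd (c s))).
  - apply (continuous_scal_r (fst v) (fun s => fst (c s))). now apply continuous_curve_fst.
  - apply (continuous_scal_r (snd v) (fun s => snd (c s))). now apply continuous_curve_snd.
Qed.

Lemma lin_velocity v (c : R -> R * R) t u :
  velocity c t u -> is_derive (fun s => lin v (c s)) t (lin v u).
Proof.
  intros [H1 H2]. unfold lin.
  apply (is_derive_plus (fun s => fst v * fst (c s)) (fun s => snd v * snd (c s))).
  - now apply (is_derive_scal (fun s => fst (c s))).
  - now apply (is_derive_scal (fun s => snd (c s))).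
Qed.

(** Linear coordinates that are bi-Lipschitz with one constant. On a line where [lin v] is constant
    the third inequality bounds distances by [w] alone. *)
Definition chart (v w : R * R) (C : R) : Prop :=
  forall p q,
    Rabs (lin v p - lin v q) <= C * dist1 p q /\
    Rabs (lin w p - lin w q) <= C * dist1 p q /\
    dist1 p q <= C * (Rabs (lin v p - lin v q) + Rabs (lin w p - lin w q)).

Lemma lin_lipschitz v p q :
  Rabs (lin v p - lin v q) <= dist1 v (0, 0) * dist1 p q.
Proof.
  unfold lin, dist1. simpl. rewrite !Rminus_0_r.
  replace (fst v * fst p + snd v * snd p - (fst v * fst q + snd v * snd q))
    with (fst v * (fst p - fst q) + snd v * (snd p - snd q)) by ring.
  eapply Rle_trans; [apply Rabs_triang|]. rewrite !Rabs_mult.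
  generalize (Rabs_pos (fst v)) (Rabs_pos (snd v)) (Rabs_pos (fst p - fst q))
    (Rabs_pos (snd p - snd q)). intros. nra.
Qed.

Lemma chart_exists v w : det2 v w <> 0 -> exists C, 1 <= C /\ chart v w C.
Proof.
  intros Hdet. set (D := Rabs (det2 v w)).
  assert (HD : 0 < D) by now apply Rabs_pos_lt.
  set (n := dist1 v (0, 0) + dist1 w (0, 0)).
  assert (Hn : 0 <= dist1 v (0, 0)) by apply dist1_pos.
  assert (Hm : 0 <= dist1 w (0, 0)) by apply dist1_pos.
  assert (HnD : 0 <= n / D) by (apply Rdiv_le_0_compat; unfold n; lra).
  exists (1 + n + n / D). split; [unfold n in *; lra|].
  intros p q. assert (Hd := dist1_pos p q).
  assert (H1 := lin_lipschitz v p q). assert (H2 := lin_lipschitz w p q).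
  split; [|split].
  - eapply Rle_trans; [exact H1|]. apply Rmult_le_compat_r; [exact Hd|unfold n in *; lra].
  - eapply Rle_trans; [exact H2|]. apply Rmult_le_compat_r; [exact Hd|unfold n in *; lra].
  - set (x := lin v p - lin v q). set (y := lin w p - lin w q).
    (* Cramer's rule. *)
    assert (E1 : det2 v w * (fst p - fst q) = snd w * x - snd v * y)
      by (unfold det2, x, y, lin; ring).
    assert (E2 : det2 v w * (snd p - snd q) = fst v * y - fst w * x)
      by (unfold det2, x, y, lin; ring).
    assert (HDd : D * dist1 p q <= n * (Rabs x + Rabs y)).
    { unfold dist1 at 1, D. rewrite Rmult_plus_distr_l, <- !Rabs_mult, E1, E2.
      assert (A1 := Rabs_triang (snd w * x) (- (snd v * y))).
      assert (A2 := Rabs_triang (fst v * y) (- (fst w * x))).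
      rewrite Rabs_Ropp, !Rabs_mult in A1, A2.
      unfold n, dist1. simpl. rewrite !Rminus_0_r.
      unfold Rminus at 1 2.
      generalize (Rabs_pos x) (Rabs_pos y) (Rabs_pos (fst v)) (Rabs_pos (snd v))
        (Rabs_pos (fst w)) (Rabs_pos (snd w)). intros. nra. }
    apply Rle_trans with (n / D * (Rabs x + Rabs y)).
    + apply Rmult_le_reg_l with D; [exact HD|].
      replace (D * (n / D * (Rabs x + Rabs y))) with (n * (Rabs x + Rabs y)) by (field; lra).
      exact HDd.
    + apply Rmult_le_compat_r; [generalize (Rabs_pos x) (Rabs_pos y); lra|].
      unfold n in *; lra.
Qed.

Lemma is_derive_eps (f : R -> R) x l :
  is_derive f x l <->
  forall e, 0 < e -> exists d, 0 < d /\
    forall y, Rabs (y - x) < d -> Rabs (f y - f x - l * (y - x)) <= e * Rabs (y - x).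
Proof.
  rewrite is_derive_Reals. split.
  - intros H e He. destruct (H e He) as [d Hd]. exists d. split; [apply cond_pos|].
    intros y Hy. destruct (Req_dec y x) as [->|Hne].
    + replace (f x - f x - l * (x - x)) with 0 by ring. rewrite Rabs_R0.
      apply Rmult_le_pos; [lra|apply Rabs_pos].
    + assert (Hh : y - x <> 0) by lra.
      specialize (Hd (y - x) Hh Hy). replace (x + (y - x)) with y in Hd by ring.
      replace (f y - f x - l * (y - x)) with (((f y - f x) / (y - x) - l) * (y - x))
        by (field; exact Hh).
      rewrite Rabs_mult. apply Rmult_le_compat_r; [apply Rabs_pos|lra].
  - intros H e He. destruct (H (e / 2)) as [d [Hd K]]; [lra|].
    exists (mkposreal d Hd). intros h Hh Hhd. simpl in Hhd.
    specialize (K (x + h)). replace (x + h - x) with h in K by ring. specialize (K Hhd).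
    assert (Hp : 0 < Rabs h) by now apply Rabs_pos_lt.
    replace ((f (x + h) - f x) / h - l) with ((f (x + h) - f x - l * h) / h) by (field; exact Hh).
    unfold Rdiv. rewrite Rabs_mult, Rabs_inv.
    apply Rle_lt_trans with (e / 2); [|lra].
    apply Rmult_le_reg_r with (Rabs h); [exact Hp|].
    rewrite Rmult_assoc, Rinv_l by lra. lra.
Qed.

(** The Lipschitz bound on [tau] turns the remainder of [phi], small against tau x - t, into one
    that is small against x - phi t. *)
Lemma is_derive_inverse_function (phi tau : R -> R) t c0 l d :
  0 < c0 -> 0 < l -> 0 < d -> is_derive phi t l ->
  (forall x y, Rabs (tau x - tau y) <= / c0 * Rabs (x - y)) ->
  (forall x, Rabs (x - phi t) < d -> phi (tau x) = x) -> tau (phi t) = t ->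
  is_derive tau (phi t) (/ l).
Proof.
  intros Hc Hl Hd0 Hphi Htau Hinv Ht. apply is_derive_eps. intros e He.
  assert (Hic : 0 < / c0) by now apply Rinv_0_lt_compat.
  assert (Hil : 0 < / l) by now apply Rinv_0_lt_compat.
  destruct (proj1 (is_derive_eps phi t l) Hphi (e * l * c0)) as [d1 [Hd1 K]].
  { repeat apply Rmult_lt_0_compat; assumption. }
  exists (Rmin d (d1 * c0)). split.
  { apply Rmin_pos; [exact Hd0|]. now apply Rmult_lt_0_compat. }
  intros x Hx.
  destruct (Rlt_min _ _ _ Hx) as [Hx1 Hx2].
  assert (Hs := Htau x (phi t)). rewrite Ht in *.
  assert (Hs1 : Rabs (tau x - t) < d1).
  { eapply Rle_lt_trans; [exact Hs|]. apply Rmult_lt_reg_l with c0; [exact Hc|].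
    rewrite <- Rmult_assoc, Rinv_r by lra. lra. }
  specialize (K (tau x) Hs1). rewrite (Hinv x Hx1) in K.
  replace (tau x - t - / l * (x - phi t))
    with (- / l * (x - phi t - l * (tau x - t))) by (field; lra).
  rewrite Rabs_mult, Rabs_Ropp, (Rabs_pos_eq (/ l)) by lra.
  apply Rle_trans with (/ l * (e * l * c0 * (/ c0 * Rabs (x - phi t)))).
  - apply Rmult_le_compat_l; [lra|]. eapply Rle_trans; [exact K|].
    apply Rmult_le_compat_l; [|exact Hs]. left. repeat apply Rmult_lt_0_compat; assumption.
  - right. field. split; lra.
Qed.

(** The curve is reparametrized by [lin v], along which it advances with speed at least c0. The
    graph function is Lipschitz on all of R, as the Gronwall lemma with a gap requires. *)
Lemma curve_graph (c : R -> R * R) (v w : R * R) a b c0 C0 :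
  a <= b -> 0 < c0 -> 0 <= C0 ->
  (forall t, continuous c t) ->
  (forall s t, a <= s <= t -> t <= b -> c0 * (t - s) <= lin v (c t) - lin v (c s)) ->
  (forall s t, a <= s <= t -> t <= b -> Rabs (lin w (c t) - lin w (c s)) <= C0 * (t - s)) ->
  exists eta : R -> R,
    (forall x y, Rabs (eta x - eta y) <= C0 / c0 * Rabs (x - y)) /\
    (forall t, a <= t <= b -> eta (lin v (c t)) = lin w (c t)) /\
    (forall x, lin v (c a) <= x <= lin v (c b) ->
       exists t, a <= t <= b /\ lin v (c t) = x) /\
    (forall t u, a < t < b -> velocity c t u -> 0 < lin v u ->
       is_derive eta (lin v (c t)) (lin w u / lin v u)).
Proof.
  intros Hab Hc0 HC0 Hc HV HW.
  set (A := lin v (c a)). set (B := lin v (c b)).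
  assert (HAB : A <= B).
  { generalize (HV a b ltac:(lra) ltac:(lra)). unfold A, B. nra. }
  assert (Hivt : forall x, A <= x <= B -> exists t, a <= t <= b /\ lin v (c t) = x).
  { intros x Hx.
    destruct (IVT_gen (fun t => lin v (c t)) a b x) as [t [Ht E]].
    - intros t. apply continuity_pt_filterlim. apply (lin_continuous v c t), Hc.
    - fold A B. now rewrite Rmin_left, Rmax_right by lra.
    - rewrite Rmin_left, Rmax_right in Ht by lra. now exists t. }
  (* Beyond its end points the graph is continued by constants. *)
  set (cl := fun x => Rmax A (Rmin B x)).
  assert (Hcl : forall x, A <= cl x <= B).
  { intros x. unfold cl. split; [apply Rmax_l|]. apply Rmax_lub; [lra|apply Rmin_l]. }
  assert (Hcl1 : forall x, A <= x <= B -> cl x = x).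
  { intros x Hx. unfold cl. now rewrite Rmin_right, Rmax_right by lra. }
  assert (Hcl2 : forall x y, Rabs (cl x - cl y) <= Rabs (x - y)).
  { intros x y. unfold cl, Rmax, Rmin. destruct (Rle_dec B x); destruct (Rle_dec B y);
      repeat match goal with |- context [Rle_dec ?a ?b] => destruct (Rle_dec a b) end;
      unfold Rabs; repeat destruct Rcase_abs; lra. }
  set (tau := fun x => proj1_sig (constructive_indefinite_description _ (Hivt (cl x) (Hcl x)))).
  assert (Htau : forall x, a <= tau x <= b /\ lin v (c (tau x)) = cl x).
  { intros x. exact (proj2_sig (constructive_indefinite_description _ (Hivt (cl x) (Hcl x)))). }
  clearbody tau.
  assert (Hic : 0 < / c0) by now apply Rinv_0_lt_compat.
  assert (Hmono : forall s t, a <= s <= b -> a <= t <= b ->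
    Rabs (s - t) <= / c0 * Rabs (lin v (c s) - lin v (c t))).
  { intros s t Hs Ht. apply Rmult_le_reg_l with c0; [exact Hc0|].
    rewrite <- Rmult_assoc, Rinv_r, Rmult_1_l by lra.
    destruct (Rle_dec s t) as [Hst|Hst].
    - assert (K := HV s t ltac:(lra) ltac:(lra)).
      rewrite (Rabs_left1 (s - t)) by lra. rewrite Rabs_minus_sym.
      eapply Rle_trans; [|apply Rle_abs]. lra.
    - assert (K := HV t s ltac:(lra) ltac:(lra)).
      rewrite (Rabs_pos_eq (s - t)) by lra.
      eapply Rle_trans; [|apply Rle_abs]. lra. }
  assert (Htl : forall x y, Rabs (tau x - tau y) <= / c0 * Rabs (x - y)).
  { intros x y. destruct (Htau x) as [Hx Ex]. destruct (Htau y) as [Hy Ey].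
    eapply Rle_trans; [apply Hmono; assumption|]. rewrite Ex, Ey.
    apply Rmult_le_compat_l; [lra|apply Hcl2]. }
  assert (Hrange : forall t, a <= t <= b -> A <= lin v (c t) <= B).
  { intros t Ht. generalize (HV a t ltac:(lra) ltac:(lra)) (HV t b ltac:(lra) ltac:(lra)).
    unfold A, B. nra. }
  assert (Hti : forall t, a <= t <= b -> tau (lin v (c t)) = t).
  { intros t Ht. destruct (Htau (lin v (c t))) as [Hx Ex].
    rewrite Hcl1 in Ex by now apply Hrange.
    assert (K := Hmono _ _ Hx Ht). rewrite Ex, Rminus_diag, Rabs_R0, Rmult_0_r in K.
    apply Rminus_diag_uniq. apply NNPP. intros Hn. apply Rabs_pos_lt in Hn. lra. }
  exists (fun x => lin w (c (tau x))). split; [|split; [|split]].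
  - intros x y. destruct (Htau x) as [Hx _]. destruct (Htau y) as [Hy _].
    apply Rle_trans with (C0 * Rabs (tau x - tau y)).
    + destruct (Rle_dec (tau x) (tau y)) as [Hst|Hst].
      * rewrite (Rabs_left1 (tau x - tau y)), Rabs_minus_sym by lra.
        replace (- (tau x - tau y)) with (tau y - tau x) by ring. apply HW; lra.
      * rewrite (Rabs_pos_eq (tau x - tau y)) by lra. apply HW; lra.
    + unfold Rdiv. rewrite Rmult_assoc. apply Rmult_le_compat_l; [exact HC0|apply Htl].
  - intros t Ht. now rewrite Hti.
  - exact Hivt.
  - intros t u Ht Hu Hpos.
    assert (HA : A < lin v (c t)).
    { generalize (HV a t ltac:(lra) ltac:(lra)). fold A. nra. }
    assert (HB : lin v (c t) < B).
    { generalize (HV t b ltac:(lra) ltac:(lra)). fold B. nra. }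
    assert (Dtau : is_derive tau (lin v (c t)) (/ lin v u)).
    { apply (is_derive_inverse_function (fun s => lin v (c s)) tau t c0 (lin v u)
        (Rmin (lin v (c t) - A) (B - lin v (c t)))); try assumption.
      - apply Rmin_pos; lra.
      - now apply lin_velocity.
      - intros x Hx. destruct (Htau x) as [_ ->]. apply Hcl1.
        destruct (Rlt_min _ _ _ Hx) as [H1 H2].
        apply Rabs_lt_between in H1, H2. lra.
      - apply Hti. lra. }
    evar_last.
    + apply (is_derive_comp (fun s => lin w (c s)) tau); [|exact Dtau].
      rewrite Hti by lra. exact (lin_velocity w c t u Hu).
    + unfold scal; simpl. unfold mult; simpl. field. lra.
Qed.

(** * Passage through flow boxes *)

(** At the exceptional time [t1] continuity is enough, since the increments before and after it add
    up. *)
Lemma curve_increments (y : R -> R * R) (v w : R * R) a b t1 c C :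
  (forall t, continuous y t) ->
  (forall t, a < t < b -> t <> t1 -> exists u, velocity y t u /\
     c <= lin v u /\ Rabs (lin v u) <= C /\ Rabs (lin w u) <= C) ->
  forall s t, a <= s <= t -> t <= b ->
  c * (t - s) <= lin v (y t) - lin v (y s) <= C * (t - s) /\
  Rabs (lin w (y t) - lin w (y s)) <= C * (t - s).
Proof.
  intros Hc Hv.
  assert (Hpart : forall s t, a <= s <= t -> t <= b -> ~ s < t1 < t ->
    c * (t - s) <= lin v (y t) - lin v (y s) <= C * (t - s) /\
    Rabs (lin w (y t) - lin w (y s)) <= C * (t - s)).
  { intros s t Hs Ht Hn.
    assert (Hx : forall x, s < x < t -> exists u, velocity y x u /\
      c <= lin v u /\ Rabs (lin v u) <= C /\ Rabs (lin w u) <= C).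
    { intros x Hx. apply Hv; [lra|]. intros ->. now apply Hn. }
    split; [split|].
    - apply (increment_ge (fun x => lin v (y x))); [lra| |].
      + intros x Ix. destruct (Hx x Ix) as [u [Hu [H1 _]]]. exists (lin v u).
        split; [now apply lin_velocity|exact H1].
      + intros x _. now apply lin_continuous.
    - apply (increment_le (fun x => lin v (y x))); [lra| |].
      + intros x Ix. destruct (Hx x Ix) as [u [Hu [_ [H1 _]]]]. exists (lin v u).
        split; [now apply lin_velocity|]. apply Rabs_le_between in H1. lra.
      + intros x _. now apply lin_continuous.
    - apply (increment_abs_le (fun x => lin w (y x))); [lra| |].
      + intros x Ix. destruct (Hx x Ix) as [u [Hu [_ [_ H1]]]]. exists (lin w u).
        split; [now apply lin_velocity|exact H1].
      + intros x _. now apply lin_continuous. }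
  intros s t Hs Ht. destruct (classic (s < t1 < t)) as [Hin|Hout].
  - destruct (Hpart s t1) as [A1 B1]; [lra|lra|lra|].
    destruct (Hpart t1 t) as [A2 B2]; [lra|lra|lra|].
    split; [lra|].
    replace (lin w (y t) - lin w (y s)) with
      ((lin w (y t) - lin w (y t1)) + (lin w (y t1) - lin w (y s))) by ring.
    eapply Rle_trans; [apply Rabs_triang|]. lra.
  - now apply Hpart.
Qed.

Section FlowBoxes.

Context (Z : R -> R * R -> R * R) (g : R -> R * R) (r0 : R).
Context (Hg : forall t, continuous g t) (Hr0 : 0 < r0).

(* Solutions are only required to follow Z eps inside the tube around g, so
   that both genuine orbits of Z eps and orbits of a globally Lipschitz
   extension of its restriction to the tube qualify. *)
Definition tube_solution (eps : R) (y : R -> R * R) : Prop :=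
  forall t, continuous y t /\ (tube g r0 (y t) -> velocity y t (Z eps (y t))).

Lemma tube_solution_shift eps y T :
  tube_solution eps y -> tube_solution eps (fun t => y (t + T)).
Proof.
  intros Hy t. split.
  - apply continuous_shift. intros s. apply Hy.
  - intros H. apply velocity_shift. now apply Hy.
Qed.

Definition slope (v w u : R * R) : R := lin w u / lin v u.

(* A neighbourhood of g t0 in which the linear form v increases along the
   orbits, seen as graphs of w over v; the bounds do not depend on eps.  The
   one-sided Lipschitz condition replaces the Lipschitz condition, whose
   constant blows up in the regularization strip. *)
Record flow_box (t0 : R) (v w : R * R) (r c C L d : R) : Prop := {
  box_r : 0 < r <= 1;
  box_c : 0 < c;
  box_C : 1 <= C;
  box_L : 0 <= L;
  box_d : 0 < d;
  box_chart : chart v w C;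
  box_speed : forall eps q, 0 < eps < r -> dist1 q (g t0) < r ->
    c <= lin v (Z eps q) /\ Rabs (lin v (Z eps q)) <= C /\
    Rabs (lin w (Z eps q)) <= C;
  box_one_sided : forall eps p q, 0 < eps < r ->
    dist1 p (g t0) < r -> dist1 q (g t0) < r -> lin v p = lin v q ->
    (lin w q - lin w p) * (slope v w (Z eps q) - slope v w (Z eps p))
      <= L * (lin w q - lin w p) ^ 2;
  box_near : forall t, Rabs (t - t0) < d -> dist1 (g t) (g t0) < r / 2;
  box_orbit : forall mu, 0 < mu -> exists e0, 0 < e0 /\
    forall eps t, 0 < eps < e0 -> mu < Rabs (t - t0) < d ->
    velocity g t (Z eps (g t))
}.

Arguments box_r {t0 v w r c C L d}.
Arguments box_c {t0 v w r c C L d}.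
Arguments box_C {t0 v w r c C L d}.
Arguments box_L {t0 v w r c C L d}.
Arguments box_d {t0 v w r c C L d}.
Arguments box_chart {t0 v w r c C L d}.
Arguments box_speed {t0 v w r c C L d}.
Arguments box_one_sided {t0 v w r c C L d}.
Arguments box_near {t0 v w r c C L d}.
Arguments box_orbit {t0 v w r c C L d}.

(** At each time other than t0 the curve g solves [Z eps] for small eps by [box_orbit], and the
    speed bounds do not depend on eps, so g inherits them. *)
Lemma box_curve t0 v w r c C L d :
  flow_box t0 v w r c C L d ->
  forall s t, t0 - d < s -> s <= t -> t < t0 + d ->
  c * (t - s) <= lin v (g t) - lin v (g s) <= C * (t - s) /\
  Rabs (lin w (g t) - lin w (g s)) <= C * (t - s).
Proof.
  intros B s t Hs Hst Ht.
  apply (curve_increments g v w s t t0); [exact Hg| |lra|lra].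
  intros x Hx Hne.
  assert (Hp : 0 < Rabs (x - t0)) by (apply Rabs_pos_lt; lra).
  assert (Hxd : Rabs (x - t0) < d) by (apply Rabs_def1; lra).
  destruct (box_orbit B (Rabs (x - t0) / 2)) as [e0 [He0 K]]; [lra|].
  assert (Hr := box_r B).
  set (eps := Rmin e0 r / 2).
  assert (Heps : 0 < eps /\ eps < e0 /\ eps < r).
  { unfold eps. assert (0 < Rmin e0 r) by (apply Rmin_pos; lra).
    generalize (Rmin_l e0 r) (Rmin_r e0 r). lra. }
  exists (Z eps (g x)). split; [apply K; lra|].
  apply (box_speed B); [lra|].
  generalize (box_near B x Hxd). lra.
Qed.

Lemma box_solution t0 v w r c C L d eps y th :
  flow_box t0 v w r c C L d -> 0 < eps < r -> tube_solution eps y ->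
  (forall t, 0 <= t <= th -> dist1 (y t) (g t0) < r /\ tube g r0 (y t)) ->
  forall s t, 0 <= s <= t -> t <= th ->
  c * (t - s) <= lin v (y t) - lin v (y s) <= C * (t - s) /\
  Rabs (lin w (y t) - lin w (y s)) <= C * (t - s).
Proof.
  (* The time -1 lies outside [0, th]: a solution has no exceptional time. *)
  intros B He Hy Hin. apply (curve_increments y v w 0 th (-1)).
  - intros t. apply Hy.
  - intros t Ht _. destruct (Hin t) as [H1 H2]; [lra|].
    exists (Z eps (y t)). split; [now apply Hy|]. now apply (box_speed B).
Qed.

(** A box has diameter at most 2, so [lin v] varies by at most 2 C and the exponent of
    [gronwall_gap] is at most 4 L C. The second factor bounds the initial deviation: C from the
    difference in [w], and C / c times C from the difference in [v] along a graph of slope at most C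
    / c. *)
Definition gain (c C L : R) : R := exp (4 * L * C) * (C + C * C / c).

Lemma gain_pos c C L : 0 < c -> 1 <= C -> 0 < gain c C L.
Proof.
  intros Hc HC. unfold gain. apply Rmult_lt_0_compat; [apply exp_pos|].
  assert (0 < C * C / c) by (apply Rdiv_lt_0_compat; nra). lra.
Qed.

(* Comparison with g: the deviation lin w y - eta (lin v y) from g obeys the
   one-sided Gronwall inequality except near t0, where g need not solve Z eps. *)
Lemma deviation_bound t0 v w r c C L d a b mu eta eps y th :
  flow_box t0 v w r c C L d ->
  t0 - d < a -> a < b -> b < t0 + d -> 0 < mu < d ->
  0 < eps < r ->
  (forall t, mu < Rabs (t - t0) < d -> velocity g t (Z eps (g t))) ->
  (forall x y, Rabs (eta x - eta y) <= C / c * Rabs (x - y)) ->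
  (forall t, a <= t <= b -> eta (lin v (g t)) = lin w (g t)) ->
  (forall x, lin v (g a) <= x <= lin v (g b) ->
     exists t, a <= t <= b /\ lin v (g t) = x) ->
  (forall t u, a < t < b -> velocity g t u -> 0 < lin v u ->
     is_derive eta (lin v (g t)) (lin w u / lin v u)) ->
  tube_solution eps y -> 0 <= th ->
  (forall t, 0 <= t <= th -> dist1 (y t) (g t0) < r /\ tube g r0 (y t)) ->
  lin v (g a) < lin v (y 0) -> lin v (y th) < lin v (g b) ->
  Rabs (lin w (y th) - eta (lin v (y th))) <=
    exp (4 * L * C) * (Rabs (lin w (y 0) - eta (lin v (y 0))) + 4 * C * C / c * mu).
Proof.
  intros B Ha Hab Hb Hmu He Horb Hlip Hval Hsur Hder Hy Hth Hin HA HB.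
  assert (Hr := box_r B). assert (Hc := box_c B).
  assert (HC := box_C B). assert (HL := box_L B).
  assert (Hinc := box_solution t0 v w r c C L d eps y th B He Hy Hin).
  assert (Hyc : forall t, continuous y t) by (intros t; apply Hy).
  destruct (curve_graph y v w 0 th c C Hth Hc ltac:(lra) Hyc) as [ey [Ely [Evy [Esy Edy]]]].
  { intros s t Hs Ht. now apply Hinc. }
  { intros s t Hs Ht. now apply Hinc. }
  set (D := fun x => ey x - eta x).
  assert (HCc : 0 < C / c) by (apply Rdiv_lt_0_compat; lra).
  assert (HV : lin v (y 0) <= lin v (y th)).
  { generalize (Hinc 0 th ltac:(lra) ltac:(lra)). nra. }
  assert (Hgap : Rabs (D (lin v (y th))) <=
    exp (2 * L * (lin v (y th) - lin v (y 0))) *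
    (Rabs (D (lin v (y 0))) + 2 * (C / c) * (lin v (g (t0 + mu)) - lin v (g (t0 - mu))))).
  { apply gronwall_gap; [exact HV|exact HL| | |].
    - generalize (box_curve t0 v w r c C L d B (t0 - mu) (t0 + mu) ltac:(lra) ltac:(lra) ltac:(lra)).
      intros [K _]. nra.
    - intros x x'. unfold D.
      replace (ey x - eta x - (ey x' - eta x')) with ((ey x - ey x') + - (eta x - eta x')) by ring.
      eapply Rle_trans; [apply Rabs_triang|]. rewrite Rabs_Ropp.
      generalize (Ely x x') (Hlip x x'). lra.
    - intros x Hx Hout.
      destruct (Esy x) as [t' [Ht' Ex]]; [lra|].
      destruct (Hsur x) as [t [Ht Ex']]; [lra|].
      assert (Hta : a < t).
      { destruct (Req_dec a t) as [<-|]; lra. }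
      assert (Htb : t < b).
      { destruct (Req_dec b t) as [<-|]; lra. }
      assert (Ht0 : 0 < t').
      { destruct (Req_dec 0 t') as [<-|]; lra. }
      assert (Htth : t' < th).
      { destruct (Req_dec th t') as [<-|]; lra. }
      (* [lin v] increases along g, so a value outside the gap is attained at a time farther than mu
         from t0. *)
      assert (Hfar : mu < Rabs (t - t0) < d).
      { split; [|apply Rabs_def1; lra]. apply Rnot_le_lt. intros Hle.
        apply Rabs_le_between in Hle.
        destruct (box_curve t0 v w r c C L d B (t0 - mu) t) as [K1 _]; [lra|lra|lra|].
        destruct (box_curve t0 v w r c C L d B t (t0 + mu)) as [K2 _]; [lra|lra|lra|].
        rewrite Ex' in *.
        assert (0 <= c * (t - (t0 - mu))) by (apply Rmult_le_pos; lra).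
        assert (0 <= c * (t0 + mu - t)) by (apply Rmult_le_pos; lra). lra. }
      assert (Hgt : dist1 (g t) (g t0) < r).
      { generalize (box_near B t (proj2 Hfar)). lra. }
      destruct (Hin t') as [Hyt Hyn]; [lra|].
      assert (S1 := box_speed B eps _ He Hgt).
      assert (S2 := box_speed B eps _ He Hyt).
      exists (slope v w (Z eps (y t')) - slope v w (Z eps (g t))). split.
      + apply (is_derive_minus ey eta).
        * rewrite <- Ex. apply Edy; [lra|now apply Hy|lra].
        * rewrite <- Ex'. apply Hder; [lra|now apply Horb|lra].
      + unfold D. replace (ey x) with (lin w (y t')) by (rewrite <- Ex; symmetry; apply Evy; lra).
        replace (eta x) with (lin w (g t)) by (rewrite <- Ex'; symmetry; apply Hval; lra).
        apply (box_one_sided B); try assumption. congruence. }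
  unfold D in Hgap. rewrite !Evy in Hgap by lra.
  eapply Rle_trans; [exact Hgap|].
  assert (Hrange : lin v (y th) - lin v (y 0) <= 2 * C).
  { destruct (Hin 0) as [I0 _]; [lra|]. destruct (Hin th) as [I1 _]; [lra|].
    destruct (box_chart B (y th) (y 0)) as [K _].
    assert (Hd2 : dist1 (y th) (y 0) <= 2).
    { generalize (dist1_triangle (y th) (g t0) (y 0)). rewrite (dist1_sym (g t0)). lra. }
    generalize (Rle_abs (lin v (y th) - lin v (y 0))). nra. }
  assert (Hm : lin v (g (t0 + mu)) - lin v (g (t0 - mu)) <= 2 * C * mu).
  { generalize (box_curve t0 v w r c C L d B (t0 - mu) (t0 + mu) ltac:(lra) ltac:(lra) ltac:(lra)).
    lra. }
  assert (Hm0 : 0 <= lin v (g (t0 + mu)) - lin v (g (t0 - mu))).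
  { generalize (box_curve t0 v w r c C L d B (t0 - mu) (t0 + mu) ltac:(lra) ltac:(lra) ltac:(lra)).
    intros [K _]. nra. }
  apply Rmult_le_compat; [left; apply exp_pos| | |].
  - apply Rplus_le_le_0_compat; [apply Rabs_pos|]. apply Rmult_le_pos; lra.
  - apply exp_le. nra.
  - apply Rplus_le_compat_l.
    replace (4 * C * C / c * mu) with (2 * (C / c) * (2 * C * mu)) by (field; lra).
    apply Rmult_le_compat_l; lra.
Qed.

(** A bootstrap: as long as the deviation from g stays below rho1 the solution is in the box and in
    the tubes, where Gronwall improves the bound to rho1 / 2. Hence the region can only be left
    through the section [lin v = lin v (g t)], which is reached because [lin v] grows at rate c. The
    start may be near any g s' with s <= s' <= t, as [follows] requires. *)
Lemma box_passage t0 v w r c C L d s t :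
  flow_box t0 v w r c C L d -> t0 - d < s -> s <= t -> t < t0 + d ->
  forall rho, 0 < rho -> exists delta, 0 < delta /\
  forall rho', 0 < rho' -> exists e0, 0 < e0 /\
  forall eps y s', 0 < eps < e0 -> tube_solution eps y -> s <= s' <= t ->
  dist1 (y 0) (g s') < delta -> lin v (y 0) <= lin v (g t) ->
  exists th, 0 <= th /\ lin v (y th) = lin v (g t) /\
    (forall x, 0 <= x <= th ->
       dist1 (y x) (g t0) < r /\ tube g r0 (y x) /\ tube g rho (y x)) /\
    dist1 (y th) (g t) <= C * gain c C L * dist1 (y 0) (g s') + rho'.
Proof.
  intros B Hs Hst Ht rho Hrho.
  assert (Hr := box_r B). assert (Hc := box_c B).
  assert (HC := box_C B). assert (HL := box_L B).
  assert (Hd := box_d B).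
  (* A margin around [s, t], so that the graph of g is also available just before the start and just
     after the section. *)
  set (a := (t0 - d + s) / 2). set (b := (t + t0 + d) / 2).
  assert (Ha : t0 - d < a < s) by (unfold a; lra).
  assert (Hb : t < b < t0 + d) by (unfold b; lra).
  destruct (curve_graph g v w a b c C ltac:(lra) Hc ltac:(lra) Hg) as [eta [Hlip [Hval [Hsur Hder]]]].
  { intros x x' H1 H2. apply (box_curve t0 v w r c C L d B); lra. }
  { intros x x' H1 H2. apply (box_curve t0 v w r c C L d B); lra. }
  (* A deviation up to rho1 means a distance up to C rho1 from g, which keeps the solution in the
     box and in both tubes. *)
  destruct (small_positive C (r / 4) C (rho / 2) C (r0 / 2) 1 1)
    as [rho1 [Hrho1 [P1 [P2 [P3 _]]]]]; try lra.
  assert (HG := gain_pos c C L Hc HC). set (G := gain c C L) in *.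
  set (E := exp (4 * L * C)). assert (HE : 0 < E) by apply exp_pos.
  set (k := C + C * C / c).
  assert (HGk : G = E * k) by reflexivity.
  assert (Hcsa : 0 < c * (s - a)) by (apply Rmult_lt_0_compat; lra).
  (* The first threshold makes the solution start after the level of g a; the second spends a
     quarter of rho1 on the initial deviation. *)
  destruct (small_positive C (c * (s - a) / 2) G (rho1 / 4) 1 1 1 1)
    as [delta [Hdelta [D1 [D2 _]]]]; try lra.
  exists delta. split; [exact Hdelta|]. intros rho' Hrho'.
  set (X := 4 * C * C / c * E).
  assert (HX : 0 < X) by (apply Rmult_lt_0_compat; [apply Rdiv_lt_0_compat; nra|exact HE]).
  (* X mu is the error caused by the gap around t0. It takes another quarter of rho1 and, after the
     factor C of the chart, at most rho'; only eps depends on mu, not delta. *)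
  destruct (small_positive 1 (d / 2) X (rho1 / 4) (C * X) rho' 1 1)
    as [mu [Hmu [M1 [M2 [M3 _]]]]]; try lra.
  destruct (box_orbit B mu) as [e0 [He0 Horb]]; [lra|].
  exists (Rmin e0 r). split; [apply Rmin_pos; lra|].
  intros eps y s' He Hy Hs' Hnear HV0.
  assert (He1 : 0 < eps < e0) by (generalize (Rmin_l e0 r); lra).
  assert (He2 : 0 < eps < r) by (generalize (Rmin_r e0 r); lra).
  set (dev := fun x => lin w (y x) - eta (lin v (y x))).
  set (d0 := dist1 (y 0) (g s')) in *.
  assert (Hd0 : 0 <= d0) by apply dist1_pos.
  assert (HCc : 0 < C / c) by (apply Rdiv_lt_0_compat; lra).
  destruct (box_chart B (y 0) (g s')) as [Q1 [Q2 _]]. fold d0 in Q1, Q2.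
  assert (Hdev0 : Rabs (dev 0) <= k * d0).
  { unfold dev.
    replace (lin w (y 0) - eta (lin v (y 0))) with
      ((lin w (y 0) - lin w (g s')) + (eta (lin v (g s')) - eta (lin v (y 0))))
      by (rewrite (Hval s') by lra; ring).
    eapply Rle_trans; [apply Rabs_triang|].
    assert (Q3 := Hlip (lin v (g s')) (lin v (y 0))). rewrite (Rabs_minus_sym (lin v (g s'))) in Q3.
    assert (Q4 : C / c * Rabs (lin v (y 0) - lin v (g s')) <= C / c * (C * d0))
      by (apply Rmult_le_compat_l; lra).
    unfold k. replace ((C + C * C / c) * d0) with (C * d0 + C / c * (C * d0)) by (field; lra). lra. }
  assert (HVa : lin v (g a) < lin v (y 0)).
  { apply Rabs_le_between in Q1.
    destruct (box_curve t0 v w r c C L d B a s') as [K _]; [lra|lra|lra|].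
    assert (C * d0 < c * (s - a) / 2).
    { apply Rlt_le_trans with (C * delta); [apply Rmult_lt_compat_l; lra|exact D1]. }
    assert (c * (s - a) <= c * (s' - a)) by (apply Rmult_le_compat_l; lra).
    lra. }
  assert (HVb : lin v (g t) < lin v (g b)).
  { destruct (box_curve t0 v w r c C L d B t b) as [K _]; [lra|lra|lra|].
    assert (0 < c * (b - t)) by (apply Rmult_lt_0_compat; lra). lra. }
  assert (HGd : E * (k * d0) <= rho1 / 4).
  { rewrite <- Rmult_assoc, <- HGk.
    apply Rle_trans with (G * delta); [apply Rmult_le_compat_l; lra|exact D2]. }
  assert (Hregion : forall x, lin v (g a) <= lin v (y x) <= lin v (g t) -> Rabs (dev x) <= rho1 ->
    dist1 (y x) (g t0) < r /\ tube g r0 (y x) /\ tube g rho (y x)).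
  { intros x Hx Hdx. destruct (Hsur (lin v (y x))) as [z [Hz Ez]]; [lra|].
    destruct (box_chart B (y x) (g z)) as [_ [_ K]].
    rewrite Ez, Rminus_diag, Rabs_R0, Rplus_0_l in K.
    assert (Hw : lin w (g z) = eta (lin v (y x))) by (rewrite <- Ez; symmetry; now apply Hval).
    rewrite Hw in K. fold (dev x) in K.
    assert (Hyz : dist1 (y x) (g z) <= C * rho1).
    { eapply Rle_trans; [exact K|]. apply Rmult_le_compat_l; lra. }
    assert (Hgz : dist1 (g z) (g t0) < r / 2).
    { apply (box_near B). apply Rabs_def1; lra. }
    split; [generalize (dist1_triangle (y x) (g z) (g t0)); lra|].
    split; exists z; lra. }
  assert (Hbound : forall th, 0 <= th ->
    (forall x, 0 <= x <= th -> lin v (g a) <= lin v (y x) <= lin v (g t) /\ Rabs (dev x) <= rho1) ->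
    Rabs (dev th) <= E * (k * d0) + X * mu).
  { intros th Hth Hin.
    eapply Rle_trans.
    - apply (deviation_bound t0 v w r c C L d a b mu eta eps y th); try assumption; try lra.
      + intros x Hx. now apply Horb.
      + intros x Hx. destruct (Hin x Hx) as [I1 I2]. destruct (Hregion x I1 I2) as [J1 [J2 _]].
        now split.
      + destruct (Hin th) as [I1 _]; lra.
    - fold E. rewrite Rmult_plus_distr_l. apply Rplus_le_compat.
      + apply Rmult_le_compat_l; [lra|exact Hdev0].
      + right. unfold X. ring. }
  assert (Hend : forall th, 0 <= th -> lin v (y th) = lin v (g t) ->
    (forall x, 0 <= x <= th -> lin v (g a) <= lin v (y x) <= lin v (g t) /\ Rabs (dev x) <= rho1) ->
    exists th, 0 <= th /\ lin v (y th) = lin v (g t) /\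
    (forall x, 0 <= x <= th ->
       dist1 (y x) (g t0) < r /\ tube g r0 (y x) /\ tube g rho (y x)) /\
    dist1 (y th) (g t) <= C * G * d0 + rho').
  { intros th Hth EV Hin. exists th. split; [exact Hth|]. split; [exact EV|]. split.
    - intros x Hx. destruct (Hin x Hx). now apply Hregion.
    - destruct (box_chart B (y th) (g t)) as [_ [_ K]].
      rewrite EV, Rminus_diag, Rabs_R0, Rplus_0_l in K.
      rewrite <- (Hval t) in K by lra. rewrite <- EV in K. fold (dev th) in K.
      assert (Hb' := Hbound th Hth Hin).
      apply (Rmult_le_compat_l C) in Hb'; [|lra]. rewrite HGk. lra. }
  destruct (Req_dec (lin v (y 0)) (lin v (g t))) as [E0|E0].
  { apply (Hend 0); [lra|exact E0|]. intros x Hx. replace x with 0 by lra. split; [lra|].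
    eapply Rle_trans; [apply Hbound|]; [lra| |lra].
    intros x' Hx'. replace x' with 0 by lra. split; [lra|].
    eapply Rle_trans; [exact Hdev0|].
    assert (H1E : 1 <= E) by (rewrite <- exp_0; apply exp_le; apply Rmult_le_pos; nra).
    assert (0 <= k * d0).
    { apply Rmult_le_pos; [|exact Hd0]. unfold k.
      assert (0 < C * C / c) by (apply Rdiv_lt_0_compat; nra). lra. }
    nra. }
  assert (Hyc : forall x, continuous y x) by (intros x; apply Hy).
  (* The three conditions defining the region are packed into the sign of one continuous
     function. *)
  set (phi := fun x => Rmax (lin v (y x) - lin v (g t))
    (Rmax (Rabs (dev x) - rho1) (lin v (g a) - lin v (y x)))).
  assert (Hphi_lt : forall x e, phi x < e <-> lin v (y x) - lin v (g t) < e /\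
    Rabs (dev x) - rho1 < e /\ lin v (g a) - lin v (y x) < e).
  { intros x e. unfold phi. split.
    - intros H. apply Rmax_Rlt in H. destruct H as [H1 H2]. now apply Rmax_Rlt in H2.
    - intros [H1 [H2 H3]]. now repeat apply Rmax_lub_lt. }
  assert (Hdevc : forall x, continuous dev x).
  { intros x. unfold dev. apply (continuous_minus (fun x => lin w (y x)) (fun x => eta (lin v (y x)))).
    - now apply lin_continuous.
    - apply (continuous_comp (fun x => lin v (y x)) eta); [now apply lin_continuous|].
      now apply lipschitz_continuous with (C / c). }
  assert (Hphic : forall x, continuous phi x).
  { intros x. apply continuous_eps. intros e0' He0'.
    destruct (proj1 (continuous_eps _ x) (lin_continuous v y x (Hyc x)) e0' He0') as [d1 [Hd1 K1]].
    destruct (proj1 (continuous_eps _ x) (Hdevc x) e0' He0') as [d2 [Hd2 K2]].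
    exists (Rmin d1 d2). split; [now apply Rmin_pos|]. intros x' Hx'.
    apply Rlt_min in Hx'. specialize (K1 x' (proj1 Hx')). specialize (K2 x' (proj2 Hx')).
    assert (K3 := Rabs_triang_inv2 (dev x') (dev x)).
    apply Rabs_lt_between in K1. apply Rabs_le_between in K3.
    apply Rabs_lt_between. unfold phi, Rmax.
    repeat match goal with |- context [Rle_dec ?p ?q] =>
      lazymatch q with context [Rle_dec] => fail | _ => destruct (Rle_dec p q) end end; lra. }
  assert (Hphi0 : phi 0 < 0).
  { apply Hphi_lt. split; [lra|]. split; [|lra].
    assert (Rabs (dev 0) <= rho1 / 4); [|lra].
    eapply Rle_trans; [exact Hdev0|].
    assert (H1E : 1 <= E) by (rewrite <- exp_0; apply exp_le; apply Rmult_le_pos; nra).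
    assert (0 <= k * d0).
    { apply Rmult_le_pos; [|exact Hd0]. unfold k.
      assert (0 < C * C / c) by (apply Rdiv_lt_0_compat; nra). lra. }
    nra. }
  (* By this time a solution still in the region would have passed the section; the summand 1 makes
     the contradiction strict. *)
  set (T := (lin v (g t) - lin v (y 0)) / c + 1).
  assert (HT : 0 <= T).
  { unfold T. assert (0 <= (lin v (g t) - lin v (y 0)) / c) by (apply Rdiv_le_0_compat; lra). lra. }
  assert (Hmono : forall th, 0 <= th ->
    (forall x, 0 <= x <= th -> lin v (g a) <= lin v (y x) <= lin v (g t) /\ Rabs (dev x) <= rho1) ->
    lin v (y 0) + c * th <= lin v (y th)).
  { intros th Hth Hin.
    destruct (box_solution t0 v w r c C L d eps y th B He2 Hy) with 0 th as [K _]; try lra.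
    intros x Hx. destruct (Hin x Hx) as [I1 I2]. destruct (Hregion x I1 I2) as [J1 [J2 _]].
    now split. }
  destruct (first_exit phi T Hphic Hphi0 HT) as [Hall|[t1 [Ht1 [Ez Hbefore]]]].
  - exfalso. assert (K := Hmono T HT).
    assert (K' : lin v (y 0) + c * T <= lin v (y T)).
    { apply K. intros x Hx. destruct (proj1 (Hphi_lt x 0) (Hall x Hx)) as [H1 [H2 H3]].
      split; lra. }
    destruct (proj1 (Hphi_lt T 0)) as [H1 _]; [apply Hall; lra|].
    replace (c * T) with (lin v (g t) - lin v (y 0) + c) in K' by (unfold T; field; lra). lra.
  - assert (Hin : forall x, 0 <= x <= t1 ->
      lin v (g a) <= lin v (y x) <= lin v (g t) /\ Rabs (dev x) <= rho1).
    { intros x Hx. destruct (Req_dec x t1) as [->|Hne].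
      - assert (H1 := Rmax_l (lin v (y t1) - lin v (g t))
          (Rmax (Rabs (dev t1) - rho1) (lin v (g a) - lin v (y t1)))).
        assert (H2 := Rmax_r (lin v (y t1) - lin v (g t))
          (Rmax (Rabs (dev t1) - rho1) (lin v (g a) - lin v (y t1)))).
        assert (H3 := Rmax_l (Rabs (dev t1) - rho1) (lin v (g a) - lin v (y t1))).
        assert (H4 := Rmax_r (Rabs (dev t1) - rho1) (lin v (g a) - lin v (y t1))).
        unfold phi in Ez. lra.
      - destruct (proj1 (Hphi_lt x 0)) as [H1 [H2 H3]]; [apply Hbefore; lra|]. lra. }
    assert (Hb' := Hbound t1 ltac:(lra) Hin). assert (Hm' := Hmono t1 ltac:(lra) Hin).
    apply (Hend t1); [lra| |exact Hin].
    assert (Hct : 0 <= c * t1) by (apply Rmult_le_pos; lra).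
    (* At the exit the two other conditions still hold strictly, by the improved deviation bound and
       the growth of [lin v]. *)
    apply NNPP. intros Hne. assert (phi t1 < 0); [|lra].
    apply Hphi_lt. destruct (Hin t1) as [I1 I2]; lra.
Qed.

End FlowBoxes.

Arguments box_r {Z g t0 v w r c C L d}.
Arguments box_c {Z g t0 v w r c C L d}.
Arguments box_C {Z g t0 v w r c C L d}.
Arguments box_L {Z g t0 v w r c C L d}.
Arguments box_d {Z g t0 v w r c C L d}.
Arguments box_chart {Z g t0 v w r c C L d}.
Arguments box_speed {Z g t0 v w r c C L d}.
Arguments box_one_sided {Z g t0 v w r c C L d}.
Arguments box_near {Z g t0 v w r c C L d}.
Arguments box_orbit {Z g t0 v w r c C L d}.

Section Links.

Context (Z : R -> R * R -> R * R) (g : R -> R * R) (r0 : R).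
Context (Hg : forall t, continuous g t) (Hr0 : 0 < r0).

(** Both curves solve [Z eps], so in contrast to the comparison with g there is no gap and no
    additive error. The values m1 and m2 are taken at the larger of the two initial values of
    [lin v], from which on both graphs are defined. *)
Lemma box_contraction t0 v w r c C L d eps (H h : R -> R) y1 y2 th1 th2 :
  flow_box Z g t0 v w r c C L d -> 0 < eps < r ->
  (forall x, is_derive H x (h x)) ->
  (forall p q, dist1 p (g t0) < r -> dist1 q (g t0) < r -> lin v p = lin v q ->
     (H (lin w q) - H (lin w p)) *
       (h (lin w q) * slope v w (Z eps q) - h (lin w p) * slope v w (Z eps p))
     <= L * (H (lin w q) - H (lin w p)) ^ 2) ->
  tube_solution Z g r0 eps y1 -> tube_solution Z g r0 eps y2 -> 0 <= th1 -> 0 <= th2 ->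
  (forall t, 0 <= t <= th1 -> dist1 (y1 t) (g t0) < r /\ tube g r0 (y1 t)) ->
  (forall t, 0 <= t <= th2 -> dist1 (y2 t) (g t0) < r /\ tube g r0 (y2 t)) ->
  lin v (y1 th1) = lin v (y2 th2) ->
  exists m1 m2,
    Rabs (m1 - lin w (y1 0)) <= C * C / c * dist1 (y1 0) (y2 0) /\
    Rabs (m2 - lin w (y2 0)) <= C * C / c * dist1 (y1 0) (y2 0) /\
    Rabs (m2 - m1) <= (C + C * C / c) * dist1 (y1 0) (y2 0) /\
    Rabs (H (lin w (y2 th2)) - H (lin w (y1 th1))) <=
      exp (4 * L * C) * Rabs (H m2 - H m1).
Proof.
  intros B He HH Hosl Hy1 Hy2 Hth1 Hth2 In1 In2 HV.
  assert (Hr := box_r B). assert (Hc := box_c B).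
  assert (HC := box_C B). assert (HL := box_L B).
  assert (Inc1 := box_solution Z g r0 t0 v w r c C L d eps y1 th1 B He Hy1 In1).
  assert (Inc2 := box_solution Z g r0 t0 v w r c C L d eps y2 th2 B He Hy2 In2).
  destruct (curve_graph y1 v w 0 th1 c C Hth1 Hc ltac:(lra)) as [e1 [El1 [Ev1 [Es1 Ed1]]]].
  { intros t; apply Hy1. } { intros s t Hs Ht. now apply Inc1. } { intros s t Hs Ht. now apply Inc1. }
  destruct (curve_graph y2 v w 0 th2 c C Hth2 Hc ltac:(lra)) as [e2 [El2 [Ev2 [Es2 Ed2]]]].
  { intros t; apply Hy2. } { intros s t Hs Ht. now apply Inc2. } { intros s t Hs Ht. now apply Inc2. }
  assert (M1 : lin v (y1 0) <= lin v (y1 th1)) by (generalize (Inc1 0 th1 ltac:(lra) ltac:(lra)); nra).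
  assert (M2 : lin v (y2 0) <= lin v (y2 th2)) by (generalize (Inc2 0 th2 ltac:(lra) ltac:(lra)); nra).
  set (m := Rmax (lin v (y1 0)) (lin v (y2 0))).
  assert (Hm : lin v (y1 0) <= m /\ lin v (y2 0) <= m /\ m <= lin v (y1 th1)).
  { unfold m. split; [apply Rmax_l|]. split; [apply Rmax_r|]. apply Rmax_lub; lra. }
  destruct (box_chart B (y1 0) (y2 0)) as [Q1 [Q2 _]].
  set (dd := dist1 (y1 0) (y2 0)) in *.
  assert (Hdd : 0 <= dd) by apply dist1_pos.
  assert (HCc : 0 < C / c) by (apply Rdiv_lt_0_compat; lra).
  assert (Hmd : Rabs (m - lin v (y1 0)) <= C * dd /\ Rabs (m - lin v (y2 0)) <= C * dd /\
    (m = lin v (y1 0) \/ m = lin v (y2 0))).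
  { assert (0 <= C * dd) by (apply Rmult_le_pos; lra).
    unfold m, Rmax. destruct (Rle_dec (lin v (y1 0)) (lin v (y2 0))).
    - rewrite Rminus_diag, Rabs_R0, Rabs_minus_sym. now repeat split; try lra; right.
    - rewrite Rminus_diag, Rabs_R0. now repeat split; try lra; left. }
  assert (E : C * C / c * dd = C / c * (C * dd)) by (field; lra).
  assert (D1 : Rabs (e1 m - lin w (y1 0)) <= C * C / c * dd).
  { rewrite E, <- (Ev1 0) by lra. eapply Rle_trans; [apply El1|].
    apply Rmult_le_compat_l; lra. }
  assert (D2 : Rabs (e2 m - lin w (y2 0)) <= C * C / c * dd).
  { rewrite E, <- (Ev2 0) by lra. eapply Rle_trans; [apply El2|].
    apply Rmult_le_compat_l; lra. }
  exists (e1 m), (e2 m). split; [exact D1|]. split; [exact D2|]. split.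
  - destruct Hmd as [_ [_ [Em|Em]]].
    + replace (e2 m - e1 m) with ((e2 m - lin w (y2 0)) - (lin w (y1 0) - lin w (y2 0)))
        by (replace (lin w (y1 0)) with (e1 m) by (rewrite Em; apply Ev1; lra); ring).
      unfold Rminus at 1. eapply Rle_trans; [apply Rabs_triang|]. rewrite Rabs_Ropp. lra.
    + replace (e2 m - e1 m) with (- (e1 m - lin w (y1 0)) - (lin w (y1 0) - lin w (y2 0)))
        by (replace (lin w (y2 0)) with (e2 m) by (rewrite Em; apply Ev2; lra); ring).
      unfold Rminus at 1. eapply Rle_trans; [apply Rabs_triang|]. rewrite !Rabs_Ropp. lra.
  - set (D := fun x => H (e2 x) - H (e1 x)).
    assert (HHc : forall x, continuous H x).
    { intros x. apply ex_derive_continuous_R. eexists; apply HH. }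
    assert (G : Rabs (D (lin v (y1 th1))) <= exp (L * (lin v (y1 th1) - m)) * Rabs (D m)).
    { apply gronwall_one_sided; [lra| |].
      - intros x _. apply (continuous_minus (fun x => H (e2 x)) (fun x => H (e1 x))).
        + apply (continuous_comp e2 H); [|apply HHc]. now apply lipschitz_continuous with (C / c).
        + apply (continuous_comp e1 H); [|apply HHc]. now apply lipschitz_continuous with (C / c).
      - intros x Hx.
        destruct (Es1 x) as [x1 [Hx1 E1]]; [lra|]. destruct (Es2 x) as [x2 [Hx2 E2]]; [lra|].
        assert (I1 : 0 < x1 < th1).
        { split; [destruct (Req_dec 0 x1) as [<-|]|destruct (Req_dec th1 x1) as [<-|]]; lra. }
        assert (I2 : 0 < x2 < th2).
        { split; [destruct (Req_dec 0 x2) as [<-|]|destruct (Req_dec th2 x2) as [<-|]]; lra. }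
        destruct (In1 x1 Hx1) as [J1 K1]. destruct (In2 x2 Hx2) as [J2 K2].
        assert (S1 := box_speed B eps _ He J1).
        assert (S2 := box_speed B eps _ He J2).
        exists (h (lin w (y2 x2)) * slope v w (Z eps (y2 x2)) -
                h (lin w (y1 x1)) * slope v w (Z eps (y1 x1))).
        assert (V1 : e1 x = lin w (y1 x1)) by (rewrite <- E1; apply Ev1; lra).
        assert (V2 : e2 x = lin w (y2 x2)) by (rewrite <- E2; apply Ev2; lra).
        split.
        + apply (is_derive_minus (fun x => H (e2 x)) (fun x => H (e1 x))).
          * rewrite (Rmult_comm (h _)). apply (is_derive_comp H e2).
            -- rewrite V2. apply HH.
            -- rewrite <- E2. apply Ed2; [lra|now apply Hy2|lra].
          * rewrite (Rmult_comm (h _)). apply (is_derive_comp H e1).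
            -- rewrite V1. apply HH.
            -- rewrite <- E1. apply Ed1; [lra|now apply Hy1|lra].
        + unfold D. rewrite V1, V2. apply Hosl; try assumption. congruence. }
    unfold D in G. rewrite (Ev1 th1) in G by lra. rewrite HV in G at 1.
    rewrite (Ev2 th2) in G by lra.
    eapply Rle_trans; [exact G|]. apply Rmult_le_compat_r; [apply Rabs_pos|]. apply exp_le.
    assert (Hrange : lin v (y1 th1) - lin v (y1 0) <= 2 * C).
    { destruct (In1 0) as [I0 _]; [lra|]. destruct (In1 th1) as [I1 _]; [lra|].
      destruct (box_chart B (y1 th1) (y1 0)) as [K _].
      assert (Hd2 : dist1 (y1 th1) (y1 0) <= 2).
      { generalize (dist1_triangle (y1 th1) (g t0) (y1 0)). rewrite (dist1_sym (g t0)). lra. }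
      generalize (Rle_abs (lin v (y1 th1) - lin v (y1 0))). nra. }
    apply Rle_trans with (L * (4 * C)); [|lra]. apply Rmult_le_compat_l; lra.
Qed.

(* delta does not depend on rho', which only constrains eps: this is what makes
   the return map send a fixed ball into itself. *)
Definition link (kappa s t : R) : Prop :=
  exists K, 0 <= K /\ forall rho, 0 < rho -> exists delta, 0 < delta /\
  forall rho', 0 < rho' -> exists e0, 0 < e0 /\ forall eps, 0 < eps < e0 ->
  exists theta : (R -> R * R) -> R,
    (forall y, tube_solution Z g r0 eps y -> dist1 (y 0) (g s) < delta ->
       0 <= theta y /\
       (forall x, 0 <= x <= theta y -> tube g rho (y x)) /\
       dist1 (y (theta y)) (g t) <= K * dist1 (y 0) (g s) + rho' /\
       (exists x, 0 <= x <= theta y /\ y x <> y 0)) /\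
    (forall y1 y2, tube_solution Z g r0 eps y1 -> tube_solution Z g r0 eps y2 ->
       dist1 (y1 0) (g s) < delta -> dist1 (y2 0) (g s) < delta ->
       dist1 (y1 (theta y1)) (y2 (theta y2)) <= kappa * dist1 (y1 0) (y2 0)).

(** Serves uniqueness: an orbit that is near g at any time of [s, t] is later carried into the ball
    around g t on which the return map contracts. *)
Definition follows (s t : R) : Prop :=
  forall rho, 0 < rho -> exists delta, 0 < delta /\ exists e0, 0 < e0 /\
  forall eps y s', 0 < eps < e0 -> tube_solution Z g r0 eps y -> s <= s' <= t ->
  dist1 (y 0) (g s') < delta -> exists x, 0 <= x /\ dist1 (y x) (g t) < rho.

(* The contraction between the ends s and t of a box may be measured after a
   change H of the transversal coordinate, which may depend on eps. *)
Definition weighted_box t0 (v w : R * R) (r L s t Ain Aout : R) : Prop :=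
  exists d0 e0, 0 < d0 /\ 0 < e0 /\ forall eps, 0 < eps < e0 ->
  exists H h : R -> R,
    (forall x, is_derive H x (h x)) /\
    (forall p q, dist1 p (g t0) < r -> dist1 q (g t0) < r -> lin v p = lin v q ->
       (H (lin w q) - H (lin w p)) *
         (h (lin w q) * slope v w (Z eps q) - h (lin w p) * slope v w (Z eps p))
       <= L * (H (lin w q) - H (lin w p)) ^ 2) /\
    (forall x x', Rabs (x - lin w (g s)) < d0 -> Rabs (x' - lin w (g s)) < d0 ->
       Rabs (H x - H x') <= Ain * Rabs (x - x')) /\
    (forall x x', Rabs (x - lin w (g t)) < d0 -> Rabs (x' - lin w (g t)) < d0 ->
       Aout * Rabs (x - x') <= Rabs (H x - H x')).

Lemma weighted_box_trivial t0 v w r c C L d s t :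
  flow_box Z g t0 v w r c C L d -> weighted_box t0 v w r L s t 1 1.
Proof.
  intros B. exists 1, r. split; [lra|]. split; [apply (box_r B)|].
  intros eps He. exists (fun x => x), (fun _ => 1).
  split; [intros x; apply (is_derive_id x)|]. split; [|split; intros; lra].
  intros p q Hp Hq E. rewrite !Rmult_1_l. now apply (box_one_sided B).
Qed.

(** The map H is Ain-Lipschitz near the entry and expands by Aout near the exit, while distances
    measured in H grow at most by the Gronwall factor; in the original coordinate this leaves Ain /
    Aout. *)
Lemma box_link t0 v w r c C L d s t Ain Aout :
  flow_box Z g t0 v w r c C L d -> t0 - d < s -> s < t -> t < t0 + d ->
  0 < Ain -> 0 < Aout -> weighted_box t0 v w r L s t Ain Aout ->
  link (C * gain c C L * (Ain / Aout)) s t.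
Proof.
  intros B Hs Hst Ht HAin HAout [d0 [e1 [Hd0 [He1 HW]]]].
  assert (Hr := box_r B). assert (Hc := box_c B).
  assert (HC := box_C B). assert (HL := box_L B).
  assert (HG := gain_pos c C L Hc HC). set (G := gain c C L) in *.
  assert (HCG : 0 < C * G) by (apply Rmult_lt_0_compat; lra).
  exists (C * G). split; [lra|]. intros rho Hrho.
  destruct (box_passage Z g r0 Hg Hr0 t0 v w r c C L d s t B Hs ltac:(lra) Ht rho Hrho)
    as [delta0 [Hdelta0 Hpass]].
  assert (Hvst : 0 < c * (t - s)) by (apply Rmult_lt_0_compat; lra).
  set (k := C + 2 * (C * C / c)).
  assert (Hk : 0 < C * C / c) by (apply Rdiv_lt_0_compat; nra).
  (* In this order: the passage applies, the start precedes the section through g t, the points m1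
     and m2 lie within d0 of the entry, and the arrivals lie within d0 of the exit. *)
  destruct (small_positive 1 delta0 C (c * (t - s) / 2) k (d0 / 2) (C * (C * G)) (d0 / 4))
    as [delta [Hdelta0' [D1 [D2 [D3 D4]]]]]; try lra.
  exists delta. split; [lra|]. intros rho' Hrho'.
  destruct (small_positive 1 rho' C (d0 / 4) 1 1 1 1) as [rho2 [Hrho2 [R1 [R2 _]]]]; try lra.
  destruct (Hpass rho2) as [e2 [He2 Hp]]; [lra|].
  exists (Rmin (Rmin e1 e2) r). split; [repeat apply Rmin_pos; lra|].
  intros eps He.
  assert (Hee : eps < e1 /\ eps < e2 /\ eps < r).
  { generalize (Rmin_l (Rmin e1 e2) r) (Rmin_r (Rmin e1 e2) r) (Rmin_l e1 e2) (Rmin_r e1 e2). lra. }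
  destruct (HW eps) as [H [h [HH [Hosl [Hin Hout]]]]]; [lra|].
  assert (HVs : forall y : R -> R * R, dist1 (y 0) (g s) < delta -> lin v (y 0) < lin v (g t)).
  { intros y Hy. destruct (box_chart B (y 0) (g s)) as [Q _].
    destruct (box_curve Z g Hg t0 v w r c C L d B s t) as [K _]; [lra|lra|lra|].
    apply Rabs_le_between in Q. assert (C * dist1 (y 0) (g s) <= C * delta)
      by (apply Rmult_le_compat_l; lra). lra. }
  set (good := fun y th => 0 <= th /\ lin v (y th) = lin v (g t) /\
    (forall x, 0 <= x <= th -> dist1 (y x) (g t0) < r /\ tube g r0 (y x) /\ tube g rho (y x)) /\
    dist1 (y th) (g t) <= C * G * dist1 (y 0) (g s) + rho2).
  assert (Hex : forall y, exists th, tube_solution Z g r0 eps y -> dist1 (y 0) (g s) < delta -> good y th).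
  { intros y. destruct (classic (tube_solution Z g r0 eps y /\ dist1 (y 0) (g s) < delta)) as [[Hy Hd]|Hn].
    - destruct (Hp eps y s) as [th Hth]; [lra|exact Hy|lra|lra|left; now apply HVs|].
      exists th. intros _ _. exact Hth.
    (* Default passage time for curves that are not nearby solutions, so that [theta] is total. *)
    - exists 0. intros Hy Hd. exfalso. now apply Hn. }
  set (theta := fun y => proj1_sig (constructive_indefinite_description _ (Hex y))).
  assert (Htheta : forall y, tube_solution Z g r0 eps y -> dist1 (y 0) (g s) < delta -> good y (theta y)).
  { intros y. exact (proj2_sig (constructive_indefinite_description _ (Hex y))). }
  clearbody theta. exists theta. split.
  - intros y Hy Hd. destruct (Htheta y Hy Hd) as [T1 [T2 [T3 T4]]].
    split; [exact T1|]. split; [intros x Hx; now apply T3|]. split; [lra|].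
    exists (theta y). split; [lra|]. intros E. generalize (HVs y Hd). rewrite <- T2, E. lra.
  - intros y1 y2 Hy1 Hy2 Hd1 Hd2.
    destruct (Htheta y1 Hy1 Hd1) as [T1 [T2 [T3 T4]]].
    destruct (Htheta y2 Hy2 Hd2) as [U1 [U2 [U3 U4]]].
    destruct (box_contraction t0 v w r c C L d eps H h y1 y2 (theta y1) (theta y2) B) as
      [m1 [m2 [A1 [A2 [A3 A4]]]]]; try assumption; try lra.
    { intros x Hx. destruct (T3 x Hx) as [J1 [J2 _]]. now split. }
    { intros x Hx. destruct (U3 x Hx) as [J1 [J2 _]]. now split. }
    set (dd := dist1 (y1 0) (y2 0)) in *.
    assert (Hdd : 0 <= dd < 2 * delta).
    { split; [apply dist1_pos|]. generalize (dist1_triangle (y1 0) (g s) (y2 0)).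
      rewrite (dist1_sym (g s)). fold dd. lra. }
    destruct (box_chart B (y1 0) (g s)) as [_ [W1 _]].
    destruct (box_chart B (y2 0) (g s)) as [_ [W2 _]].
    assert (Hkd : C * C / c * dd <= 2 * (C * C / c) * delta).
    { replace (2 * (C * C / c) * delta) with (C * C / c * (2 * delta)) by ring.
      apply Rmult_le_compat_l; lra. }
    assert (N1 : Rabs (m1 - lin w (g s)) < d0).
    { replace (m1 - lin w (g s)) with ((m1 - lin w (y1 0)) + (lin w (y1 0) - lin w (g s))) by ring.
      eapply Rle_lt_trans; [apply Rabs_triang|].
      assert (C * dist1 (y1 0) (g s) <= C * delta) by (apply Rmult_le_compat_l; lra).
      unfold k in D3. lra. }
    assert (N2 : Rabs (m2 - lin w (g s)) < d0).
    { replace (m2 - lin w (g s)) with ((m2 - lin w (y2 0)) + (lin w (y2 0) - lin w (g s))) by ring.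
      eapply Rle_lt_trans; [apply Rabs_triang|].
      assert (C * dist1 (y2 0) (g s) <= C * delta) by (apply Rmult_le_compat_l; lra).
      unfold k in D3. lra. }
    assert (I := Hin m2 m1 N2 N1).
    assert (Hend : forall y : R -> R * R, dist1 (y 0) (g s) < delta ->
      dist1 (y (theta y)) (g t) <= C * G * dist1 (y 0) (g s) + rho2 ->
      Rabs (lin w (y (theta y)) - lin w (g t)) < d0).
    { intros y Hy Hyt. destruct (box_chart B (y (theta y)) (g t)) as [_ [W _]].
      eapply Rle_lt_trans; [exact W|].
      assert (C * G * dist1 (y 0) (g s) <= C * G * delta) by (apply Rmult_le_compat_l; lra).
      apply Rle_lt_trans with (C * (C * G * delta + rho2)); [apply Rmult_le_compat_l; lra|]. lra. }
    assert (O := Hout _ _ (Hend y2 Hd2 U4) (Hend y1 Hd1 T4)).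
    destruct (box_chart B (y1 (theta y1)) (y2 (theta y2))) as [_ [_ F]].
    rewrite T2, U2, Rminus_diag, Rabs_R0, Rplus_0_l, Rabs_minus_sym in F.
    eapply Rle_trans; [exact F|].
    set (X := Rabs (lin w (y2 (theta y2)) - lin w (y1 (theta y1)))) in *.
    assert (HE := exp_pos (4 * L * C)).
    assert (HX : Aout * X <= exp (4 * L * C) * (Ain * ((C + C * C / c) * dd))).
    { eapply Rle_trans; [exact O|]. eapply Rle_trans; [exact A4|].
      apply Rmult_le_compat_l; [lra|]. eapply Rle_trans; [exact I|].
      apply Rmult_le_compat_l; lra. }
    apply Rmult_le_reg_l with Aout; [exact HAout|].
    replace (Aout * (C * G * (Ain / Aout) * dd)) with
      (C * (exp (4 * L * C) * (Ain * ((C + C * C / c) * dd))))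
      by (unfold G, gain; field; split; lra).
    replace (Aout * (C * X)) with (C * (Aout * X)) by ring.
    apply Rmult_le_compat_l; lra.
Qed.

(** K1 delta <= d2 / 2 fixes delta before rho' is known; the additive error rho1 of the first leg is
    then adapted to rho' through eps alone. *)
Lemma link_compose k1 k2 s t u :
  0 <= k1 -> 0 <= k2 -> link k1 s t -> link k2 t u -> link (k1 * k2) s u.
Proof.
  intros Hk1 Hk2 [K1 [HK1 H1]] [K2 [HK2 H2]].
  exists (K2 * K1). split; [now apply Rmult_le_pos|]. intros rho Hrho.
  destruct (H2 rho Hrho) as [d2 [Hd2 H2']].
  destruct (H1 rho Hrho) as [d1 [Hd1 H1']].
  destruct (small_positive 1 d1 K1 (d2 / 2) 1 1 1 1) as [delta [Hdelta [D1 [D2 _]]]]; try lra.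
  exists delta. split; [exact Hdelta|]. intros rho' Hrho'.
  destruct (H2' (rho' / 2)) as [e2 [He2 H2'']]; [lra|].
  destruct (small_positive 1 (d2 / 4) K2 (rho' / 2) 1 1 1 1) as [rho1 [Hrho1 [R1 [R2 _]]]]; try lra.
  destruct (H1' rho1) as [e1 [He1 H1'']]; [lra|].
  exists (Rmin e1 e2). split; [now apply Rmin_pos|].
  intros eps He.
  destruct (H1'' eps) as [th1 [A1 C1]]; [generalize (Rmin_l e1 e2); lra|].
  destruct (H2'' eps) as [th2 [A2 C2]]; [generalize (Rmin_r e1 e2); lra|].
  set (sh := fun (y : R -> R * R) x => y (x + th1 y)).
  assert (Hmid : forall y, tube_solution Z g r0 eps y -> dist1 (y 0) (g s) < delta ->
    dist1 (y 0) (g s) < d1 /\ tube_solution Z g r0 eps (sh y) /\ dist1 (sh y 0) (g t) < d2).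
  { intros y Hy Hd. assert (Hd' : dist1 (y 0) (g s) < d1) by lra.
    split; [exact Hd'|]. split; [now apply tube_solution_shift|].
    destruct (A1 y Hy Hd') as [_ [_ [B _]]]. unfold sh. rewrite Rplus_0_l.
    assert (K1 * dist1 (y 0) (g s) <= K1 * delta) by (apply Rmult_le_compat_l; lra). lra. }
  exists (fun y => th2 (sh y) + th1 y). split.
  - intros y Hy Hd. destruct (Hmid y Hy Hd) as [E1 [Hs E2]].
    destruct (A1 y Hy E1) as [B1 [B2 [B3 [x0 [Hx0 B4]]]]].
    destruct (A2 _ Hs E2) as [F1 [F2 [F3 _]]].
    split; [lra|]. split; [|split].
    + intros x Hx. destruct (Rle_dec x (th1 y)) as [Hle|Hgt]; [apply B2; lra|].
      assert (F := F2 (x - th1 y) ltac:(lra)). unfold sh in F.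
      now replace (x - th1 y + th1 y) with x in F by ring.
    + unfold sh in F3 at 1. eapply Rle_trans; [exact F3|].
      unfold sh. rewrite Rplus_0_l.
      apply (Rmult_le_compat_l K2) in B3; [|exact HK2]. lra.
    + exists x0. split; [lra|exact B4].
  - intros y1 y2 Hy1 Hy2 Hd1' Hd2'.
    destruct (Hmid y1 Hy1 Hd1') as [F1 [S1 E1]]. destruct (Hmid y2 Hy2 Hd2') as [F2 [S2 E2]].
    assert (Q1 := C1 y1 y2 Hy1 Hy2 F1 F2). assert (Q2 := C2 _ _ S1 S2 E1 E2).
    unfold sh in Q2 at 1 3. eapply Rle_trans; [exact Q2|]. unfold sh. rewrite !Rplus_0_l.
    apply (Rmult_le_compat_l k2) in Q1; [|exact Hk2]. lra.
Qed.

Lemma box_follows t0 v w r c C L d s t :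
  flow_box Z g t0 v w r c C L d -> t0 - d < s -> s <= t -> t < t0 + d -> follows s t.
Proof.
  intros B Hs Hst Ht rho Hrho.
  assert (Hr := box_r B). assert (Hc := box_c B).
  assert (HC := box_C B).
  assert (HG := gain_pos c C L Hc HC). set (G := gain c C L) in *.
  assert (HCG : 0 < C * G) by (apply Rmult_lt_0_compat; lra).
  destruct (box_passage Z g r0 Hg Hr0 t0 v w r c C L d s t B Hs Hst Ht rho Hrho)
    as [d1 [Hd1 Hpass]].
  set (k := 1 + C * (C + C * C / c)).
  assert (Hk0 : 0 < C * C / c) by (apply Rdiv_lt_0_compat; nra).
  assert (Hk : 1 <= k) by (unfold k; nra).
  destruct (small_positive 1 d1 (C * G) (rho / 2) k (rho / 2) 1 1)
    as [delta [Hdelta [D1 [D2 [D3 _]]]]]; try lra.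
  exists delta. split; [lra|].
  destruct (Hpass (rho / 4)) as [e0 [He0 Hp]]; [lra|].
  exists e0. split; [exact He0|]. intros eps y s' He Hy Hs' Hd.
  destruct (Rle_dec (lin v (y 0)) (lin v (g t))) as [HV|HV].
  - destruct (Hp eps y s' He Hy Hs' ltac:(lra) HV) as [th [T1 [_ [_ T4]]]].
    exists th. split; [exact T1|].
    assert (C * G * dist1 (y 0) (g s') <= C * G * delta) by (apply Rmult_le_compat_l; lra).
    fold G in T4. lra.
  - (* y 0 already lies beyond the section through g t, so s' is close to t. *)
    exists 0. split; [lra|].
    destruct (box_chart B (y 0) (g s')) as [Q _].
    destruct (box_chart B (g s') (g t)) as [_ [_ F]].
    destruct (box_curve Z g Hg t0 v w r c C L d B s' t) as [K1 K2]; [lra|lra|lra|].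
    apply Rabs_le_between in Q.
    set (dd := dist1 (y 0) (g s')) in *.
    assert (Hdd : 0 <= dd) by apply dist1_pos.
    assert (Hct : t - s' <= C / c * dd).
    { apply Rmult_le_reg_l with c; [exact Hc|].
      replace (c * (C / c * dd)) with (C * dd) by (field; lra). lra. }
    rewrite Rabs_minus_sym in K2.
    assert (HF1 : Rabs (lin v (g s') - lin v (g t)) <= C * dd).
    { assert (0 <= c * (t - s')) by (apply Rmult_le_pos; lra).
      rewrite Rabs_left1; lra. }
    assert (HF2 : Rabs (lin w (g s') - lin w (g t)) <= C * C / c * dd).
    { eapply Rle_trans; [exact K2|].
      replace (C * C / c * dd) with (C * (C / c * dd)) by (field; lra).
      apply Rmult_le_compat_l; lra. }
    assert (Hst' : dist1 (g s') (g t) <= C * (C * dd + C * C / c * dd)).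
    { eapply Rle_trans; [exact F|]. apply Rmult_le_compat_l; lra. }
    generalize (dist1_triangle (y 0) (g s') (g t)). fold dd.
    assert (k * dd <= k * delta) by (apply Rmult_le_compat_l; lra).
    unfold k in *. lra.
Qed.

Lemma follows_compose s t u : s <= t -> t <= u -> follows s t -> follows t u -> follows s u.
Proof.
  intros Hst Htu H1 H2 rho Hrho.
  destruct (H2 rho Hrho) as [d2 [Hd2 [e2 [He2 K2]]]].
  destruct (H1 d2 Hd2) as [d1 [Hd1 [e1 [He1 K1]]]].
  exists (Rmin d1 d2). split; [now apply Rmin_pos|].
  exists (Rmin e1 e2). split; [now apply Rmin_pos|].
  intros eps y s' He Hy Hs' Hd.
  destruct (Rlt_min _ _ _ Hd) as [D1 D2].
  assert (E1 : 0 < eps < e1) by (generalize (Rmin_l e1 e2); lra).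
  assert (E2 : 0 < eps < e2) by (generalize (Rmin_r e1 e2); lra).
  destruct (Rle_dec s' t) as [Hle|Hgt].
  - destruct (K1 eps y s' E1 Hy ltac:(lra) D1) as [x [Hx Hyx]].
    destruct (K2 eps (fun z => y (z + x)) t E2) as [x' [Hx' Hyx']].
    + now apply tube_solution_shift.
    + lra.
    + now rewrite Rplus_0_l.
    + exists (x' + x). split; [lra|exact Hyx'].
  - apply (K2 eps y s' E2 Hy); [lra|exact D2].
Qed.

Definition has_box (t0 : R) : Prop :=
  exists v w r c C L d, flow_box Z g t0 v w r c C L d.

(** The condition s < t belongs to the chained relation because [interval_chain] also produces
    degenerate intervals, whereas a [link] makes solutions move. *)
Lemma link_everywhere s t :
  (forall x, has_box x) -> s < t -> exists kappa, 0 <= kappa /\ link kappa s t.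
Proof.
  intros Hbox Hst.
  enough (H : s < t -> exists kappa, 0 <= kappa /\ link kappa s t) by now apply H.
  revert s t Hst.
  enough (H : forall s t, s <= t -> s < t -> exists kappa, 0 <= kappa /\ link kappa s t)
    by (intros; apply H; lra).
  apply (interval_chain (fun s t => s < t -> exists kappa, 0 <= kappa /\ link kappa s t)).
  - intros a b c' Hab H1 H2 Hac.
    destruct (Req_dec a b) as [->|Hne1]; [now apply H2|].
    destruct (Req_dec b c') as [<-|Hne2]; [now apply H1|].
    destruct H1 as [k1 [Hk1 L1]]; [lra|]. destruct H2 as [k2 [Hk2 L2]]; [lra|].
    exists (k1 * k2). split; [now apply Rmult_le_pos|]. now apply link_compose with b.
  - intros t0. destruct (Hbox t0) as [v [w [r [c [C [L [d B]]]]]]].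
    exists d. split; [apply (box_d B)|]. intros a b Ha Hab Hb Hlt.
    exists (C * gain c C L * (1 / 1)). split.
    + assert (Hc := box_c B). assert (HC := box_C B).
      generalize (gain_pos c C L Hc HC). intros. rewrite Rdiv_diag, Rmult_1_r by lra. nra.
    + apply (box_link t0 v w r c C L d); try lra; [exact B|].
      now apply (weighted_box_trivial t0 v w r c C L d).
Qed.

Lemma follows_everywhere s t : (forall x, has_box x) -> s <= t -> follows s t.
Proof.
  intros Hbox. revert s t. apply interval_chain.
  - intros a b c' H H1 H2. now apply follows_compose with b.
  - intros t0. destruct (Hbox t0) as [v [w [r [c [C [L [d B]]]]]]].
    exists d. split; [apply (box_d B)|]. intros a b Ha Hab Hb.
    now apply (box_follows t0 v w r c C L d).
Qed.

End Links.

(** * From contracting passages to limit cycles *)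

Lemma periodic_nat {A} (f : R -> A) T :
  (forall t, f (t + T) = f t) -> forall n t, f (t + INR n * T) = f t.
Proof.
  intros H n. induction n as [|n IH]; intros t.
  - simpl. f_equal. ring.
  - rewrite S_INR, <- (IH t), <- (H (t + INR n * T)). f_equal. ring.
Qed.

Lemma periodic_translate {A} (f : R -> A) T a :
  0 < T -> (forall t, f (t + T) = f t) ->
  forall t, exists s, a <= s < a + T /\ forall x, f (x + (s - t)) = f x.
Proof.
  intros HT H t.
  assert (Hint : forall n t, f (t + IZR n * T) = f t).
  { intros n x. destruct (Z_le_gt_dec 0 n) as [Hn|Hn].
    - rewrite <- (Z2Nat.id n Hn), <- INR_IZR_INZ. now apply periodic_nat.
    - rewrite <- (periodic_nat f T H (Z.to_nat (- n)) (x + IZR n * T)).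
      f_equal. rewrite INR_IZR_INZ, Z2Nat.id, opp_IZR by lia. ring. }
  set (n := Int_part ((t - a) / T)).
  destruct (base_Int_part ((t - a) / T)) as [B1 B2]. fold n in B1, B2.
  exists (t + IZR (- n) * T). split.
  - rewrite opp_IZR.
    assert (E : (t - a) / T * T = t - a) by (field; lra).
    assert (IZR n * T <= t - a) by (rewrite <- E; apply Rmult_le_compat_r; lra).
    assert (t - a - T < IZR n * T).
    { replace (t - a - T) with (((t - a) / T - 1) * T) by (rewrite Rmult_minus_distr_r, E; ring).
      apply Rmult_lt_compat_r; lra. }
    lra.
  - intros x. rewrite <- (Hint (- n)%Z x). f_equal. ring.
Qed.

Lemma periodic_reduce {A} (f : R -> A) T a :
  0 < T -> (forall t, f (t + T) = f t) ->
  forall t, exists s, a <= s < a + T /\ f s = f t.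
Proof.
  intros HT H t. destruct (periodic_translate f T a HT H t) as [s [Hs E]].
  exists s. split; [exact Hs|]. rewrite <- (E t). f_equal. ring.
Qed.

(** A periodic orbit is compact, so the distance to [q] attains its minimum on it. *)
Lemma periodic_curve_closed (y : R -> R * R) T q :
  0 < T -> (forall t, continuous y t) -> (forall t, y (t + T) = y t) ->
  (forall e, 0 < e -> exists x, dist1 (y x) q < e) -> exists x, 0 <= x /\ y x = q.
Proof.
  intros HT Hc Hper Hnear.
  destruct (continuity_ab_min (fun t => dist1 (y t) q) 0 T) as [m [Hm Hmr]]; [lra| |].
  { intros t _. apply continuity_pt_filterlim.
    apply (continuous_dist1 y (fun _ => q)); [apply Hc|apply continuous_const]. }
  exists m. split; [lra|]. apply dist1_eq0. apply Rnot_lt_le. intros Hpos.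
  destruct (Hnear _ Hpos) as [x Hx].
  destruct (periodic_reduce y T 0 HT Hper x) as [x' [Hx' E]].
  specialize (Hm x' ltac:(lra)). rewrite E in Hm. lra.
Qed.

(** * Tubes as neighbourhoods of a periodic curve *)

Lemma tube_open g r : open (tube g r).
Proof.
  apply open_dist1. intros q [t Ht]. exists (r - dist1 q (g t)). split; [lra|].
  intros q' Hq'. exists t. generalize (dist1_triangle q' q (g t)). lra.
Qed.

Lemma tube_in_open (g : R -> R * R) T (U : R * R -> Prop) :
  0 < T -> (forall t, g (t + T) = g t) -> (forall t, continuous g t) -> open U ->
  (forall t, U (g t)) -> exists r, 0 < r /\ forall q, tube g r q -> U q.
Proof.
  intros HT Hper Hc HU Hin.
  assert (HQ : forall a b, a <= b ->
    exists r, 0 < r /\ forall t q, a <= t <= b -> dist1 q (g t) < r -> U q).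
  { apply interval_chain.
    - intros a b c _ [r1 [Hr1 K1]] [r2 [Hr2 K2]].
      exists (Rmin r1 r2). split; [now apply Rmin_pos|]. intros t q Ht Hq.
      destruct (Rle_dec t b) as [Hb|Hb].
      + apply (K1 t); [lra|]. eapply Rlt_le_trans; [exact Hq|apply Rmin_l].
      + apply (K2 t); [lra|]. eapply Rlt_le_trans; [exact Hq|apply Rmin_r].
    - intros t0. destruct (proj1 (open_dist1 U) HU (g t0) (Hin t0)) as [r [Hr K]].
      destruct (proj1 (continuous_curve g t0) (Hc t0) (r / 2)) as [d [Hd Kd]]; [lra|].
      exists d. split; [exact Hd|]. intros a b Ha Hab Hb.
      exists (r / 2). split; [lra|]. intros t q Ht Hq. apply K.
      assert (dist1 (g t) (g t0) < r / 2) by (apply Kd; apply Rabs_def1; lra).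
      generalize (dist1_triangle q (g t) (g t0)). lra. }
  destruct (HQ 0 T) as [r [Hr K]]; [lra|].
  exists r. split; [exact Hr|]. intros q [t Ht].
  destruct (periodic_reduce g T 0 HT Hper t) as [s [Hs E]].
  apply (K s); [lra|]. now rewrite E.
Qed.

Section Loop.

Context (D : R * R -> Prop) (Z : R -> R * R -> R * R) (g : R -> R * R) (r0 T eN : R).
Context (Hg : forall t, continuous g t) (Hr0 : 0 < r0) (HT : 0 < T) (HeN : 0 < eN)
  (Hper : forall t, g (t + T) = g t)
  (HD : forall q, tube g r0 q -> D q)
  (Hext : forall eps, 0 < eps < eN -> exists G L M, lipschitz_field L G /\
     (forall q, dist1 (G q) (0, 0) <= M) /\ forall q, tube g r0 q -> G q = Z eps q).

(** Outside the tube nothing is known about [y]. But until its distance to [z] reaches r0 / 2 it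
    stays in the tube and solves the same Lipschitz equation, so the distance remains 0. *)
Lemma tube_solution_unique eps G L (y z : R -> R * R) :
  lipschitz_field L G -> (forall q, tube g r0 q -> G q = Z eps q) ->
  tube_solution Z g r0 eps y -> (forall t, velocity z t (G (z t))) ->
  (forall t, tube g (r0 / 2) (z t)) -> y 0 = z 0 -> forall t, 0 <= t -> y t = z t.
Proof.
  intros HG HGZ Hy Hz Hzt E0 t Ht.
  assert (Hyc : forall t, continuous y t) by (intros s; apply Hy).
  assert (Hzc : forall t, continuous z t) by (intros s; now apply velocity_continuous with (G (z s))).
  assert (Huniq : forall t, 0 <= t -> (forall s, 0 <= s < t -> dist1 (y s) (z s) < r0 / 2) -> y t = z t).
  { clear t Ht. intros t Ht Hs. apply (ode_uniqueness_on G L); [exact Ht| | |exact E0].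
    - intros s _. now split.
    - intros s Hst. exists (G (y s)), (G (z s)). split; [|split; [apply Hz|apply HG]].
      assert (Hts : tube g r0 (y s)).
      { destruct (Hzt s) as [x Hx]. exists x.
        generalize (dist1_triangle (y s) (z s) (g x)) (Hs s ltac:(lra)). lra. }
      rewrite HGZ by exact Hts. now apply Hy. }
  destruct (first_exit (fun s => dist1 (y s) (z s) - r0 / 2) t) as [H|[t1 [Ht1 [E1 H]]]].
  - intros s. apply (continuous_minus (fun s => dist1 (y s) (z s)) (fun _ => r0 / 2)).
    + now apply continuous_dist1.
    + apply continuous_const.
  - rewrite E0, dist1_refl. lra.
  - exact Ht.
  - apply Huniq; [exact Ht|]. intros s Hs. generalize (H s ltac:(lra)). lra.
  - exfalso. rewrite Huniq, dist1_refl in E1; [lra|lra|].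
    intros s Hs. generalize (H s Hs). lra.
Qed.

(** Banach's fixed point theorem for the return map of the extended field on the ball of radius
    delta / 2. Since [theta] depends on whole curves, the contraction also compares any
    [tube_solution] with the fixed orbit, which yields the attraction in the last clause. *)
Lemma periodic_attractor kappa s0 rho :
  0 <= kappa <= 1 / 2 -> link Z g r0 kappa s0 (s0 + T) -> 0 < rho ->
  exists delta e1, 0 < delta /\ 0 < e1 /\ e1 <= eN /\ forall eps, 0 < eps < e1 ->
  exists (ys : R -> R * R) (Ts : R),
    0 < Ts /\ (forall t, velocity ys t (Z eps (ys t))) /\ (forall t, ys (t + Ts) = ys t) /\
    (forall t, tube g rho (ys t) /\ tube g r0 (ys t)) /\ (exists t, ys t <> ys 0) /\
    (forall y, tube_solution Z g r0 eps y -> dist1 (y 0) (g s0) < delta ->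
       forall e, 0 < e -> exists x, 0 <= x /\ dist1 (y x) (ys 0) < e).
Proof.
  intros Hk [K [HK Hlink]] Hrho.
  destruct (Hlink (Rmin rho r0)) as [delta [Hdelta Hl]]; [now apply Rmin_pos|].
  (* The centre moves by at most delta / 4 and the ball of radius delta / 2 shrinks by half, so it
     is mapped into itself. *)
  destruct (Hl (delta / 4)) as [e0 [He0 Hl']]; [lra|].
  exists delta, (Rmin e0 eN). split; [exact Hdelta|]. split; [now apply Rmin_pos|].
  split; [apply Rmin_r|]. intros eps He.
  destruct (Hl' eps) as [theta [A C]]; [generalize (Rmin_l e0 eN); lra|].
  destruct (Hext eps) as [G [L [M [HL [HM HGZ]]]]]; [generalize (Rmin_r e0 eN); lra|].
  rewrite Hper in A.
  assert (Hflow : forall q, exists y, y 0 = q /\ forall t, velocity y t (G (y t)))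
    by (intros q; now apply ode_existence with L M).
  set (flow := fun q => proj1_sig (constructive_indefinite_description _ (Hflow q))).
  assert (Hflow0 : forall q, flow q 0 = q).
  { intros q. exact (proj1 (proj2_sig (constructive_indefinite_description _ (Hflow q)))). }
  assert (HflowG : forall q t, velocity (flow q) t (G (flow q t))).
  { intros q. exact (proj2 (proj2_sig (constructive_indefinite_description _ (Hflow q)))). }
  clearbody flow.
  assert (Hsol : forall q, tube_solution Z g r0 eps (flow q)).
  { intros q t. split; [now apply velocity_continuous with (G (flow q t))|].
    intros Ht. rewrite <- HGZ by exact Ht. apply HflowG. }
  set (P := fun q => flow q (theta (flow q))).
  assert (Hcontr : forall y q, tube_solution Z g r0 eps y -> dist1 (y 0) (g s0) < delta ->
    dist1 q (g s0) < delta -> dist1 (y (theta y)) (P q) <= 1 / 2 * dist1 (y 0) q).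
  { intros y q Hy Hd Hq. rewrite <- (Hflow0 q) in Hq.
    assert (Q := C y (flow q) Hy (Hsol q) Hd Hq). rewrite Hflow0 in Q.
    unfold P. generalize (dist1_pos (y 0) q). nra. }
  assert (Hcontr2 : forall p q, dist1 p (g s0) < delta -> dist1 q (g s0) < delta ->
    dist1 (P p) (P q) <= 1 / 2 * dist1 p q).
  { intros p q Hp Hq. rewrite <- (Hflow0 p) in Hp.
    assert (Q := Hcontr (flow p) q (Hsol p) Hp Hq). now rewrite Hflow0 in Q. }
  assert (Hcenter : dist1 (P (g s0)) (g s0) <= delta / 4).
  { destruct (A (flow (g s0)) (Hsol _)) as [_ [_ [B _]]].
    - rewrite Hflow0, dist1_refl. exact Hdelta.
    - rewrite Hflow0, dist1_refl in B. unfold P. lra. }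
  assert (Hg0 : dist1 (g s0) (g s0) < delta) by (rewrite dist1_refl; exact Hdelta).
  assert (Hstay : forall q, dist1 q (g s0) <= delta / 2 -> dist1 (P q) (g s0) <= delta / 2).
  { intros q Hq. generalize (dist1_triangle (P q) (P (g s0)) (g s0)) (Hcontr2 q (g s0) ltac:(lra) Hg0). lra. }
  set (qn := fun n => Nat.iter n P (g s0)).
  assert (Hqn : forall n, dist1 (qn n) (g s0) <= delta / 2).
  { induction n as [|n IH]; [simpl; rewrite dist1_refl; lra|]. now apply Hstay. }
  assert (Hstep : forall n, dist1 (qn (S n)) (qn n) <= delta * (1 / 2) ^ n).
  { induction n as [|n IH]; [simpl; lra|].
    apply Rle_trans with (1 / 2 * dist1 (qn (S n)) (qn n)).
    - apply Hcontr2; [generalize (Hqn (S n)); lra|generalize (Hqn n); lra].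
    - simpl. simpl in IH. lra. }
  destruct (geometric_limit_plane qn delta Hstep) as [qs Hqs].
  assert (Hqs0 : dist1 qs (g s0) <= delta / 2).
  { apply le_geometric with (4 * delta). intros n.
    generalize (dist1_triangle qs (qn n) (g s0)) (Hqs n) (Hqn n).
    rewrite (dist1_sym qs (qn n)). lra. }
  assert (Hfix : P qs = qs).
  { apply dist1_eq0. apply le_geometric with (8 * delta). intros n.
    assert (Q1 := Hcontr2 qs (qn n) ltac:(lra) ltac:(generalize (Hqn n); lra)).
    change (P (qn n)) with (qn (S n)) in Q1. rewrite (dist1_sym qs) in Q1.
    assert (Q2 := dist1_triangle (P qs) (qn (S n)) qs).
    assert (Q3 := Hqs n). assert (Q4 := Hqs (S n)).
    replace ((1 / 2) ^ S n) with (1 / 2 * (1 / 2) ^ n) in Q4 by reflexivity.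
    assert (0 < delta * (1 / 2) ^ n) by (apply Rmult_lt_0_compat; [lra|apply pow_half_pos]).
    lra. }
  destruct (A (flow qs) (Hsol qs)) as [B1 [B2 [_ [x0 [Hx0 B4]]]]]; [rewrite Hflow0; lra|].
  set (Ts := theta (flow qs)) in *.
  assert (HTs : 0 < Ts).
  { destruct (Req_dec Ts 0) as [E|E]; [|lra]. exfalso. apply B4. f_equal. lra. }
  (* The extension has unique solutions on the whole line, so the single return to [qs] forces
     periodicity in both time directions. *)
  assert (Hperiod : forall t, flow qs (t + Ts) = flow qs t).
  { apply (ode_uniqueness G L (fun t => flow qs (t + Ts)) (flow qs) HL).
    - intros t. apply velocity_shift, HflowG.
    - apply HflowG.
    - rewrite Rplus_0_l, Hflow0. exact Hfix. }
  assert (Htube : forall t, tube g rho (flow qs t) /\ tube g r0 (flow qs t)).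
  { intros t. destruct (periodic_reduce (flow qs) Ts 0 HTs Hperiod t) as [s [Hs <-]].
    destruct (B2 s) as [x Hx]; [lra|].
    split; exists x; (eapply Rlt_le_trans; [exact Hx|]); [apply Rmin_l|apply Rmin_r]. }
  exists (flow qs), Ts. split; [exact HTs|]. split; [|split; [exact Hperiod|split; [exact Htube|split]]].
  - intros t. apply (Hsol qs), Htube.
  - now exists x0.
  - intros y Hy Hd e He'. rewrite Hflow0.
    assert (Hiter : forall n, exists x, 0 <= x /\ dist1 (y x) (g s0) < delta /\
      dist1 (y x) qs <= 2 * delta * (1 / 2) ^ n).
    { induction n as [|n [x [Hx [H1 H2]]]].
      - exists 0. split; [lra|]. split; [exact Hd|].
        generalize (dist1_triangle (y 0) (g s0) qs). rewrite (dist1_sym (g s0) qs). simpl. lra.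
      - set (z := fun t => y (t + x)).
        assert (Hz : tube_solution Z g r0 eps z) by now apply tube_solution_shift.
        assert (Hz0 : z 0 = y x) by (unfold z; now rewrite Rplus_0_l).
        assert (Hzd : dist1 (z 0) (g s0) < delta) by now rewrite Hz0.
        destruct (A z Hz Hzd) as [F1 _].
        exists (theta z + x). split; [lra|]. change (y (theta z + x)) with (z (theta z)).
        assert (Q1 := Hcontr z (g s0) Hz Hzd Hg0).
        assert (Q2 := Hcontr z qs Hz Hzd ltac:(lra)). rewrite Hfix in Q2. rewrite Hz0 in *.
        split.
        + generalize (dist1_triangle (z (theta z)) (P (g s0)) (g s0)). lra.
        + simpl. lra. }
    destruct (pow_half_small (e / (2 * delta))) as [n Hn].
    { apply Rdiv_lt_0_compat; lra. }
    destruct (Hiter n) as [x [Hx [_ H2]]]. exists x. split; [exact Hx|].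
    eapply Rle_lt_trans; [exact H2|].
    apply (Rmult_lt_compat_l (2 * delta)) in Hn; [|lra].
    replace (2 * delta * (e / (2 * delta))) with e in Hn by (field; lra). exact Hn.
Qed.

Theorem limit_cycles_near_loop kappa s0 :
  0 <= kappa <= 1 / 2 -> link Z g r0 kappa s0 (s0 + T) -> follows Z g r0 s0 (s0 + T) ->
  exists Geps : R -> R * R -> Prop,
    (exists eps0 : R, 0 < eps0 /\ forall eps, 0 < eps < eps0 ->
       limit_cycle D (Z eps) (Geps eps)) /\
    converges_to Geps (range_of g).
Proof.
  intros Hk Hlink Hfol.
  destruct (periodic_attractor kappa s0 (r0 / 2) Hk Hlink) as [delta [e1 [Hdelta [He1 [HeN1 Hatt]]]]];
    [lra|].
  destruct (Hfol delta Hdelta) as [rW [HrW [e2 [He2 Hcatch]]]].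
  rewrite Hper in Hcatch.
  set (W := tube g rW).
  (* Every periodic orbit that meets W is attracted by, hence equal to, the one
     given by the fixed point of the return map. *)
  assert (Huniq : forall eps, 0 < eps < Rmin e1 e2 -> exists G0 : R * R -> Prop,
    forall G, periodic_orbit D (Z eps) G -> (exists q, G q /\ W q) -> forall q, G q <-> G0 q).
  { intros eps He.
    assert (He1' : 0 < eps < e1) by (generalize (Rmin_l e1 e2); lra).
    assert (He2' : 0 < eps < e2) by (generalize (Rmin_r e1 e2); lra).
    destruct (Hatt eps He1') as [ys [Ts [HTs [Hys [Hysper [Hystube [_ Hyatt]]]]]]].
    exists (range_of ys). intros G [y [T' [HT' [Hy [_ HG]]]]] [q [Gq [s Hs]]].
    destruct (proj1 (HG q) Gq) as [t ->].
    assert (Hsol : forall x, tube_solution Z g r0 eps (fun z => y (z + x))).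
    { intros x. apply tube_solution_shift. intros z. destruct (Hy z) as [_ [V _]].
      split; [now apply velocity_continuous with (Z eps (y z))|]. intros _. exact V. }
    destruct (periodic_reduce g T s0 HT Hper s) as [s' [Hs' E]]. rewrite <- E in Hs.
    destruct (Hcatch eps (fun z => y (z + t)) s' He2' (Hsol t) ltac:(lra)) as [x [Hx Hyx]].
    { now rewrite Rplus_0_l. }
    assert (Hclose : forall e, 0 < e -> exists z, dist1 (y z) (ys 0) < e).
    { intros e He'. destruct (Hyatt (fun z => y (z + (x + t))) (Hsol (x + t))) with e as [z [_ Hz]].
      - now rewrite Rplus_0_l.
      - exact He'.
      - now exists (z + (x + t)). }
    assert (Hyc : forall z, continuous y z).
    { intros z. destruct (Hy z) as [_ [V _]]. now apply velocity_continuous with (Z eps (y z)). }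
    assert (Hyper : forall z, y (z + T') = y z) by (intros z; apply Hy).
    destruct (periodic_curve_closed y T' (ys 0) HT' Hyc Hyper Hclose) as [x1 [_ E1]].
    destruct (Hext eps) as [F [L [M [HL [HM HFZ]]]]]; [lra|].
    assert (Heq : forall z, 0 <= z -> y (z + x1) = ys z).
    { apply (tube_solution_unique eps F L (fun z => y (z + x1)) ys HL HFZ (Hsol x1)).
      - intros z. rewrite HFZ by apply Hystube. apply Hys.
      - apply Hystube.
      - now rewrite Rplus_0_l. }
    intros q. rewrite (HG q). split; intros [z ->].
    - destruct (periodic_reduce y T' x1 HT' Hyper z) as [z' [Hz' <-]].
      exists (z' - x1). rewrite <- Heq by lra. f_equal. ring.
    - destruct (periodic_reduce ys Ts 0 HTs Hysper z) as [z' [Hz' <-]].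
      exists (z' + x1). symmetry. apply Heq. lra. }
  assert (Hexist : forall rho, 0 < rho -> exists e3, 0 < e3 /\ forall eps, 0 < eps < e3 ->
    exists G, periodic_orbit D (Z eps) G /\ (exists q, G q) /\ forall q, G q -> tube g rho q).
  { intros rho Hrho.
    destruct (periodic_attractor kappa s0 rho Hk Hlink Hrho) as [d' [e3 [_ [He3 [_ Hatt3]]]]].
    exists e3. split; [exact He3|]. intros eps He.
    destruct (Hatt3 eps He) as [ys [Ts [HTs [Hys [Hysper [Hystube [Hnc _]]]]]]].
    exists (range_of ys). split; [|split].
    - exists ys, Ts. split; [exact HTs|]. split; [|split; [exact Hnc|intros q; tauto]].
      intros t. split; [apply HD, Hystube|]. split; [apply Hys|apply Hysper].
    - exists (ys 0). now exists 0.
    - intros q [t ->]. apply Hystube. }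
  (* Convergence concerns one family, but the attractor is constructed anew for each rho. Taking all
     periodic orbits that meet W defines the family without rho, and uniqueness identifies it with
     each construction. *)
  set (Geps := fun eps q => exists G, periodic_orbit D (Z eps) G /\ (exists q', G q' /\ W q') /\ G q).
  assert (Hmain : forall rho, 0 < rho -> exists e3, 0 < e3 /\ forall eps, 0 < eps < e3 ->
    limit_cycle D (Z eps) (Geps eps) /\ forall q, Geps eps q -> tube g rho q).
  { intros rho Hrho.
    destruct (Hexist (Rmin rho rW)) as [e3 [He3 H3]]; [now apply Rmin_pos|].
    exists (Rmin e3 (Rmin e1 e2)). split; [repeat apply Rmin_pos; assumption|].
    intros eps He.
    assert (He3' : 0 < eps < e3) by (generalize (Rmin_l e3 (Rmin e1 e2)); lra).
    assert (He12 : 0 < eps < Rmin e1 e2) by (generalize (Rmin_r e3 (Rmin e1 e2)); lra).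
    destruct (H3 eps He3') as [G [HGp [[q0 Gq0] HGt]]].
    destruct (Huniq eps He12) as [G0 HG0].
    assert (HGW : forall q, G q -> W q).
    { intros q Gq. destruct (HGt q Gq) as [t Ht]. exists t.
      eapply Rlt_le_trans; [exact Ht|apply Rmin_r]. }
    assert (HGr : forall q, G q -> tube g rho q).
    { intros q Gq. destruct (HGt q Gq) as [t Ht]. exists t.
      eapply Rlt_le_trans; [exact Ht|apply Rmin_l]. }
    assert (HGW' : exists q, G q /\ W q) by (exists q0; split; [exact Gq0|now apply HGW]).
    assert (HGE : forall q, Geps eps q <-> G q).
    { intros q. split.
      - intros [G1 [P1 [W1 G1q]]]. apply (HG0 G HGp HGW'), (HG0 G1 P1 W1), G1q.
      - intros Gq. now exists G. }
    split; [|intros q Hq; apply HGr; now apply HGE].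
    split.
    - destruct HGp as [y [T' [H1 [H2 [H4 H5]]]]]. exists y, T'. split; [exact H1|].
      split; [exact H2|]. split; [exact H4|]. intros q. rewrite HGE. apply H5.
    - exists W. split; [apply tube_open|]. split; [intros q Hq; now apply HGW, HGE|].
      intros G1 P1 W1 q. rewrite HGE, (HG0 G1 P1 W1). symmetry. now apply HG0. }
  exists Geps. split.
  - destruct (Hmain 1) as [e3 [He3 H3]]; [lra|]. exists e3. split; [exact He3|].
    intros eps He. now apply H3.
  - intros U HU Hin.
    destruct (tube_in_open g T U HT Hper Hg HU) as [r [Hr Hr']].
    { intros t. apply Hin. now exists t. }
    destruct (Hmain r Hr) as [e3 [He3 H3]]. exists e3. split; [exact He3|].
    intros eps He q Hq. apply Hr'. now apply (proj2 (H3 eps He)).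
Qed.

End Loop.

(** * Flow boxes at regular points and at contacts with Sigma *)

Lemma lin_blend v b p q : lin v (blend b p q) = b * lin v p + (1 - b) * lin v q.
Proof. unfold lin, blend. simpl. ring. Qed.

Lemma blend_same b p : blend b p p = p.
Proof. unfold blend. destruct p; simpl. f_equal; ring. Qed.

Lemma blend_dist b p q p' q' :
  0 <= b <= 1 -> dist1 (blend b p q) (blend b p' q') <= b * dist1 p p' + (1 - b) * dist1 q q'.
Proof.
  intros Hb. unfold blend, dist1. simpl.
  assert (K : forall x y x' y' : R, Rabs (b * x + (1 - b) * y - (b * x' + (1 - b) * y')) <=
    b * Rabs (x - x') + (1 - b) * Rabs (y - y')).
  { intros x y x' y'.
    replace (b * x + (1 - b) * y - (b * x' + (1 - b) * y')) with
      (b * (x - x') + (1 - b) * (y - y')) by ring.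
    eapply Rle_trans; [apply Rabs_triang|]. rewrite !Rabs_mult, (Rabs_pos_eq b), (Rabs_pos_eq (1 - b)); lra. }
  generalize (K (fst p) (fst q) (fst p') (fst q')) (K (snd p) (snd q) (snd p') (snd q')). lra.
Qed.

Lemma slope_lipschitz v w c C p q :
  0 < c -> 0 <= C -> c <= lin v p -> c <= lin v q -> Rabs (lin w p) <= C ->
  Rabs (slope v w q - slope v w p) <=
    (dist1 w (0, 0) / c + C * dist1 v (0, 0) / (c * c)) * dist1 p q.
Proof.
  intros Hc HC Hp Hq Hw. unfold slope.
  replace (lin w q / lin v q - lin w p / lin v p) with
    ((lin w q - lin w p) * / lin v q + lin w p * (lin v p - lin v q) * (/ lin v p * / lin v q))
    by (field; lra).
  assert (Ip : 0 < / lin v p <= / c).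
  { split; [apply Rinv_0_lt_compat; lra|]. apply Rinv_le_contravar; lra. }
  assert (Iq : 0 < / lin v q <= / c).
  { split; [apply Rinv_0_lt_compat; lra|]. apply Rinv_le_contravar; lra. }
  assert (L1 := lin_lipschitz w q p). assert (L2 := lin_lipschitz v p q).
  rewrite (dist1_sym q p) in L1.
  assert (Hd := dist1_pos p q). assert (Hw0 := dist1_pos w (0, 0)). assert (Hv0 := dist1_pos v (0, 0)).
  eapply Rle_trans; [apply Rabs_triang|]. rewrite !Rabs_mult.
  rewrite (Rabs_pos_eq (/ lin v q)), (Rabs_pos_eq (/ lin v p)) by lra.
  rewrite Rmult_plus_distr_r. apply Rplus_le_compat.
  - replace (dist1 w (0, 0) / c * dist1 p q) with (dist1 w (0, 0) * dist1 p q * / c) by (field; lra).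
    apply Rmult_le_compat; try lra. apply Rabs_pos.
  - replace (C * dist1 v (0, 0) / (c * c) * dist1 p q) with
      (C * (dist1 v (0, 0) * dist1 p q) * (/ c * / c)) by (field; lra).
    apply Rmult_le_compat.
    + apply Rmult_le_pos; apply Rabs_pos.
    + apply Rmult_le_pos; lra.
    + apply Rmult_le_compat; try apply Rabs_pos; assumption.
    + apply Rmult_le_compat; lra.
Qed.

(** A form that increases along both fields increases along all their convex combinations, so
    neither the speed bounds nor the Lipschitz constant depend on the weight [b], hence not on
    eps. *)
Lemma blend_bounds (A B : R * R -> R * R) p v w r1 LX :
  0 < r1 -> 0 <= LX -> lipschitz_near A p r1 LX -> lipschitz_near B p r1 LX ->
  0 < lin v (A p) -> 0 < lin v (B p) -> det2 v w <> 0 ->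
  exists c C L r, 0 < c /\ 1 <= C /\ 0 <= L /\ 0 < r <= 1 /\ r <= r1 /\ chart v w C /\
    (forall q, dist1 q p < r ->
       c <= lin v (A q) <= C /\ c <= lin v (B q) <= C /\
       Rabs (lin w (A q)) <= C /\ Rabs (lin w (B q)) <= C) /\
    (forall b q q', 0 <= b <= 1 -> dist1 q p < r -> dist1 q' p < r -> lin v q = lin v q' ->
       Rabs (slope v w (blend b (B q') (A q')) - slope v w (blend b (B q) (A q)))
         <= L * Rabs (lin w q' - lin w q)).
Proof.
  intros Hr1 HLX HA HB HvA HvB Hdet.
  destruct (chart_exists v w Hdet) as [C0 [HC0 Hchart]].
  set (c := Rmin (lin v (A p)) (lin v (B p)) / 2).
  assert (Hc : 0 < c /\ 2 * c <= lin v (A p) /\ 2 * c <= lin v (B p)).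
  { unfold c. generalize (Rmin_l (lin v (A p)) (lin v (B p))) (Rmin_r (lin v (A p)) (lin v (B p))).
    assert (0 < Rmin (lin v (A p)) (lin v (B p))) by now apply Rmin_pos. lra. }
  set (nv := dist1 v (0, 0)). set (nw := dist1 w (0, 0)).
  assert (Hnv : 0 <= nv) by apply dist1_pos. assert (Hnw : 0 <= nw) by apply dist1_pos.
  assert (HnL : 0 <= nv * LX) by now apply Rmult_le_pos.
  destruct (small_positive 1 1 1 r1 (nv * LX) c 1 1) as [r [Hr0 [Hr1' [Hr2 [Hr3 _]]]]]; try lra.
  set (M := dist1 (A p) (0, 0) + dist1 (B p) (0, 0) + LX).
  assert (HMA := dist1_pos (A p) (0, 0)). assert (HMB := dist1_pos (B p) (0, 0)).
  assert (Hp : dist1 p p < r1) by (rewrite dist1_refl; lra).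
  assert (Hlin0 : forall u, lin u (0, 0) = 0) by (intros u; unfold lin; simpl; ring).
  assert (Hfield : forall (X : R * R -> R * R) q, lipschitz_near X p r1 LX -> dist1 q p < r ->
    dist1 (X p) (0, 0) + LX <= M -> 2 * c <= lin v (X p) ->
    c <= lin v (X q) <= nv * M /\ Rabs (lin w (X q)) <= nw * M).
  { intros X q HX Hq HM Hv.
    assert (Hdq := dist1_pos q p).
    assert (E : dist1 (X q) (X p) <= LX * dist1 q p) by (apply HX; [lra|exact Hp]).
    assert (HqM : dist1 (X q) (0, 0) <= M).
    { generalize (dist1_triangle (X q) (X p) (0, 0)).
      assert (LX * dist1 q p <= LX * 1) by (apply Rmult_le_compat_l; lra). lra. }
    assert (Q1 := lin_lipschitz v (X q) (X p)). assert (Q2 := lin_lipschitz v (X q) (0, 0)).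
    assert (Q3 := lin_lipschitz w (X q) (0, 0)). rewrite Hlin0, Rminus_0_r in Q2, Q3.
    fold nv in Q1, Q2. fold nw in Q3.
    assert (nv * dist1 (X q) (X p) <= nv * LX * r).
    { rewrite Rmult_assoc. apply Rmult_le_compat_l; [exact Hnv|].
      eapply Rle_trans; [exact E|]. apply Rmult_le_compat_l; lra. }
    apply Rabs_le_between in Q1.
    assert (nv * dist1 (X q) (0, 0) <= nv * M) by (apply Rmult_le_compat_l; lra).
    assert (nw * dist1 (X q) (0, 0) <= nw * M) by (apply Rmult_le_compat_l; lra).
    generalize (Rle_abs (lin v (X q))). lra. }
  assert (HM : 0 <= M) by (unfold M; lra).
  set (C := C0 + nv * M + nw * M).
  assert (HvM : 0 <= nv * M) by now apply Rmult_le_pos.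
  assert (HwM : 0 <= nw * M) by now apply Rmult_le_pos.
  assert (Hbd : forall q, dist1 q p < r ->
    c <= lin v (A q) <= C /\ c <= lin v (B q) <= C /\
    Rabs (lin w (A q)) <= C /\ Rabs (lin w (B q)) <= C).
  { intros q Hq.
    destruct (Hfield A q HA Hq) as [F1 F2]; [unfold M; lra|lra|].
    destruct (Hfield B q HB Hq) as [F3 F4]; [unfold M; lra|lra|].
    unfold C. lra. }
  set (S := nw / c + C * nv / (c * c)).
  assert (HS : 0 <= S).
  { apply Rplus_le_le_0_compat; apply Rdiv_le_0_compat; try lra.
    - apply Rmult_le_pos; unfold C; lra.
    - nra. }
  exists c, C, (S * LX * C0), r.
  split; [lra|]. split; [unfold C; lra|]. split.
  { repeat apply Rmult_le_pos; lra. }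
  split; [lra|]. split; [lra|]. split; [|split; [exact Hbd|]].
  - intros x y. destruct (Hchart x y) as [Q1 [Q2 Q3]]. assert (Hd := dist1_pos x y).
    assert (C0 * dist1 x y <= C * dist1 x y) by (apply Rmult_le_compat_r; unfold C; lra).
    split; [lra|]. split; [lra|]. eapply Rle_trans; [exact Q3|].
    apply Rmult_le_compat_r; [|unfold C; lra].
    apply Rplus_le_le_0_compat; apply Rabs_pos.
  - intros b q q' Hb Hq Hq' EV.
    destruct (Hbd q Hq) as [A1 [A2 [A3 A4]]]. destruct (Hbd q' Hq') as [A1' [A2' _]].
    assert (Hlow : forall x y, c <= x -> c <= y -> c <= b * x + (1 - b) * y) by (intros; nra).
    eapply Rle_trans.
    + apply (slope_lipschitz v w c C); [lra|unfold C; lra| | |]; rewrite lin_blend.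
      * apply Hlow; lra.
      * apply Hlow; lra.
      * eapply Rle_trans; [apply Rabs_triang|].
        rewrite !Rabs_mult, (Rabs_pos_eq b), (Rabs_pos_eq (1 - b)) by lra. nra.
    + fold nv nw S. rewrite 2!Rmult_assoc. apply Rmult_le_compat_l; [exact HS|].
      eapply Rle_trans; [now apply blend_dist|].
      assert (E1 : dist1 (B q) (B q') <= LX * dist1 q q') by (apply HB; lra).
      assert (E2 : dist1 (A q) (A q') <= LX * dist1 q q') by (apply HA; lra).
      apply Rle_trans with (LX * dist1 q q'); [nra|].
      apply Rmult_le_compat_l; [exact HLX|].
      destruct (Hchart q q') as [_ [_ Q3]].
      rewrite EV, Rminus_diag, Rabs_R0, Rplus_0_l, Rabs_minus_sym in Q3. exact Q3.
Qed.

(** The weight of the field followed after the contact, as a function of the height oriented along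
    the motion. Continuity is there for the primitive H. *)
Definition switching (b : R -> R -> R) : Prop :=
  forall eps, 0 < eps ->
    (forall x, continuous (b eps) x) /\
    (forall x y, x <= y -> b eps x <= b eps y) /\
    (forall x, x <= - eps -> b eps x = 0) /\
    (forall x, eps <= x -> b eps x = 1).

Lemma switching_bounds b eps x : switching b -> 0 < eps -> 0 <= b eps x <= 1.
Proof.
  intros Hb He. destruct (Hb eps He) as [_ [Hm [H0 H1]]].
  rewrite <- (H0 (Rmin x (- eps))) at 1 by apply Rmin_r.
  rewrite <- (H1 (Rmax x eps)) by apply Rmax_r.
  split; apply Hm; [apply Rmin_l|apply Rmax_l].
Qed.

Lemma positive_on_segment (f : R -> R) a b :
  a <= b -> (forall x, continuous f x) -> (forall x, a <= x <= b -> 0 < f x) ->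
  exists m, 0 < m /\ forall x, a <= x <= b -> m <= f x.
Proof.
  intros Hab Hc Hpos. destruct (continuity_ab_min f a b Hab) as [z [Hz Hz']].
  - intros x _. apply continuity_pt_filterlim, Hc.
  - exists (f z). split; [now apply Hpos|exact Hz].
Qed.

Section Contacts.

Context (Z : R -> R * R -> R * R) (g : R -> R * R).
Context (Hg : forall t, continuous g t).

Lemma regular_box t0 (X : R * R -> R * R) r1 LX d1 :
  0 < r1 -> 0 <= LX -> lipschitz_near X (g t0) r1 LX -> X (g t0) <> (0, 0) ->
  (forall eps q, 0 < eps < r1 -> dist1 q (g t0) < r1 -> Z eps q = X q) ->
  0 < d1 -> (forall t, Rabs (t - t0) < d1 -> velocity g t (X (g t))) ->
  has_box Z g t0.
Proof.
  intros Hr1 HLX HX Hne HZ Hd1 Hvel.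
  (* The direction of the flow itself serves as the increasing form, its quarter turn as the
     transversal one. *)
  set (v := X (g t0)). set (w := (- snd v, fst v)).
  assert (Hsq : 0 < lin v v).
  { unfold lin. assert (v <> (0, 0)) as Hv by exact Hne. destruct v as [a b]; simpl.
    assert (Ha := pow2_ge_0 a). assert (Hb := pow2_ge_0 b).
    destruct (Req_dec a 0) as [->|Ha0].
    - destruct (Req_dec b 0) as [->|Hb0]; [now contradict Hv|].
      assert (0 < b * b) by nra. lra.
    - assert (0 < a * a) by nra. nra. }
  assert (Hdet : det2 v w <> 0).
  { unfold det2, w. unfold lin in Hsq. simpl. nra. }
  destruct (blend_bounds X X (g t0) v w r1 LX) as
    [c [C [L [r [Hc [HC [HL [Hr [Hrr [Hch [Hbd Hlip]]]]]]]]]]]; try assumption.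
  destruct (proj1 (continuous_curve g t0) (Hg t0) (r / 2)) as [d2 [Hd2 Kd2]]; [lra|].
  exists v, w, r, c, C, L, (Rmin d1 d2).
  assert (Hmin := Rmin_l d1 d2). assert (Hmin' := Rmin_r d1 d2).
  split; try assumption.
  - now apply Rmin_pos.
  - intros eps q He Hq. rewrite HZ by lra. destruct (Hbd q Hq) as [B1 [_ [B3 _]]].
    split; [lra|]. split; [|exact B3]. apply Rabs_le; lra.
  - intros eps p q He Hp Hq EV. rewrite !HZ by lra.
    assert (K := Hlip 0 p q ltac:(lra) Hp Hq EV). rewrite !blend_same in K.
    rewrite <- pow2_abs.
    apply Rle_trans with (Rabs (lin w q - lin w p) * Rabs (slope v w (X q) - slope v w (X p))).
    + rewrite <- Rabs_mult. apply Rle_abs.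
    + generalize (Rabs_pos (lin w q - lin w p)). nra.
  - intros t Ht. apply Kd2. lra.
  - intros mu Hmu. exists r1. split; [exact Hr1|]. intros eps t He Ht.
    rewrite HZ; [apply Hvel; lra|lra|].
    assert (dist1 (g t) (g t0) < r / 2) by (apply Kd2; lra). lra.
Qed.

(* Around g t0 the curve g passes from the orbit of A into that of B, across
   Sigma, which A crosses transversally; sigma = 1 when it goes upwards. *)
Record contact (t0 : R) (A B : R * R -> R * R) (sigma : R) (b : R -> R -> R)
    (r1 LX d1 : R) : Prop := {
  contact_sigma : sigma = 1 \/ sigma = -1;
  contact_r : 0 < r1;
  contact_L : 0 <= LX;
  contact_d : 0 < d1;
  contact_A : lipschitz_near A (g t0) r1 LX;
  contact_B : lipschitz_near B (g t0) r1 LX;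
  contact_switch : switching b;
  contact_Z : forall eps q, 0 < eps -> dist1 q (g t0) < r1 ->
    Z eps q = blend (b eps (sigma * snd q)) (B q) (A q);
  contact_before : forall t, t0 - d1 < t < t0 ->
    sigma * snd (g t) < 0 /\ velocity g t (A (g t));
  contact_after : forall t, t0 < t < t0 + d1 ->
    0 < sigma * snd (g t) /\ velocity g t (B (g t));
  contact_transversal : 0 < sigma * snd (A (g t0))
}.

Arguments contact_sigma {t0 A B sigma b r1 LX d1}.
Arguments contact_r {t0 A B sigma b r1 LX d1}.
Arguments contact_L {t0 A B sigma b r1 LX d1}.
Arguments contact_d {t0 A B sigma b r1 LX d1}.
Arguments contact_A {t0 A B sigma b r1 LX d1}.
Arguments contact_B {t0 A B sigma b r1 LX d1}.
Arguments contact_switch {t0 A B sigma b r1 LX d1}.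
Arguments contact_Z {t0 A B sigma b r1 LX d1}.
Arguments contact_before {t0 A B sigma b r1 LX d1}.
Arguments contact_after {t0 A B sigma b r1 LX d1}.
Arguments contact_transversal {t0 A B sigma b r1 LX d1}.

(** Away from t0 the height of g is bounded away from 0 on a compact set, so for smaller eps these
    points are off the strip and [Z eps] is A or B there. *)
Lemma contact_orbit t0 A B sigma b r1 LX d1 r :
  contact t0 A B sigma b r1 LX d1 -> 0 < r <= r1 ->
  exists d, 0 < d /\ d <= d1 /\
    (forall t, Rabs (t - t0) < d -> dist1 (g t) (g t0) < r / 2) /\
    (forall mu, 0 < mu -> exists e0, 0 < e0 /\ forall eps t, 0 < eps < e0 ->
       mu < Rabs (t - t0) < d -> velocity g t (Z eps (g t))).
Proof.
  intros H Hr. assert (Hd1 := contact_d H).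
  destruct (proj1 (continuous_curve g t0) (Hg t0) (r / 2)) as [d2 [Hd2 Kd2]]; [lra|].
  set (d := Rmin (d1 / 2) d2).
  assert (Hd : 0 < d /\ d <= d1 / 2 /\ d <= d2).
  { unfold d. split; [apply Rmin_pos; lra|]. split; [apply Rmin_l|apply Rmin_r]. }
  exists d. split; [lra|]. split; [lra|]. split; [intros t Ht; apply Kd2; lra|].
  intros mu Hmu. set (m := Rmin mu d).
  assert (Hm : 0 < m /\ m <= d /\ m <= mu).
  { unfold m. split; [apply Rmin_pos; lra|]. split; [apply Rmin_r|apply Rmin_l]. }
  assert (Hc : forall k t, continuous (fun x => k * snd (g x)) t).
  { intros k t. apply (continuous_scal_r k (fun x => snd (g x))). now apply continuous_curve_snd. }
  destruct (positive_on_segment (fun x => - sigma * snd (g x)) (t0 - d) (t0 - m)) as [m1 [Hm1 K1]];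
    [lra|apply Hc| |].
  { intros x Hx. destruct (contact_before H x); lra. }
  destruct (positive_on_segment (fun x => sigma * snd (g x)) (t0 + m) (t0 + d)) as [m2 [Hm2 K2]];
    [lra|apply Hc| |].
  { intros x Hx. destruct (contact_after H x); lra. }
  exists (Rmin m1 m2). split; [now apply Rmin_pos|]. intros eps t He Ht.
  assert (M1 := Rmin_l m1 m2). assert (M2 := Rmin_r m1 m2).
  destruct (contact_switch H eps ltac:(lra)) as [_ [_ [S0 S1]]].
  assert (Hgt : dist1 (g t) (g t0) < r / 2) by (apply Kd2; lra).
  rewrite (contact_Z H) by lra.
  destruct (Rle_dec t t0) as [Hle|Hgt0].
  - rewrite Rabs_left1 in Ht by lra.
    destruct (contact_before H t) as [_ V]; [lra|].
    specialize (K1 t ltac:(lra)). rewrite S0 by lra.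
    replace (blend 0 (B (g t)) (A (g t))) with (A (g t)); [exact V|].
    unfold blend. destruct (A (g t)); simpl. f_equal; ring.
  - rewrite Rabs_pos_eq in Ht by lra.
    destruct (contact_after H t) as [_ V]; [lra|].
    specialize (K2 t ltac:(lra)). rewrite S1 by lra.
    replace (blend 1 (B (g t)) (A (g t))) with (B (g t)); [exact V|].
    unfold blend. destruct (B (g t)); simpl. f_equal; ring.
Qed.

Lemma convex_bounds b x y lo hi :
  0 <= b <= 1 -> lo <= x <= hi -> lo <= y <= hi -> lo <= b * x + (1 - b) * y <= hi.
Proof. intros. nra. Qed.

Lemma contact_speed t0 A B sigma b r1 LX d1 v w c C r :
  contact t0 A B sigma b r1 LX d1 -> 0 < c -> r <= r1 ->
  (forall q, dist1 q (g t0) < r ->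
       c <= lin v (A q) <= C /\ c <= lin v (B q) <= C /\
       Rabs (lin w (A q)) <= C /\ Rabs (lin w (B q)) <= C) ->
  forall eps q, 0 < eps < r -> dist1 q (g t0) < r ->
    c <= lin v (Z eps q) /\ Rabs (lin v (Z eps q)) <= C /\ Rabs (lin w (Z eps q)) <= C.
Proof.
  intros H Hc Hr Hbd eps q He Hq. rewrite (contact_Z H) by lra.
  assert (Hb := switching_bounds b eps (sigma * snd q) (contact_switch H) ltac:(lra)).
  rewrite !lin_blend. destruct (Hbd q Hq) as [B1 [B2 [B3 B4]]].
  apply Rabs_le_between in B3, B4.
  assert (K1 := convex_bounds _ _ _ _ _ Hb B2 B1). assert (K2 := convex_bounds _ _ _ _ _ Hb B4 B3).
  split; [lra|]. split; apply Rabs_le; lra.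
Qed.

(** Both fields cross Sigma in the same direction, so the height can be the increasing form. Two
    points with equal [lin v] then have equal weights, and the steep transition cancels from the
    comparison of slopes. *)
Lemma crossing_box t0 A B sigma b r1 LX d1 :
  contact t0 A B sigma b r1 LX d1 -> 0 < sigma * snd (B (g t0)) -> has_box Z g t0.
Proof.
  intros H HB. assert (HA := contact_transversal H).
  assert (Hs := contact_sigma H).
  set (v := (0, sigma)). set (w := (1, 0)).
  assert (Hv : forall q, lin v q = sigma * snd q) by (intros q; unfold lin; simpl; ring).
  destruct (blend_bounds A B (g t0) v w r1 LX) as
    [c [C [L [r [Hc [HC [HL [Hr [Hrr [Hch [Hbd Hlip]]]]]]]]]]].
  - apply (contact_r H).
  - apply (contact_L H).
  - apply (contact_A H).
  - apply (contact_B H).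
  - now rewrite Hv.
  - now rewrite Hv.
  - unfold det2. simpl. destruct Hs; lra.
  - destruct (contact_orbit t0 A B sigma b r1 LX d1 r H ltac:(lra)) as [d [Hd [_ [Hnear Horb]]]].
    exists v, w, r, c, C, L, d. split; try assumption.
    + now apply (contact_speed t0 A B sigma b r1 LX d1 v w c C r H).
    + intros eps p q He Hp Hq EV. rewrite !(contact_Z H) by lra.
      assert (EV' : sigma * snd q = sigma * snd p) by (rewrite <- !Hv; congruence).
      rewrite EV'.
      assert (Hb := switching_bounds b eps (sigma * snd p) (contact_switch H) ltac:(lra)).
      assert (K := Hlip _ p q Hb Hp Hq EV).
      rewrite <- pow2_abs. eapply Rle_trans; [apply Rle_abs|]. rewrite Rabs_mult.
      generalize (Rabs_pos (lin w q - lin w p)). nra.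
Qed.

(* f x b stands for the slope at the point x of the blend with weight b; the
   weight increases with the transversal coordinate and f decreases with it, so
   only the Lipschitz dependence on the point matters. *)
Lemma one_sided_weight (f : R * R -> R -> R) (bw rho H : R -> R) (w : R * R) L p q :
  (forall b, 0 <= b <= 1 -> Rabs (f q b - f p b) <= L * Rabs (lin w q - lin w p)) ->
  (forall x b1 b2, x = p \/ x = q -> 0 <= b1 <= b2 -> b2 <= 1 ->
     rho b2 * f x b2 <= rho b1 * f x b1) ->
  (forall x, 0 <= bw x <= 1) -> (forall x y, x <= y -> bw x <= bw y) -> 0 <= L ->
  (forall b, 0 <= b <= 1 -> 0 <= rho b) ->
  (forall x y, x <= y -> rho (bw x) * (y - x) <= H y - H x) ->
  (H (lin w q) - H (lin w p)) *
    (rho (bw (lin w q)) * f q (bw (lin w q)) - rho (bw (lin w p)) * f p (bw (lin w p)))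
  <= L * (H (lin w q) - H (lin w p)) ^ 2.
Proof.
  intros Hf0 Hmon0 Hb Hbm HL Hrho HH.
  assert (Hle : forall p q, lin w p <= lin w q ->
    (forall b, 0 <= b <= 1 -> Rabs (f q b - f p b) <= L * Rabs (lin w q - lin w p)) ->
    (forall b1 b2, 0 <= b1 <= b2 -> b2 <= 1 -> rho b2 * f q b2 <= rho b1 * f q b1) ->
    (H (lin w q) - H (lin w p)) *
      (rho (bw (lin w q)) * f q (bw (lin w q)) - rho (bw (lin w p)) * f p (bw (lin w p)))
    <= L * (H (lin w q) - H (lin w p)) ^ 2).
  { clear Hf0 Hmon0 p q. intros p q Hpq Hf Hmon.
    assert (K1 := HH _ _ Hpq). set (x := lin w p) in *. set (y := lin w q) in *.
    assert (B1 := Hb x). assert (B2 := Hb y). assert (B12 := Hbm x y Hpq).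
    assert (R1 := Hrho (bw x) B1).
    assert (K2 := Hmon (bw x) (bw y) ltac:(lra) ltac:(lra)).
    assert (K3 := Hf (bw x) B1). rewrite (Rabs_pos_eq (y - x)) in K3 by lra.
    apply Rabs_le_between in K3.
    assert (Hx : 0 <= rho (bw x) * (y - x)) by (apply Rmult_le_pos; lra).
    set (dH := H y - H x) in *.
    assert (rho (bw y) * f q (bw y) - rho (bw x) * f p (bw x) <= L * dH).
    { apply Rle_trans with (rho (bw x) * (f q (bw x) - f p (bw x))); [lra|].
      apply Rle_trans with (rho (bw x) * (L * (y - x))); [apply Rmult_le_compat_l; lra|].
      replace (rho (bw x) * (L * (y - x))) with (L * (rho (bw x) * (y - x))) by ring.
      apply Rmult_le_compat_l; lra. }
    replace (L * dH ^ 2) with (dH * (L * dH)) by ring.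
    apply Rmult_le_compat_l; lra. }
  destruct (Rle_dec (lin w p) (lin w q)) as [Hpq|Hpq].
  - apply Hle; [exact Hpq|exact Hf0|]. intros b1 b2. apply Hmon0. now right.
  - assert (K := Hle q p ltac:(lra)).
    enough ((H (lin w p) - H (lin w q)) *
      (rho (bw (lin w p)) * f p (bw (lin w p)) - rho (bw (lin w q)) * f q (bw (lin w q)))
      <= L * (H (lin w p) - H (lin w q)) ^ 2) by lra.
    apply K.
    + intros b Hb'. rewrite Rabs_minus_sym, (Rabs_minus_sym (lin w p)). now apply Hf0.
    + intros b1 b2. apply Hmon0. now left.
Qed.

(** * The weighted transversal coordinate at a tangential singularity *)

Lemma primitive (h : R -> R) :
  (forall x, continuous h x) -> exists H, forall x, is_derive H x (h x).
Proof.
  intros Hh. exists (fun x => RInt h 0 x). intros x.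
  apply (is_derive_RInt h (fun t => RInt h 0 t) 0 x).
  - apply filter_forall. intros t. apply (@RInt_correct R_CompleteNormedModule).
    apply (@ex_RInt_continuous R_CompleteNormedModule). intros; apply Hh.
  - apply Hh.
Qed.

(** The function with value 1 at b = 0 and derivative theta / (eta + 1 - b). *)
Definition log_weight (theta eta b : R) : R := 1 + theta * ln ((1 + eta) / (eta + 1 - b)).

Lemma log_weight_0 theta eta : 0 < eta -> log_weight theta eta 0 = 1.
Proof.
  intros He. unfold log_weight.
  replace ((1 + eta) / (eta + 1 - 0)) with 1 by (field; lra). rewrite ln_1. ring.
Qed.

(** The derivative of the weight in the form of differences, from 1 + ln x <= x. *)
Lemma log_weight_increment theta eta b1 b2 :
  0 <= theta -> 0 < eta -> b1 <= b2 -> b2 <= 1 ->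
  0 <= (log_weight theta eta b2 - log_weight theta eta b1) * (eta + 1 - b2) <= theta * (b2 - b1).
Proof.
  intros Ht He Hb Hb2. unfold log_weight.
  set (x1 := eta + 1 - b1). set (x2 := eta + 1 - b2).
  assert (Hx : 0 < x2 <= x1) by (unfold x1, x2; lra).
  unfold Rdiv. rewrite !ln_mult by (try lra; apply Rinv_0_lt_compat; lra).
  rewrite !ln_Rinv by lra.
  replace (1 + theta * (ln (1 + eta) + - ln x2) - (1 + theta * (ln (1 + eta) + - ln x1)))
    with (theta * (ln x1 - ln x2)) by ring.
  assert (Hln : 0 <= ln x1 - ln x2) by (generalize (ln_le x2 x1); lra).
  assert (Hln2 : (ln x1 - ln x2) * x2 <= x1 - x2).
  { replace (ln x1 - ln x2) with (ln (x1 / x2))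
      by (unfold Rdiv; rewrite ln_mult by (try apply Rinv_0_lt_compat; lra); rewrite ln_Rinv by lra; ring).
    assert (Hq : 0 < x1 / x2) by (apply Rdiv_lt_0_compat; lra).
    assert (E : 1 + ln (x1 / x2) <= x1 / x2).
    { rewrite <- (exp_ln (x1 / x2)) at 2 by exact Hq. apply exp_ineq1_le. }
    replace (x1 - x2) with ((x1 / x2 - 1) * x2) by (field; lra).
    apply Rmult_le_compat_r; lra. }
  split.
  - apply Rmult_le_pos; [|lra]. now apply Rmult_le_pos.
  - rewrite Rmult_assoc. replace (b2 - b1) with (x1 - x2) by (unfold x1, x2; ring).
    now apply Rmult_le_compat_l.
Qed.

Lemma log_weight_ge_1 theta eta b : 0 <= theta -> 0 < eta -> 0 <= b <= 1 -> 1 <= log_weight theta eta b.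
Proof.
  intros Ht He Hb.
  assert (K := log_weight_increment theta eta 0 b Ht He ltac:(lra) ltac:(lra)).
  rewrite log_weight_0 in K by exact He.
  destruct (Rle_dec 1 (log_weight theta eta b)) as [|Hn]; [assumption|exfalso]. nra.
Qed.

Lemma log_weight_continuous theta eta (bw : R -> R) x :
  0 < eta -> (forall x, 0 <= bw x <= 1) -> continuous bw x ->
  continuous (fun x => log_weight theta eta (bw x)) x.
Proof.
  intros He Hb Hc.
  apply (continuous_comp bw (log_weight theta eta)); [exact Hc|].
  apply ex_derive_continuous_R.
  unfold log_weight. specialize (Hb x). auto_derive. split; [lra|]. split; [|exact I].
  apply Rmult_lt_0_compat; [lra|apply Rinv_0_lt_compat; lra].
Qed.

(** By the choice of eta the determinant WA VB - WB VA is at least j = a c / 4, so f1 - f2 >= (b2 -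
    b1) j / C^2. The slope f2 is at most C (eta + 1 - b2) / c, so multiplying it by the increment of
    the weight gives at most C theta (b2 - b1) / c. The bound on theta is exactly C theta / c <= j /
    C^2. *)
Lemma weighted_slope_decreasing VA VB WA WB c C a eta theta b1 b2 :
  0 < c -> 1 <= C -> c <= VA <= C -> c <= VB <= C -> a / 2 <= WA <= C ->
  Rabs WB <= eta -> 0 < eta -> eta <= a * c / (4 * C) ->
  0 <= theta -> theta <= a * c * c / (4 * C ^ 3) -> 0 <= b1 <= b2 -> b2 <= 1 ->
  log_weight theta eta b2 * ((b2 * WB + (1 - b2) * WA) / (b2 * VB + (1 - b2) * VA)) <=
  log_weight theta eta b1 * ((b1 * WB + (1 - b1) * WA) / (b1 * VB + (1 - b1) * VA)).
Proof.
  intros Hc HC HVA HVB HWA HWB He He2 Ht Ht2 Hb Hb2.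
  apply Rabs_le_between in HWB.
  set (V1 := b1 * VB + (1 - b1) * VA). set (V2 := b2 * VB + (1 - b2) * VA).
  assert (HV1 : c <= V1 <= C) by (apply convex_bounds; lra).
  assert (HV2 : c <= V2 <= C) by (apply convex_bounds; lra).
  set (f1 := (b1 * WB + (1 - b1) * WA) / V1). set (f2 := (b2 * WB + (1 - b2) * WA) / V2).
  set (j := a * c / 4).
  assert (HeC : eta * C <= j).
  { apply (Rmult_le_compat_r C) in He2; [|lra].
    replace (a * c / (4 * C) * C) with j in He2 by (unfold j; field; lra). exact He2. }
  assert (Hj : 0 < j) by nra.
  assert (Ha : 0 < a) by (unfold j in Hj; nra).
  assert (HJ : j <= WA * VB - WB * VA).
  { assert (a / 2 * c <= WA * VB) by (apply Rmult_le_compat; lra).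
    assert (WB * VA <= eta * C) by nra. unfold j in *. lra. }
  assert (Hf12 : (b2 - b1) * j <= (f1 - f2) * (C * C)).
  { assert (E : (f1 - f2) * (V1 * V2) = (b2 - b1) * (WA * VB - WB * VA)).
    { unfold f1, f2. unfold V1, V2 in *. field. lra. }
    assert (P0 : 0 <= (b2 - b1) * j) by (apply Rmult_le_pos; lra).
    assert (P1 : (b2 - b1) * j <= (f1 - f2) * (V1 * V2)).
    { rewrite E. apply Rmult_le_compat_l; lra. }
    assert (P2 : 0 < V1 * V2 <= C * C).
    { split; [apply Rmult_lt_0_compat; lra|apply Rmult_le_compat; lra]. }
    assert (0 <= f1 - f2).
    { apply Rmult_le_reg_r with (V1 * V2); lra. }
    eapply Rle_trans; [exact P1|]. apply Rmult_le_compat_l; lra. }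
  set (x2 := eta + 1 - b2).
  assert (Hx2 : 0 < x2) by (unfold x2; lra).
  assert (Hf2 : f2 * c <= C * x2).
  { assert (HN : b2 * WB + (1 - b2) * WA <= C * x2) by (unfold x2; nra).
    destruct (Rle_dec 0 f2) as [Hpos|Hneg]; [|assert (0 <= C * x2) by (apply Rmult_le_pos; lra); nra].
    apply Rle_trans with (f2 * V2); [apply Rmult_le_compat_l; lra|].
    unfold f2. replace ((b2 * WB + (1 - b2) * WA) / V2 * V2) with (b2 * WB + (1 - b2) * WA) by (field; lra).
    exact HN. }
  assert (K := log_weight_increment theta eta b1 b2 Ht He ltac:(lra) Hb2). fold x2 in K.
  assert (K1 := log_weight_ge_1 theta eta b1 Ht He ltac:(lra)).
  set (r1 := log_weight theta eta b1) in *. set (r2 := log_weight theta eta b2) in *.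
  assert (Hr : 0 <= r2 - r1).
  { apply Rmult_le_reg_r with x2; [exact Hx2|]. lra. }
  assert (HtC : C * theta * (C * C) <= j * c).
  { apply (Rmult_le_compat_r (C ^ 3)) in Ht2; [|apply pow_le; lra].
    replace (a * c * c / (4 * C ^ 3) * C ^ 3) with (j * c) in Ht2 by (unfold j; field; lra). lra. }
  assert (Hmain : f2 * (r2 - r1) <= f1 - f2).
  { apply Rmult_le_reg_r with (c * (C * C)); [repeat apply Rmult_lt_0_compat; lra|].
    apply Rle_trans with (C * theta * (C * C) * (b2 - b1)).
    - assert (S1 : f2 * c * (r2 - r1) <= C * x2 * (r2 - r1)) by (apply Rmult_le_compat_r; lra).
      assert (S2 : C * ((r2 - r1) * x2) <= C * (theta * (b2 - b1))) by (apply Rmult_le_compat_l; lra).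
      replace (f2 * (r2 - r1) * (c * (C * C))) with (f2 * c * (r2 - r1) * (C * C)) by ring.
      replace (C * theta * (C * C) * (b2 - b1)) with (C * (theta * (b2 - b1)) * (C * C)) by ring.
      apply Rmult_le_compat_r; [nra|lra].
    - apply Rle_trans with (j * c * (b2 - b1)); [apply Rmult_le_compat_r; lra|].
      replace ((f1 - f2) * (c * (C * C))) with (c * ((f1 - f2) * (C * C))) by ring.
      replace (j * c * (b2 - b1)) with (c * ((b2 - b1) * j)) by ring.
      apply Rmult_le_compat_l; lra. }
  assert (0 <= f1 - f2).
  { apply Rmult_le_reg_r with (C * C); [nra|]. rewrite Rmult_0_l.
    eapply Rle_trans; [|exact Hf12]. apply Rmult_le_pos; lra. }
  assert (f1 - f2 <= r1 * (f1 - f2)) by nra. lra.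
Qed.

(* The ratio of the weights at the two ends is log_weight 1, which grows without
   bound as eta goes to 0, that is as the box shrinks. *)
Lemma tangential_boxes t0 A B sigma b r1 LX d1 :
  contact t0 A B sigma b r1 LX d1 -> snd (B (g t0)) = 0 -> fst (B (g t0)) <> 0 ->
  exists v w c C L, 0 < c /\ 1 <= C /\ forall ratio, 0 < ratio ->
  exists r d, flow_box Z g t0 v w r c C L d /\
    forall s t, t0 - d < s < t0 -> t0 < t < t0 + d ->
    exists Aout, 0 < Aout /\ 1 / Aout <= ratio /\ weighted_box Z g t0 v w r L s t 1 Aout.
Proof.
  intros H HB0 HB1.
  assert (HA := contact_transversal H).
  assert (Hs := contact_sigma H).
  assert (HLX := contact_L H).
  assert (Hr1 := contact_r H).
  set (p := g t0) in *.
  set (a := sigma * snd (A p)) in *.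
  (* The horizontal direction in which the tangent field B moves. *)
  set (m := if Rlt_dec 0 (fst (B p)) then 1 else -1).
  assert (Hm : (m = 1 \/ m = -1) /\ 0 < m * fst (B p)).
  { unfold m. destruct (Rlt_dec 0 (fst (B p))); split; [now left|lra|now right|lra]. }
  (* The form [v] must also increase along A. Adding k times the height contributes k a = |fst (A
     p)| + 1 there, and nothing along B at p, where B is horizontal. *)
  set (k := (Rabs (fst (A p)) + 1) / a).
  set (v := (m, k * sigma)). set (w := (0, sigma)).
  assert (Hw : forall q, lin w q = sigma * snd q) by (intros q; unfold lin; simpl; ring).
  assert (Hv : forall q, lin v q = m * fst q + k * (sigma * snd q)) by (intros q; unfold lin; simpl; ring).
  destruct (blend_bounds A B p v w r1 LX) as
    [c [C [L [r2 [Hc [HC [HL [Hr2 [Hrr [Hch [Hbd Hlip]]]]]]]]]]].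
  { exact Hr1. } { exact HLX. }
  { apply (contact_A H). } { apply (contact_B H). }
  { rewrite Hv. fold a. replace (k * a) with (Rabs (fst (A p)) + 1) by (unfold k; field; lra).
    assert (Hab := Rle_abs (fst (A p))). assert (Hab' := Rle_abs (- fst (A p))).
    rewrite Rabs_Ropp in Hab'. destruct Hm as [[->| ->] _]; lra. }
  { rewrite Hv, HB0. lra. }
  { unfold det2. simpl. destruct Hm as [[->| ->] _], Hs as [->| ->]; lra. }
  set (theta := a * c * c / (4 * C ^ 3)).
  assert (HC3 : 0 < C ^ 3) by (apply pow_lt; lra).
  assert (Htheta : 0 < theta).
  { unfold theta. apply Rdiv_lt_0_compat; [|lra].
    apply Rmult_lt_0_compat; [apply Rmult_lt_0_compat|]; lra. }
  exists v, w, c, C, L. split; [exact Hc|]. split; [exact HC|]. intros ratio Hratio.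
  (* The first bound is the one of [weighted_slope_decreasing]; the second makes theta ln (1 / eta)
     at least 1 / ratio. *)
  set (eta := Rmin (a * c / (4 * C)) (exp (- (/ ratio / theta)))).
  assert (Heta : 0 < eta /\ eta <= a * c / (4 * C) /\ eta <= exp (- (/ ratio / theta))).
  { unfold eta. split; [|split; [apply Rmin_l|apply Rmin_r]].
    apply Rmin_pos; [|apply exp_pos]. apply Rdiv_lt_0_compat; [|lra]. apply Rmult_lt_0_compat; lra. }
  (* In a box of this radius the normal component of A stays above a / 2 and that of B below eta. *)
  destruct (small_positive 1 r2 LX (a / 2) LX eta 1 1) as [r [Hr [Hrr2 [Hra [Hre _]]]]]; try lra.
  assert (Hnw : dist1 w (0, 0) = 1).
  { unfold dist1, w. simpl. rewrite !Rminus_0_r, Rabs_R0.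
    destruct Hs as [->| ->]; [rewrite Rabs_R1|rewrite Rabs_left by lra]; ring. }
  assert (Hw_near : forall (X : R * R -> R * R) q, lipschitz_near X p r1 LX -> dist1 q p < r ->
    Rabs (lin w (X q) - lin w (X p)) <= LX * r).
  { intros X q HX Hq. eapply Rle_trans; [apply lin_lipschitz|]. rewrite Hnw, Rmult_1_l.
    eapply Rle_trans; [apply HX; [lra|rewrite dist1_refl; lra]|]. apply Rmult_le_compat_l; lra. }
  assert (HWA : forall q, dist1 q p < r -> a / 2 <= lin w (A q) <= C).
  { intros q Hq. assert (K := Hw_near A q (contact_A H) Hq).
    rewrite (Hw (A p)) in K. fold a in K. apply Rabs_le_between in K.
    destruct (Hbd q ltac:(lra)) as [_ [_ [B3 _]]]. apply Rabs_le_between in B3. lra. }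
  assert (HWB : forall q, dist1 q p < r -> Rabs (lin w (B q)) <= eta).
  { intros q Hq. assert (K := Hw_near B q (contact_B H) Hq).
    rewrite (Hw (B p)), HB0, Rmult_0_r, Rminus_0_r in K. lra. }
  set (f := fun q x => slope v w (blend x (B q) (A q))).
  assert (Hmon : forall th q b1 b2, 0 <= th <= theta -> dist1 q p < r -> 0 <= b1 <= b2 -> b2 <= 1 ->
    log_weight th eta b2 * f q b2 <= log_weight th eta b1 * f q b1).
  { intros th q b1 b2 Hth Hq Hb Hb2. unfold f, slope. rewrite !lin_blend.
    destruct (Hbd q ltac:(lra)) as [B1 [B2 _]].
    apply (weighted_slope_decreasing _ _ _ _ c C a); try assumption; try lra.
    - now apply HWA.
    - now apply HWB.
    - unfold theta in Hth. lra. }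
  assert (HZ : forall eps q, 0 < eps -> dist1 q p < r ->
    Z eps q = blend (b eps (lin w q)) (B q) (A q)).
  { intros eps q He Hq. rewrite Hw. apply (contact_Z H); [exact He|fold p; lra]. }
  assert (Hsw := contact_switch H).
  assert (Hosl : forall eps th H', 0 < eps -> 0 <= th <= theta ->
    (forall x y, x <= y -> log_weight th eta (b eps x) * (y - x) <= H' y - H' x) ->
    forall q q', dist1 q p < r -> dist1 q' p < r -> lin v q = lin v q' ->
    (H' (lin w q') - H' (lin w q)) *
      (log_weight th eta (b eps (lin w q')) * slope v w (Z eps q') -
       log_weight th eta (b eps (lin w q)) * slope v w (Z eps q))
    <= L * (H' (lin w q') - H' (lin w q)) ^ 2).
  { intros eps th H' He Hth HH q q' Hq Hq' EV. rewrite !HZ by assumption.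
    apply (one_sided_weight f (b eps) (log_weight th eta) H' w L q q'); try assumption.
    - intros x Hx. apply Hlip; [exact Hx|lra|lra|exact EV].
    - intros x b1 b2 [->| ->] Hb Hb2; now apply Hmon.
    - intros x. now apply switching_bounds.
    - now apply Hsw.
    - intros x Hx. generalize (log_weight_ge_1 th eta x ltac:(lra) ltac:(lra) Hx). lra. }
  destruct (contact_orbit t0 A B sigma b r1 LX d1 r H ltac:(lra)) as [d [Hd [Hdd [Hnear Horb]]]].
  exists r, d. split.
  - split; try assumption; try lra.
    + apply (contact_speed t0 A B sigma b r1 LX d1 v w c C r H Hc); [lra|].
      intros q Hq. apply Hbd. fold p in Hq. lra.
    + intros eps q q' He Hq Hq' EV.
      (* For theta = 0 the weight is 1 and H the identity: the plain one-sided Lipschitz condition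
         of a flow box. *)
      assert (K := Hosl eps 0 (fun x => x) ltac:(lra) ltac:(lra)).
      unfold log_weight in K.
      assert (K' := K ltac:(intros; rewrite Rmult_0_l; lra) q q' Hq Hq' EV).
      rewrite !Rmult_0_l, !Rplus_0_r, !Rmult_1_l in K'. exact K'.
  - intros s t Hst Ht.
    set (Aout := log_weight theta eta 1).
    assert (HA1 : 1 <= Aout) by (apply log_weight_ge_1; lra).
    exists Aout. split; [lra|]. split.
    + assert (Hln : / ratio / theta <= ln ((1 + eta) / (eta + 1 - 1))).
      { rewrite <- (ln_exp (/ ratio / theta)). apply ln_le; [apply exp_pos|].
        replace (eta + 1 - 1) with eta by ring.
        destruct Heta as [He0 [_ He]]. rewrite exp_Ropp in He.
        assert (Hep := exp_pos (/ ratio / theta)).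
        apply Rmult_le_reg_r with eta; [exact He0|].
        replace ((1 + eta) / eta * eta) with (1 + eta) by (field; lra).
        apply (Rmult_le_compat_l (exp (/ ratio / theta))) in He; [|lra].
        rewrite Rinv_r in He by lra. lra. }
      assert (Hbig : / ratio <= Aout).
      { unfold Aout, log_weight. apply (Rmult_le_compat_l theta) in Hln; [|lra].
        replace (theta * (/ ratio / theta)) with (/ ratio) in Hln by (field; lra). lra. }
      unfold Rdiv. rewrite Rmult_1_l. rewrite <- (Rinv_inv ratio).
      apply Rinv_le_contravar; [now apply Rinv_0_lt_compat|exact Hbig].
    + destruct (contact_before H s) as [Hhs _]; [lra|].
      destruct (contact_after H t) as [Hht _]; [lra|].
      (* For eps < d0 the d0-neighbourhoods of both ends lie off the strip, so H' is constantly 1 at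
         the entry and [Aout] at the exit. *)
      set (d0 := Rmin (- (sigma * snd (g s))) (sigma * snd (g t)) / 2).
      assert (Hd0 : 0 < d0 /\ sigma * snd (g s) <= - (2 * d0) /\ 2 * d0 <= sigma * snd (g t)).
      { assert (0 < Rmin (- (sigma * snd (g s))) (sigma * snd (g t))) by (apply Rmin_pos; lra).
        generalize (Rmin_l (- (sigma * snd (g s))) (sigma * snd (g t)))
          (Rmin_r (- (sigma * snd (g s))) (sigma * snd (g t))). unfold d0. lra. }
      exists d0, d0. split; [lra|]. split; [lra|]. intros eps He.
      destruct (Hsw eps ltac:(lra)) as [Hbc [Hbm [Hb0 Hb1]]].
      set (h := fun x => log_weight theta eta (b eps x)).
      destruct (primitive h) as [H' HH'].
      { intros x. apply log_weight_continuous; [lra| |apply Hbc].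
        intros y. apply switching_bounds; [exact Hsw|lra]. }
      assert (Hincr : forall x y, x <= y -> h x * (y - x) <= H' y - H' x).
      { intros x y Hxy. apply increment_ge; [exact Hxy| |].
        - intros z Hz. exists (h z). split; [apply HH'|]. unfold h.
          assert (B1 := switching_bounds b eps x Hsw ltac:(lra)).
          assert (B2 := switching_bounds b eps z Hsw ltac:(lra)).
          assert (K := log_weight_increment theta eta (b eps x) (b eps z) ltac:(lra) ltac:(lra)
            ltac:(apply Hbm; lra) ltac:(lra)).
          enough (0 <= log_weight theta eta (b eps z) - log_weight theta eta (b eps x)) by lra.
          apply Rmult_le_reg_r with (eta + 1 - b eps z); lra.
        - intros z _. apply ex_derive_continuous_R. eexists; apply HH'. }
      exists H', h. split; [exact HH'|]. split; [|split].
      * intros q q' Hq Hq' EV. apply (Hosl eps theta H'); try assumption; lra.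
      * intros x x' Hx Hx'. rewrite Hw in Hx, Hx'. apply Rabs_lt_between in Hx, Hx'.
        apply segment_lipschitz. intros z Hz.
        assert (Hz' : z <= - eps).
        { revert Hz. unfold Rmax. destruct (Rle_dec x x'); lra. }
        split; [eexists; apply HH'|]. rewrite (is_derive_unique _ _ _ (HH' z)). unfold h.
        rewrite Hb0 by exact Hz'. rewrite log_weight_0 by lra. rewrite Rabs_R1. lra.
      * intros x x' Hx Hx'. rewrite Hw in Hx, Hx'. apply Rabs_lt_between in Hx, Hx'.
        assert (Ex : h x = Aout) by (unfold h; rewrite Hb1 by lra; reflexivity).
        assert (Ex' : h x' = Aout) by (unfold h; rewrite Hb1 by lra; reflexivity).
        destruct (Rle_dec x x') as [Hle|Hgt].
        -- rewrite Rabs_minus_sym, (Rabs_minus_sym (H' x)), (Rabs_pos_eq (x' - x)) by lra.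
           eapply Rle_trans; [|apply Rle_abs]. rewrite <- Ex. now apply Hincr.
        -- rewrite (Rabs_pos_eq (x - x')) by lra.
           eapply Rle_trans; [|apply Rle_abs]. rewrite <- Ex'. apply Hincr. lra.
Qed.

(** The passage over the prescribed interval has three legs. The two outer ones use a fixed box and
    cost the factor G each; the inner one uses a smaller box with the same constants, chosen so late
    that its ratio can absorb G ^ 3. *)
Lemma tangential_link t0 A B sigma b r1 LX d1 r0 :
  0 < r0 ->
  contact t0 A B sigma b r1 LX d1 -> snd (B (g t0)) = 0 -> fst (B (g t0)) <> 0 ->
  has_box Z g t0 /\ exists d, 0 < d /\ forall e kappa, 0 < e < d -> 0 < kappa ->
    exists kappa', 0 <= kappa' <= kappa /\ link Z g r0 kappa' (t0 - e) (t0 + e).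
Proof.
  intros Hr0 H HB0 HB1.
  destruct (tangential_boxes t0 A B sigma b r1 LX d1 H HB0 HB1) as [v [w [c [C [L [Hc [HC Hbox]]]]]]].
  destruct (Hbox 1) as [r [d [Bx _]]]; [lra|]. split.
  { now exists v, w, r, c, C, L, d. }
  assert (Hd := box_d Bx).
  exists d. split; [exact Hd|]. intros e0 kappa He0 Hk.
  set (G := C * gain c C L).
  assert (HG : 0 < G) by (apply Rmult_lt_0_compat; [lra|now apply gain_pos]).
  assert (HG3 : 0 < G * G * G) by exact (Rmult_lt_0_compat _ _ (Rmult_lt_0_compat _ _ HG HG) HG).
  destruct (Hbox (kappa / (G * G * G))) as [r' [d' [Bx' Hw]]]; [now apply Rdiv_lt_0_compat|].
  assert (Hd' := box_d Bx').
  set (e := Rmin (e0 / 2) (d' / 2)).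
  assert (He : 0 < e /\ e <= e0 / 2 /\ e <= d' / 2).
  { unfold e. split; [apply Rmin_pos; lra|]. split; [apply Rmin_l|apply Rmin_r]. }
  destruct (Hw (t0 - e) (t0 + e)) as [Aout [HAo [Hratio HW]]]; [lra|lra|].
  assert (L2 := box_link Z g r0 Hg Hr0 t0 v w r' c C L d' (t0 - e) (t0 + e) 1 Aout Bx'
    ltac:(lra) ltac:(lra) ltac:(lra) ltac:(lra) HAo HW). fold G in L2.
  assert (Hout : forall s t, t0 - d < s -> s < t -> t < t0 + d -> link Z g r0 G s t).
  { intros s t Hs Hst Ht.
    assert (L1 := box_link Z g r0 Hg Hr0 t0 v w r c C L d s t 1 1 Bx Hs Hst Ht
      ltac:(lra) ltac:(lra) (weighted_box_trivial Z g t0 v w r c C L d s t Bx)).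
    fold G in L1. now rewrite Rdiv_diag, Rmult_1_r in L1 by lra. }
  assert (HA1 : 0 < 1 / Aout) by (apply Rdiv_lt_0_compat; lra).
  assert (HGA : 0 < G * (1 / Aout)) by now apply Rmult_lt_0_compat.
  exists (G * (G * (1 / Aout)) * G). split.
  - split; [apply (Rmult_le_pos (G * _) G); [apply (Rmult_le_pos G)|]; lra|].
    replace (G * (G * (1 / Aout)) * G) with (G * G * G * (1 / Aout)) by (field; lra).
    apply (Rmult_le_compat_l (G * G * G)) in Hratio; [|lra].
    replace (G * G * G * (kappa / (G * G * G))) with kappa in Hratio by (field; lra). exact Hratio.
  - apply link_compose with (t0 + e); [apply (Rmult_le_pos G); lra|lra| |apply Hout; lra].
    apply link_compose with (t0 - e); [lra|lra|apply Hout; lra|exact L2].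
Qed.

End Contacts.

(** * The boxes along a polycycle of type (ii) *)

Lemma lie_snd X q : lie X snd q = snd (X q).
Proof.
  unfold lie, dx, dy. simpl. rewrite Derive_const, Derive_id. ring.
Qed.

(** Since the Lie derivative of order n_i at p_i is not 0, the tangent field does not vanish there,
    so its horizontal component is not 0. *)
Lemma lie_iter_zero X f q j : X q = (0, 0) -> (1 <= j)%nat -> lie_iter X j f q = 0.
Proof.
  intros HX Hj. destruct j as [|j]; [lia|]. unfold lie_iter. simpl. unfold lie at 1.
  rewrite HX. simpl. ring.
Qed.

Lemma subdivision_locate (s : nat -> R) m t :
  (forall j, (j < m)%nat -> s j < s (S j)) -> s O <= t < s m ->
  exists j, (j < m)%nat /\ s j <= t < s (S j).
Proof.
  induction m as [|m IH]; intros Hs Ht; [lra|].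
  destruct (Rlt_dec t (s m)) as [Hlt|Hge].
  - destruct IH as [j [Hj Hjt]]; [intros; apply Hs; lia|lra|]. exists j. split; [lia|exact Hjt].
  - exists m. split; [lia|lra].
Qed.

Lemma lipschitz_near_le X q r L r' L' :
  lipschitz_near X q r L -> r' <= r -> L <= L' -> lipschitz_near X q r' L'.
Proof.
  intros H Hr HL p p' Hp Hp'. eapply Rle_trans; [apply H; lra|].
  apply Rmult_le_compat_r; [apply dist1_pos|exact HL].
Qed.

Lemma lipschitz_near_ball X q r L p :
  lipschitz_near X q r L -> dist1 p q < r / 2 -> lipschitz_near X p (r / 2) L.
Proof.
  intros H Hp x x' Hx Hx'. apply H.
  - generalize (dist1_triangle x p q). lra.
  - generalize (dist1_triangle x' p q). lra.
Qed.

(** Used contraposed: fields that differ at g t0 differ along g nearby, so the velocity of g tells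
    which of them it follows. *)
Lemma lipschitz_near_limit A B (g : R -> R * R) t0 r L :
  0 < r -> 0 <= L -> continuous g t0 ->
  lipschitz_near A (g t0) r L -> lipschitz_near B (g t0) r L ->
  (forall d, 0 < d -> exists t, Rabs (t - t0) < d /\ A (g t) = B (g t)) ->
  A (g t0) = B (g t0).
Proof.
  intros Hr HL Hg HA HB H. apply dist1_eq0. apply le_epsilon. intros e He.
  destruct (small_positive 2 r L (e / 2) 1 1 1 1) as [h [Hh [Hhr [HhL _]]]]; try lra.
  destruct (proj1 (continuous_curve g t0) Hg h Hh) as [d [Hd K]].
  destruct (H d Hd) as [t [Ht E]]. specialize (K t Ht).
  assert (Q1 := HA (g t0) (g t) ltac:(rewrite dist1_refl; exact Hr) ltac:(lra)).
  assert (Q2 := HB (g t) (g t0) ltac:(lra) ltac:(rewrite dist1_refl; exact Hr)).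
  rewrite (dist1_sym (g t0)) in Q1. rewrite <- E in Q2.
  generalize (dist1_triangle (A (g t0)) (A (g t)) (B (g t0))).
  assert (L * dist1 (g t) (g t0) <= L * h) by (apply Rmult_le_compat_l; lra). lra.
Qed.

Section Polycycle.

Context (D : R * R -> Prop) (Xp Xm : R * R -> R * R) (g : R -> R * R).
Context (Z : R -> R * R -> R * R) (beta : R -> R) (K : R).
Context (Hg : forall t, continuous g t) (HDg : forall t, D (g t)).
Context (Hbeta : transition_weight K beta).
Context (HZ : forall eps q, Z eps q = blend (beta (snd q / eps)) (Xp q) (Xm q)).
Context (HLp : forall q, D q -> 0 <= snd q ->
  exists r L, 0 < r /\ 0 <= L /\ lipschitz_near Xp q r L).
Context (HLm : forall q, D q -> snd q <= 0 ->
  exists r L, 0 < r /\ 0 <= L /\ lipschitz_near Xm q r L).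

Definition field_on (up : bool) : R * R -> R * R := if up then Xp else Xm.
Definition side (up : bool) : R := if up then 1 else -1.

Lemma side_negb up : side (negb up) = - side up.
Proof. destruct up; simpl; lra. Qed.

Lemma field_on_lipschitz up q :
  D q -> 0 <= side up * snd q -> exists r L, 0 < r /\ 0 <= L /\ lipschitz_near (field_on up) q r L.
Proof. intros HDq Hq. destruct up; simpl in *; [apply HLp|apply HLm]; trivial; lra. Qed.

Lemma both_lipschitz q : D q -> snd q = 0 ->
  exists r L, 0 < r /\ 0 <= L /\
    forall up, lipschitz_near (field_on up) q r L.
Proof.
  intros HDq H0.
  destruct (HLp q HDq ltac:(lra)) as [r1 [L1 [Hr1 [HL1 K1]]]].
  destruct (HLm q HDq ltac:(lra)) as [r2 [L2 [Hr2 [HL2 K2]]]].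
  exists (Rmin r1 r2), (L1 + L2). split; [now apply Rmin_pos|]. split; [lra|].
  intros [|]; simpl.
  - apply lipschitz_near_le with r1 L1; [exact K1|apply Rmin_l|lra].
  - apply lipschitz_near_le with r2 L2; [exact K2|apply Rmin_r|lra].
Qed.

Lemma field_off_Sigma up q eps :
  0 < eps -> eps <= side up * snd q -> Z eps q = field_on up q.
Proof.
  intros He Hq. rewrite HZ. destruct Hbeta as [_ [_ [H0 H1]]]. destruct up; simpl in *.
  - rewrite H1; [unfold blend; destruct (Xp q); simpl; f_equal; ring|].
    apply Rmult_le_reg_r with eps; [exact He|].
    replace (snd q / eps * eps) with (snd q) by (field; lra). lra.
  - rewrite H0; [unfold blend; destruct (Xm q); simpl; f_equal; ring|].
    apply Rmult_le_reg_r with eps; [exact He|].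
    replace (snd q / eps * eps) with (snd q) by (field; lra). lra.
Qed.

(** For a downward passage the height and the roles of the fields are both reversed, and 1 - beta (-
    x / eps) is again nondecreasing. *)
Lemma field_switching up : exists b, switching b /\ forall eps q, 0 < eps ->
  Z eps q = blend (b eps (side up * snd q)) (field_on up q) (field_on (negb up) q).
Proof.
  destruct Hbeta as [HL [Hm [H0 H1]]].
  assert (Hbc : forall x, continuous beta x) by now apply lipschitz_continuous with K.
  assert (Hle : forall eps x y, 0 < eps -> x <= y * eps -> x / eps <= y).
  { intros eps x y He H. apply Rmult_le_reg_r with eps; [exact He|].
    replace (x / eps * eps) with x by (field; lra). exact H. }
  assert (Hge : forall eps x y, 0 < eps -> y * eps <= x -> y <= x / eps).
  { intros eps x y He H. apply Rmult_le_reg_r with eps; [exact He|].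
    replace (x / eps * eps) with x by (field; lra). exact H. }
  assert (Hdc : forall eps x, continuous (fun x => x / eps) x).
  { intros eps x. apply (continuous_scal_l (fun x => x) (/ eps)). apply continuous_id. }
  destruct up; simpl.
  - exists (fun eps x => beta (x / eps)). split.
    + intros eps He. split; [|split; [|split]].
      * intros x. apply (continuous_comp (fun x => x / eps) beta); [apply Hdc|apply Hbc].
      * intros x y Hxy. apply Hm. apply Hle; [exact He|].
        replace (y / eps * eps) with y by (field; lra). exact Hxy.
      * intros x Hx. apply H0. apply Hle; lra.
      * intros x Hx. apply H1. apply Hge; lra.
    + intros eps q He. rewrite HZ. now rewrite Rmult_1_l.
  - exists (fun eps x => 1 - beta (- x / eps)). split.
    + intros eps He. split; [|split; [|split]].
      * intros x. apply (continuous_minus (fun _ => 1) (fun x => beta (- x / eps))).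
        { apply continuous_const. }
        apply (continuous_comp (fun x => - x / eps) beta); [|apply Hbc].
        apply (continuous_comp Ropp (fun x => x / eps)); [|apply Hdc].
        apply ex_derive_continuous_R. auto_derive. exact I.
      * intros x y Hxy. assert (beta (- y / eps) <= beta (- x / eps)); [|lra].
        apply Hm. apply Hle; [exact He|].
        replace (- x / eps * eps) with (- x) by (field; lra). lra.
      * intros x Hx. rewrite H1; [ring|]. apply Hge; lra.
      * intros x Hx. rewrite H0; [ring|]. apply Hle; lra.
    + intros eps q He. rewrite HZ.
      replace (- (-1 * snd q) / eps) with (snd q / eps) by (field; lra).
      unfold blend. f_equal; ring.
Qed.

(** The Lipschitz constant is of order 1 / eps on Sigma, which is harmless because it only serves
    existence and uniqueness for each fixed eps. The radius does not depend on eps. *)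
Lemma Z_lipschitz_near t0 : exists r, 0 < r /\ forall eps, 0 < eps < r ->
  exists L, 0 <= L /\ lipschitz_near (Z eps) (g t0) r L.
Proof.
  assert (Hoff : forall up, 0 < side up * snd (g t0) -> exists r, 0 < r /\ forall eps, 0 < eps < r ->
    exists L, 0 <= L /\ lipschitz_near (Z eps) (g t0) r L).
  { intros up H. destruct (field_on_lipschitz up (g t0) (HDg t0)) as [r [L [Hr [HL HX]]]]; [lra|].
    set (h := side up * snd (g t0)) in *.
    exists (Rmin r (h / 2)). split; [apply Rmin_pos; lra|]. intros eps He. exists L.
    split; [exact HL|].
    assert (M1 := Rmin_l r (h / 2)). assert (M2 := Rmin_r r (h / 2)).
    assert (Heq : forall p, dist1 p (g t0) < Rmin r (h / 2) -> Z eps p = field_on up p).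
    { intros p Hp. apply field_off_Sigma; [lra|].
      assert (Hs := dist1_snd p (g t0)). apply Rabs_le_between in Hs.
      unfold h in *. destruct up; simpl in *; lra. }
    intros p p' Hp Hp'. rewrite !Heq by assumption. apply HX; lra. }
  destruct (Rtotal_order (snd (g t0)) 0) as [Hneg|[Hzero|Hpos]].
  - apply (Hoff false). simpl. lra.
  - destruct (both_lipschitz (g t0) (HDg t0) Hzero) as [r [L [Hr [HL HX]]]].
    set (r' := Rmin r 1).
    assert (Hr' : 0 < r' /\ r' <= r /\ r' <= 1).
    { unfold r'. split; [apply Rmin_pos; lra|]. split; [apply Rmin_l|apply Rmin_r]. }
    exists r'. split; [lra|]. intros eps He.
    set (M := dist1 (Xp (g t0)) (Xm (g t0)) + 2 * L).
    assert (HM : 0 <= M) by (generalize (dist1_pos (Xp (g t0)) (Xm (g t0))); unfold M; lra).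
    assert (HK : 0 <= Rabs K / eps) by (apply Rdiv_le_0_compat; [apply Rabs_pos|lra]).
    exists (L + Rabs K / eps * M). split.
    { assert (0 <= Rabs K / eps * M) by now apply Rmult_le_pos. lra. }
    intros p p' Hp Hp'. rewrite !HZ.
    assert (Hd := dist1_pos p p').
    set (b := beta (snd p / eps)). set (b' := beta (snd p' / eps)).
    assert (Hb : 0 <= b <= 1) by now apply transition_weight_bounds with K.
    assert (H0 : dist1 (g t0) (g t0) < r) by (rewrite dist1_refl; exact Hr).
    assert (Q1 : dist1 (blend b (Xp p) (Xm p)) (blend b (Xp p') (Xm p')) <= L * dist1 p p').
    { eapply Rle_trans; [now apply blend_dist|].
      assert (E1 := HX true p p' ltac:(lra) ltac:(lra)). assert (E2 := HX false p p' ltac:(lra) ltac:(lra)).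
      simpl in E1, E2. nra. }
    assert (Q2 : dist1 (blend b (Xp p') (Xm p')) (blend b' (Xp p') (Xm p')) <=
      Rabs (b - b') * dist1 (Xp p') (Xm p')).
    { unfold blend, dist1. simpl.
      replace (b * fst (Xp p') + (1 - b) * fst (Xm p') - (b' * fst (Xp p') + (1 - b') * fst (Xm p')))
        with ((b - b') * (fst (Xp p') - fst (Xm p'))) by ring.
      replace (b * snd (Xp p') + (1 - b) * snd (Xm p') - (b' * snd (Xp p') + (1 - b') * snd (Xm p')))
        with ((b - b') * (snd (Xp p') - snd (Xm p'))) by ring.
      rewrite !Rabs_mult. right. ring. }
    assert (Q3 : dist1 (Xp p') (Xm p') <= M).
    { assert (E1 := HX true p' (g t0) ltac:(lra) H0). assert (E2 := HX false (g t0) p' H0 ltac:(lra)).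
      simpl in E1, E2. rewrite (dist1_sym (g t0)) in E2.
      generalize (dist1_triangle (Xp p') (Xp (g t0)) (Xm p'))
        (dist1_triangle (Xp (g t0)) (Xm (g t0)) (Xm p')).
      assert (L * dist1 p' (g t0) <= L * 1) by (apply Rmult_le_compat_l; lra).
      unfold M. lra. }
    assert (Q4 : Rabs (b - b') <= Rabs K / eps * dist1 p p').
    { destruct Hbeta as [HbL _]. eapply Rle_trans; [apply HbL|].
      replace (snd p / eps - snd p' / eps) with ((snd p - snd p') * / eps) by (field; lra).
      assert (Hie : 0 < / eps) by (apply Rinv_0_lt_compat; lra).
      rewrite Rabs_mult, (Rabs_pos_eq (/ eps)) by lra.
      assert (Hs := dist1_snd p p'). assert (Hs0 := Rabs_pos (snd p - snd p')).
      apply Rle_trans with (Rabs K * (Rabs (snd p - snd p') * / eps)).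
      - apply Rmult_le_compat_r; [apply Rmult_le_pos; lra|apply Rle_abs].
      - unfold Rdiv. rewrite Rmult_assoc. apply Rmult_le_compat_l; [apply Rabs_pos|].
        rewrite Rmult_comm. apply Rmult_le_compat_l; lra. }
    eapply Rle_trans; [apply (dist1_triangle _ (blend b (Xp p') (Xm p')))|].
    assert (Rabs (b - b') * dist1 (Xp p') (Xm p') <= Rabs K / eps * dist1 p p' * M).
    { apply Rmult_le_compat; try assumption; [apply Rabs_pos|apply dist1_pos]. }
    lra.
  - apply (Hoff true). simpl. lra.
Qed.

Lemma Z_extension T :
  0 < T -> (forall t, g (t + T) = g t) ->
  exists r, 0 < r /\ forall r0 eps, 0 < r0 <= r -> 0 < eps < r ->
  exists G L M, lipschitz_field L G /\
     (forall q, dist1 (G q) (0, 0) <= M) /\ forall q, tube g r0 q -> G q = Z eps q.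
Proof.
  intros HT Hper.
  assert (HQ : forall a b, a <= b -> exists r, 0 < r /\ forall eps, 0 < eps < r ->
    exists L M, 0 <= L /\ forall t, a <= t <= b -> lipschitz_near (Z eps) (g t) r L /\
      forall q, dist1 q (g t) < r -> dist1 (Z eps q) (0, 0) <= M).
  { apply interval_chain.
    - intros a b c Habc [r1 [Hr1 K1]] [r2 [Hr2 K2]].
      assert (M1 := Rmin_l r1 r2). assert (M2 := Rmin_r r1 r2).
      exists (Rmin r1 r2). split; [now apply Rmin_pos|]. intros eps He.
      destruct (K1 eps) as [L1 [B1 [HL1 K1']]]; [lra|].
      destruct (K2 eps) as [L2 [B2 [HL2 K2']]]; [lra|].
      exists (L1 + L2), (Rmax B1 B2). split; [lra|]. intros t Ht.
      destruct (Rle_dec t b) as [Hb|Hb].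
      + destruct (K1' t) as [Q1 Q2]; [lra|]. split.
        * apply lipschitz_near_le with r1 L1; [exact Q1|exact M1|lra].
        * intros q Hq. eapply Rle_trans; [apply Q2; lra|apply Rmax_l].
      + destruct (K2' t) as [Q1 Q2]; [lra|]. split.
        * apply lipschitz_near_le with r2 L2; [exact Q1|exact M2|lra].
        * intros q Hq. eapply Rle_trans; [apply Q2; lra|apply Rmax_r].
    - intros t0. destruct (Z_lipschitz_near t0) as [r [Hr H]].
      destruct (proj1 (continuous_curve g t0) (Hg t0) (r / 2)) as [d [Hd Kd]]; [lra|].
      exists d. split; [exact Hd|]. intros a b Ha Hab Hb.
      exists (r / 2). split; [lra|]. intros eps He.
      destruct (H eps) as [L [HL HX]]; [lra|].
      exists L, (dist1 (Z eps (g t0)) (0, 0) + L * r). split; [exact HL|]. intros t Ht.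
      assert (Hgt : dist1 (g t) (g t0) < r / 2) by (apply Kd; apply Rabs_def1; lra).
      split; [now apply lipschitz_near_ball with (g t0)|].
      intros q Hq. assert (Hqr : dist1 q (g t0) < r) by (generalize (dist1_triangle q (g t) (g t0)); lra).
      assert (Q := HX q (g t0) Hqr ltac:(rewrite dist1_refl; exact Hr)).
      assert (L * dist1 q (g t0) <= L * r) by (apply Rmult_le_compat_l; lra).
      generalize (dist1_triangle (Z eps q) (Z eps (g t0)) (0, 0)). lra. }
  destruct (HQ 0 T) as [r [Hr H]]; [lra|].
  (* [lipschitz_cutoff] needs its bounds on a tube three times as wide. *)
  exists (r / 3). split; [lra|]. intros r0 eps Hr0 He.
  destruct (H eps) as [L [M [HL K1]]]; [lra|].
  destruct (lipschitz_cutoff g (Z eps) r0 L M) as [G [L' [HG [HGM HGZ]]]]; [lra| | |].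
  - intros t. destruct (periodic_reduce g T 0 HT Hper t) as [s [Hs <-]].
    destruct (K1 s) as [Q _]; [lra|]. apply lipschitz_near_le with r L; [exact Q|lra|lra].
  - intros q [t Ht]. destruct (periodic_reduce g T 0 HT Hper t) as [s [Hs E]].
    destruct (K1 s) as [_ Q]; [lra|]. apply Q. rewrite E. lra.
  - now exists G, L', M.
Qed.

Definition piece (up : bool) (a b : R) : Prop :=
  forall t, a < t < b ->
    0 < side up * snd (g t) /\ velocity g t (field_on up (g t)) /\ field_on up (g t) <> (0, 0).

Lemma piece_box up a b t0 : piece up a b -> a < t0 < b -> has_box Z g t0.
Proof.
  intros Hp Ht0. destruct (Hp t0 Ht0) as [Hh [_ Hne]].
  destruct (field_on_lipschitz up (g t0) (HDg t0)) as [r [L [Hr [HL HX]]]]; [lra|].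
  set (h := side up * snd (g t0)) in *.
  assert (M1 := Rmin_l r (h / 2)). assert (M2 := Rmin_r r (h / 2)).
  apply (regular_box Z g Hg t0 (field_on up) (Rmin r (h / 2)) L (Rmin (t0 - a) (b - t0))); try assumption.
  - apply Rmin_pos; lra.
  - apply lipschitz_near_le with r L; [exact HX|exact M1|lra].
  - intros eps q He Hq. apply field_off_Sigma; [lra|].
    assert (Hs := dist1_snd q (g t0)). apply Rabs_le_between in Hs.
    unfold h in *. destruct up; simpl in *; lra.
  - apply Rmin_pos; lra.
  - intros t Ht. destruct (Rlt_min _ _ _ Ht) as [T1 T2].
    apply Rabs_lt_between in T1, T2. apply Hp. lra.
Qed.

Lemma snd_field_sign_near up t0 (k : R) : snd (g t0) = 0 -> 0 < k * snd (field_on up (g t0)) ->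
  exists d, 0 < d /\ forall t, Rabs (t - t0) < d -> 0 < k * snd (field_on up (g t)).
Proof.
  intros H0 Hk. destruct (both_lipschitz (g t0) (HDg t0) H0) as [r [L [Hr [HL HX]]]].
  set (e := k * snd (field_on up (g t0))) in *.
  assert (HkL : 0 <= Rabs k * L) by (apply Rmult_le_pos; [apply Rabs_pos|lra]).
  destruct (small_positive 2 r (Rabs k * L) (e / 2) 1 1 1 1) as [h [Hh [Hhr [HhL _]]]]; try lra.
  destruct (proj1 (continuous_curve g t0) (Hg t0) h Hh) as [d [Hd Kd]].
  exists d. split; [exact Hd|]. intros t Ht. specialize (Kd t Ht).
  assert (Q := HX up (g t) (g t0) ltac:(lra) ltac:(rewrite dist1_refl; exact Hr)).
  assert (Q2 := dist1_snd (field_on up (g t)) (field_on up (g t0))).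
  assert (Q3 : Rabs (k * snd (field_on up (g t)) - e) <= Rabs k * (L * dist1 (g t) (g t0))).
  { unfold e. rewrite <- Rmult_minus_distr_l, Rabs_mult. apply Rmult_le_compat_l; [apply Rabs_pos|]. lra. }
  assert (Rabs k * L * dist1 (g t) (g t0) <= Rabs k * L * h) by (apply Rmult_le_compat_l; lra).
  apply Rabs_le_between in Q3. lra.
Qed.

(** Otherwise the distance to Sigma, positive before t0, would increase up to t0, where it is 0. *)
Lemma piece_before_sign up a t0 : a < t0 -> piece up a t0 -> snd (g t0) = 0 ->
  side up * snd (field_on up (g t0)) <= 0.
Proof.
  intros Ha Hp H0. apply Rnot_lt_le. intros Hpos.
  destruct (snd_field_sign_near up t0 (side up) H0 Hpos) as [d [Hd Hs]].
  set (t := Rmax ((a + t0) / 2) (t0 - d / 2)).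
  assert (Ht : a < t < t0 /\ t0 - d / 2 <= t).
  { unfold t, Rmax. destruct (Rle_dec ((a + t0) / 2) (t0 - d / 2)); lra. }
  destruct (Hp t ltac:(lra)) as [Q _].
  assert (Hinc : 0 * (t0 - t) <= side up * snd (g t0) - side up * snd (g t)).
  { apply (increment_ge (fun x => side up * snd (g x))); [lra| |].
    - intros x Hx. destruct (Hp x ltac:(lra)) as [_ [[_ V] _]].
      exists (side up * snd (field_on up (g x))). split.
      + apply (is_derive_scal (fun x => snd (g x))), V.
      + left. apply Hs. rewrite Rabs_left1; lra.
    - intros x _. apply (continuous_scal_r (side up) (fun x => snd (g x))).
      now apply continuous_curve_snd. }
  rewrite H0 in Hinc. lra.
Qed.

Lemma piece_after_sign up t0 b : t0 < b -> piece up t0 b -> snd (g t0) = 0 ->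
  0 <= side up * snd (field_on up (g t0)).
Proof.
  intros Hb Hp H0. apply Rnot_lt_le. intros Hneg.
  destruct (snd_field_sign_near up t0 (- side up) H0 ltac:(lra)) as [d [Hd Hs]].
  set (t := Rmin ((t0 + b) / 2) (t0 + d / 2)).
  assert (Ht : t0 < t < b /\ t <= t0 + d / 2).
  { unfold t, Rmin. destruct (Rle_dec ((t0 + b) / 2) (t0 + d / 2)); lra. }
  destruct (Hp t ltac:(lra)) as [Q _].
  assert (Hinc : side up * snd (g t) - side up * snd (g t0) <= 0 * (t - t0)).
  { apply (increment_le (fun x => side up * snd (g x))); [lra| |].
    - intros x Hx. destruct (Hp x ltac:(lra)) as [_ [[_ V] _]].
      exists (side up * snd (field_on up (g x))). split.
      + apply (is_derive_scal (fun x => snd (g x))), V.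
      + assert (W := Hs x ltac:(rewrite Rabs_pos_eq; lra)). lra.
    - intros x _. apply (continuous_scal_r (side up) (fun x => snd (g x))).
      now apply continuous_curve_snd. }
  rewrite H0 in Hinc. lra.
Qed.

Lemma pieces_contact up a t0 c :
  a < t0 < c -> piece (negb up) a t0 -> piece up t0 c -> snd (g t0) = 0 ->
  0 < side up * snd (field_on (negb up) (g t0)) ->
  exists b r L d, contact Z g t0 (field_on (negb up)) (field_on up) (side up) b r L d.
Proof.
  intros Hac Hbef Haft H0 Htr.
  destruct (both_lipschitz (g t0) (HDg t0) H0) as [r [L [Hr [HL HX]]]].
  destruct (field_switching up) as [b [Hb HbZ]].
  exists b, r, L, (Rmin (t0 - a) (c - t0)).
  assert (M1 := Rmin_l (t0 - a) (c - t0)). assert (M2 := Rmin_r (t0 - a) (c - t0)).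
  split; try assumption; try apply HX.
  - destruct up; [now left|now right].
  - apply Rmin_pos; lra.
  - intros eps q He _. now apply HbZ.
  - intros t Ht. destruct (Hbef t ltac:(lra)) as [Q1 [Q2 _]].
    rewrite side_negb in Q1. split; [lra|exact Q2].
  - intros t Ht. destruct (Haft t ltac:(lra)) as [Q1 [Q2 _]]. now split.
Qed.

(** The signs before and after t0 exclude that g returns to the side from which it came, so it
    really changes sides. *)
Lemma crossing_has_box u1 u2 a t0 c :
  a < t0 < c -> piece u1 a t0 -> piece u2 t0 c -> snd (g t0) = 0 ->
  0 < snd (Xp (g t0)) * snd (Xm (g t0)) -> has_box Z g t0.
Proof.
  intros Hac Hbef Haft H0 Hcr.
  assert (S1 := piece_before_sign u1 a t0 ltac:(lra) Hbef H0).
  assert (S2 := piece_after_sign u2 t0 c ltac:(lra) Haft H0).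
  assert (Hu : u1 = negb u2 /\ 0 < side u2 * snd (field_on u2 (g t0)) /\
    0 < side u2 * snd (field_on (negb u2) (g t0))).
  { assert (Hpm : 0 < snd (Xp (g t0)) /\ 0 < snd (Xm (g t0)) \/
      snd (Xp (g t0)) < 0 /\ snd (Xm (g t0)) < 0).
    { destruct (Rtotal_order (snd (Xp (g t0))) 0) as [H|[H|H]]; [right|exfalso|left].
      - split; [exact H|]. apply Rnot_le_lt. intros H'. nra.
      - rewrite H in Hcr. lra.
      - split; [exact H|]. apply Rnot_le_lt. intros H'. nra. }
    destruct u1, u2; simpl in *; (split; [try reflexivity; exfalso|split]); lra. }
  destruct Hu as [-> [P1 P2]].
  destruct (pieces_contact u2 a t0 c Hac Hbef Haft H0 P2) as [b [r [L [d Hct]]]].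
  now apply (crossing_box Z g Hg _ _ _ _ _ _ _ _ Hct).
Qed.

Lemma leaves_along_velocity X t0 : leaves_along X g t0 ->
  exists d, 0 < d /\ forall t, t0 < t < t0 + d -> velocity g t (X (g t)).
Proof.
  intros [d [y [Hd [Hy E]]]]. exists d. split; [exact Hd|]. intros t Ht.
  rewrite E by lra. apply velocity_locally with y (Rmin (t - t0) (t0 + d - t)).
  - apply Rmin_pos; lra.
  - intros s Hs. apply E. destruct (Rlt_min _ _ _ Hs) as [T1 T2].
    apply Rabs_lt_between in T1, T2. lra.
  - apply Hy. lra.
Qed.

Lemma arrives_along_velocity X t0 : arrives_along X g t0 ->
  exists d, 0 < d /\ forall t, t0 - d < t < t0 -> velocity g t (X (g t)).
Proof.
  intros [d [y [Hd [Hy E]]]]. exists d. split; [exact Hd|]. intros t Ht.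
  rewrite E by lra. apply velocity_locally with y (Rmin (t - (t0 - d)) (t0 - t)).
  - apply Rmin_pos; lra.
  - intros s Hs. apply E. destruct (Rlt_min _ _ _ Hs) as [T1 T2].
    apply Rabs_lt_between in T1, T2. lra.
  - apply Hy. lra.
Qed.

(* The two fields differ at g t0, so the side on which g leaves and arrives is
   the one where the prescribed field acts. *)
Lemma tangency_contact up u1 u2 a t0 c :
  a < t0 < c -> piece u1 a t0 -> piece u2 t0 c -> snd (g t0) = 0 ->
  snd (field_on up (g t0)) = 0 -> snd (field_on (negb up) (g t0)) <> 0 ->
  leaves_along (field_on up) g t0 -> arrives_along (field_on (negb up)) g t0 ->
  exists b r L d, contact Z g t0 (field_on (negb up)) (field_on up) (side up) b r L d.
Proof.
  intros Hac Hbef Haft H0 HB HA Hlv Har.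
  destruct (both_lipschitz (g t0) (HDg t0) H0) as [r [L [Hr [HL HX]]]].
  assert (Hne : ~ forall d, 0 < d -> exists t, Rabs (t - t0) < d /\
    field_on up (g t) = field_on (negb up) (g t)).
  { intros H. apply HA. rewrite <- HB.
    now rewrite (lipschitz_near_limit (field_on up) (field_on (negb up)) g t0 r L Hr HL (Hg t0)
      (HX up) (HX (negb up)) H). }
  assert (Hu2 : u2 = up).
  { destruct (Bool.bool_dec u2 up) as [|Hn]; [assumption|exfalso].
    assert (E : u2 = negb up) by (destruct u2, up; try reflexivity; now contradict Hn). subst u2. apply Hne.
    destruct (leaves_along_velocity _ _ Hlv) as [d1 [Hd1 K1]].
    intros d Hd. set (t := t0 + Rmin d (Rmin d1 (c - t0)) / 2).
    assert (Hm : 0 < Rmin d (Rmin d1 (c - t0))) by (repeat apply Rmin_pos; lra).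
    assert (M1 := Rmin_l d (Rmin d1 (c - t0))). assert (M2 := Rmin_r d (Rmin d1 (c - t0))).
    assert (M3 := Rmin_l d1 (c - t0)). assert (M4 := Rmin_r d1 (c - t0)).
    assert (Ht : t0 < t /\ t < t0 + d /\ t < t0 + d1 /\ t < c) by (unfold t; lra).
    exists t. split; [rewrite Rabs_pos_eq; lra|].
    apply (velocity_unique g t); [apply K1; lra|apply Haft; lra]. }
  assert (Hu1 : u1 = negb up).
  { destruct (Bool.bool_dec u1 (negb up)) as [|Hn]; [assumption|exfalso].
    assert (E : u1 = up) by (destruct u1, up; try reflexivity; now contradict Hn). subst u1. apply Hne.
    destruct (arrives_along_velocity _ _ Har) as [d1 [Hd1 K1]].
    intros d Hd. set (t := t0 - Rmin d (Rmin d1 (t0 - a)) / 2).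
    assert (Hm : 0 < Rmin d (Rmin d1 (t0 - a))) by (repeat apply Rmin_pos; lra).
    assert (M1 := Rmin_l d (Rmin d1 (t0 - a))). assert (M2 := Rmin_r d (Rmin d1 (t0 - a))).
    assert (M3 := Rmin_l d1 (t0 - a)). assert (M4 := Rmin_r d1 (t0 - a)).
    assert (Ht : t < t0 /\ t0 - d < t /\ t0 - d1 < t /\ a < t) by (unfold t; lra).
    exists t. split; [rewrite Rabs_left1; lra|].
    apply (velocity_unique g t); [apply Hbef; lra|apply K1; lra]. }
  subst u1 u2.
  apply (pieces_contact up a t0 c Hac Hbef Haft H0).
  assert (S1 := piece_before_sign (negb up) a t0 ltac:(lra) Hbef H0).
  rewrite side_negb in S1.
  assert (side up * snd (field_on (negb up) (g t0)) <> 0).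
  { destruct up; simpl in *; lra. }
  lra.
Qed.

Lemma regular_orbit_pieces a b :
  a < b -> regular_orbit (Pws D snd Xp Xm) g a b ->
  (exists u c, a < c /\ piece u a c) /\ (exists u c, c < b /\ piece u c b) /\
  (forall t, a < t < b -> has_box Z g t).
Proof.
  intros Hab [_ [m [s [[Hs0 [Hsm Hs]] [Hpieces Hcross]]]]].
  assert (Hpc : forall j, (j < m)%nat -> exists u, piece u (s j) (s (S j))).
  { intros j Hj. destruct (Hpieces j Hj) as [[[P1 P2] P3]|[[P1 P2] P3]].
    - exists true. intros t Ht. destruct (P1 t Ht) as [_ Q]. simpl in *.
      split; [lra|]. split; [now apply P2|now apply P3].
    - exists false. intros t Ht. destruct (P1 t Ht) as [_ Q]. simpl in *.
      split; [lra|]. split; [now apply P2|now apply P3]. }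
  destruct m as [|m]; [lra|]. split; [|split].
  - destruct (Hpc O ltac:(lia)) as [u Hu]. exists u, (s 1%nat). rewrite Hs0 in Hu.
    split; [rewrite <- Hs0; apply Hs; lia|exact Hu].
  - destruct (Hpc m ltac:(lia)) as [u Hu]. exists u, (s m). rewrite Hsm in Hu.
    split; [rewrite <- Hsm; apply Hs; lia|exact Hu].
  - intros t Ht.
    destruct (subdivision_locate s (S m) t Hs) as [j [Hj Hjt]]; [lra|].
    destruct (Req_dec t (s j)) as [E|Hne].
    + assert (Hj0 : (0 < j)%nat).
      { destruct j; [lra|lia]. }
      destruct (Hpc (j - 1)%nat ltac:(lia)) as [u1 H1]. destruct (Hpc j Hj) as [u2 H2].
      replace (S (j - 1)) with j in H1 by lia.
      assert (Hlt1 : s (j - 1)%nat < s j).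
      { replace j with (S (j - 1)) at 2 by lia. apply Hs. lia. }
      destruct (Hcross j ltac:(lia)) as [[_ C1] C2]. subst t.
      unfold Xph, Xmh in C2. simpl in C1, C2. rewrite !lie_snd in C2.
      apply (crossing_has_box u1 u2 (s (j - 1)%nat) (s j) (s (S j))); try assumption. lra.
    + destruct (Hpc j Hj) as [u Hu]. apply (piece_box u (s j) (s (S j)) t Hu). lra.
Qed.

(** Boxes are demanded at all real times, whereas the polycycle is described over one period. *)
Lemma has_box_translate t0 s :
  (forall x, g (x + (s - t0)) = g x) -> has_box Z g s -> has_box Z g t0.
Proof.
  intros E [v [w [r [c [C [L [d B]]]]]]]. exists v, w, r, c, C, L, d.
  assert (E0 : g s = g t0) by (rewrite <- (E t0); f_equal; ring).
  destruct B as [B1 B2 B3 B4 B5 B6 B7 B8 B9 B10]. rewrite E0 in *.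
  split; try assumption.
  - intros t Ht. rewrite <- (E t). apply B9.
    now replace (t + (s - t0) - s) with (t - t0) by ring.
  - intros mu Hmu. destruct (B10 mu Hmu) as [e0 [He0 H]]. exists e0. split; [exact He0|].
    intros eps t He Ht.
    apply velocity_locally with (fun x => g (x + (s - t0))) 1; [lra|intros; now rewrite E|].
    apply velocity_shift. rewrite <- (E t). apply H; [exact He|].
    now replace (t + (s - t0) - s) with (t - t0) by ring.
Qed.

End Polycycle.

(** * Assembly for polycycles of type (ii) *)

Lemma max_mult_ge l k : (0 < l)%nat -> (2 * k O <= max_mult l k)%nat.
Proof.
  intros Hl. destruct l as [|l]; [lia|]. unfold max_mult. cbn [seq map fold_right].
  apply Nat.le_max_l.
Qed.

(* p_{i+1} = (a i, 0) and n_{i+1} = 2 * k i for i < l. *)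
Theorem theoremD
  (D : R * R -> Prop) (Xp Xm : R * R -> R * R)
  (l : nat) (a : nat -> R) (k : nat -> nat)
  (g : R -> R * R) (tau : nat -> R)
  (n : nat) (Phi : R -> R)
  (HZ : filippov_system (Pws D snd Xp Xm) (max_mult l k))
  (Ha : a O = 0)
  (HGamma : polycycle_type_ii (Pws D snd Xp Xm) l (fun i => (a i, 0)) k g tau)
  (Hn : (max_mult l k - 1 <= n)%nat)
  (HPhi : C_ST (n - 1) Phi) :
  exists Geps : R -> R * R -> Prop,
    (exists eps0 : R, 0 < eps0 /\
       forall eps : R, 0 < eps < eps0 ->
         limit_cycle D (regularization (Pws D snd Xp Xm) Phi eps) (Geps eps)) /\
    converges_to Geps (range_of g).
Proof.
  destruct HGamma as [[Hl [_ [_ [HDc [Hper [_ [Htau0 [Htau [Hgp [Horb _]]]]]]]]]] Htan].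
  assert (Hg : forall t, continuous g t) by (intros t; apply HDc).
  assert (HDg : forall t, D (g t)) by (intros t; apply HDc).
  destruct HZ as [HDo [_ [_ [_ [_ [_ [[Up [HUp [HUpD HXp]]] [Um [HUm [HUmD HXm]]]]]]]]]].
  simpl in HDo, HUpD, HUmD, HXp, HXm.
  (* The fields are at least of class C^1, hence locally Lipschitz. *)
  assert (Hmult : exists r, max_mult l k = S r).
  { destruct (Htan O Hl) as [Hk _]. assert (Hm := max_mult_ge l k Hl).
    exists (max_mult l k - 1)%nat. lia. }
  destruct Hmult as [r Er]. rewrite Er in HXp, HXm.
  assert (HLp : forall q, D q -> 0 <= snd q ->
    exists r L, 0 < r /\ 0 <= L /\ lipschitz_near Xp q r L).
  { intros q Hq Hs. apply (Ck_field_lipschitz_near r Up Xp q HUp HXp). now apply HUpD. }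
  assert (HLm : forall q, D q -> snd q <= 0 ->
    exists r L, 0 < r /\ 0 <= L /\ lipschitz_near Xm q r L).
  { intros q Hq Hs. apply (Ck_field_lipschitz_near r Um Xm q HUm HXm). now apply HUmD. }
  destruct HPhi as [HPhi _]. apply monotonic_transition_weight in HPhi. destruct HPhi as [K HK].
  set (Z := regularization (Pws D snd Xp Xm) Phi).
  assert (HZb : forall eps q, Z eps q = blend ((fun s => (1 + Phi s) / 2) (snd q / eps)) (Xp q) (Xm q))
    by (intros; apply regularization_blend).
  set (T := tau l).
  assert (Hmono : forall i, (i <= l)%nat -> 0 <= tau i).
  { induction i as [|i IH]; intros Hi; [lra|].
    generalize (IH ltac:(lia)) (Htau i ltac:(lia)). lra. }
  assert (HT : 0 < T).
  { unfold T. destruct l as [|l']; [lia|].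
    generalize (Hmono l' ltac:(lia)) (Htau l' ltac:(lia)). lra. }
  assert (Harc : forall i, (i < l)%nat ->
    (exists u c, tau i < c /\ piece Xp Xm g u (tau i) c) /\
    (exists u c, c < tau (S i) /\ piece Xp Xm g u c (tau (S i))) /\
    (forall t, tau i < t < tau (S i) -> has_box Z g t)).
  { intros i Hi. apply (regular_orbit_pieces D Xp Xm g Z _ K Hg HDg HK HZb HLp HLm); [now apply Htau|].
    now apply Horb. }
  (* For i = 0 the arriving piece is the end of the last arc, shifted back by one period. *)
  assert (Hbefore : forall i, (i < l)%nat -> exists u c, c < tau i /\ piece Xp Xm g u c (tau i)).
  { intros [|i] Hi.
    - destruct (Harc (l - 1)%nat ltac:(lia)) as [_ [[u [c [Hc Hu]]] _]].
      replace (S (l - 1)) with l in * by lia. fold T in Hc, Hu.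
      exists u, (c - T). rewrite Htau0. split; [lra|].
      intros t Ht. rewrite <- (Hper t). fold T. destruct (Hu (t + T) ltac:(lra)) as [Q1 [Q2 Q3]].
      split; [exact Q1|]. split; [|exact Q3].
      apply velocity_locally with (fun x => g (x + T)) 1; [lra|intros; symmetry; apply Hper|].
      now apply velocity_shift.
    - apply (Harc i). lia. }
  assert (Hcontact : forall i, (i < l)%nat -> exists up b r L d,
    contact Z g (tau i) (field_on Xp Xm (negb up)) (field_on Xp Xm up) (side up) b r L d /\
    snd (field_on Xp Xm up (g (tau i))) = 0 /\ fst (field_on Xp Xm up (g (tau i))) <> 0).
  { intros i Hi. destruct (Htan i Hi) as [Hki [_ [_ Hvis]]].
    destruct (Hbefore i Hi) as [u1 [c1 [Hc1 Hp1]]].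
    destruct (Harc i Hi) as [[u2 [c2 [Hc2 Hp2]]] _].
    assert (Hgi := Hgp i Hi). simpl in Hgi.
    assert (H0 : snd (g (tau i)) = 0) by now rewrite Hgi.
    assert (Hmain : forall up,
      snd (field_on Xp Xm up (g (tau i))) = 0 -> field_on Xp Xm up (g (tau i)) <> (0, 0) ->
      snd (field_on Xp Xm (negb up) (g (tau i))) <> 0 ->
      leaves_along (field_on Xp Xm up) g (tau i) -> arrives_along (field_on Xp Xm (negb up)) g (tau i) ->
      exists up b r L d,
      contact Z g (tau i) (field_on Xp Xm (negb up)) (field_on Xp Xm up) (side up) b r L d /\
      snd (field_on Xp Xm up (g (tau i))) = 0 /\ fst (field_on Xp Xm up (g (tau i))) <> 0).
    { intros up S0 Sne Str Hlv Har.
      destruct (tangency_contact D Xp Xm g Z _ K Hg HDg HK HZb HLp HLm up u1 u2 c1 (tau i) c2)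
        as [b [r1 [L [d Hct]]]]; try assumption; [lra|].
      exists up, b, r1, L, d. split; [exact Hct|]. split; [exact S0|].
      intros F0. apply Sne. rewrite (surjective_pairing (field_on Xp Xm up (g (tau i)))).
      now rewrite F0, S0. }
    (* As n_i >= 2, the first Lie derivative vanishes; with h = y this is the second component of
       the tangent field. *)
    destruct Hvis as [[[_ [V1 [V2 V3]]] [Hlv Har]]|[[_ [V1 [V2 V3]]] [Hlv Har]]];
      rewrite <- Hgi in V1, V2, V3; simpl in V1, V2, V3;
      assert (V1' := V1 1%nat ltac:(lia)); unfold lie_iter in V1'; simpl in V1'; rewrite lie_snd in V1';
      unfold Xph, Xmh in V3; simpl in V3; rewrite lie_snd in V3.
    - apply (Hmain true); try assumption. simpl. intros E.
      rewrite (lie_iter_zero Xp snd (g (tau i)) _ E) in V2 by lia. lra.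
    - apply (Hmain false); try assumption. simpl. intros E.
      rewrite (lie_iter_zero Xm snd (g (tau i)) _ E) in V2 by lia. lra. }
  destruct (tube_in_open g T D HT Hper Hg HDo HDg) as [rD [HrD HtD]].
  destruct (Z_extension D Xp Xm g Z _ K Hg HDg HK HZb HLp HLm T HT Hper) as [rZ [HrZ HtZ]].
  set (r0 := Rmin rD rZ).
  assert (Hr0 : 0 < r0) by now apply Rmin_pos.
  assert (Hbox : forall t, has_box Z g t).
  { intros t. destruct (periodic_translate g T 0 HT Hper t) as [s [Hs E]].
    apply (has_box_translate g Z t s E).
    destruct (subdivision_locate tau l s Htau) as [i [Hi Hsi]]; [rewrite Htau0; fold T; lra|].
    destruct (Req_dec s (tau i)) as [->|Hne].
    - destruct (Hcontact i Hi) as [up [b [r1 [L [d [Hct [S0 F0]]]]]]].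
      apply (tangential_link Z g Hg _ _ _ _ _ _ _ _ r0 Hr0 Hct S0 F0).
    - apply (Harc i Hi). lra. }
  (* Only p_1 is used to contract; the other singularities contribute to the finite factor k2. *)
  destruct (Hcontact O Hl) as [up [b [r1 [L [d1 [Hct [S0 F0]]]]]]]. rewrite Htau0 in *.
  destruct (tangential_link Z g Hg _ _ _ _ _ _ _ _ r0 Hr0 Hct S0 F0) as [_ [d [Hd Hsmall]]].
  set (e := Rmin (d / 2) (T / 4)).
  assert (He : 0 < e /\ e <= d / 2 /\ e <= T / 4).
  { unfold e. split; [apply Rmin_pos; lra|]. split; [apply Rmin_l|apply Rmin_r]. }
  destruct (link_everywhere Z g r0 Hg Hr0 (0 + e) (0 - e + T) Hbox ltac:(lra)) as [k2 [Hk2 L2]].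
  (* With k2 known, this choice gives k1 k2 <= 1 / 2 for the whole loop from - e to T - e. *)
  destruct (Hsmall e (/ (2 * (k2 + 1)))) as [k1 [Hk1 L1]]; [lra|apply Rinv_0_lt_compat; lra|].
  apply (limit_cycles_near_loop D Z g r0 T rZ Hg Hr0 HT HrZ Hper) with (kappa := k1 * k2) (s0 := 0 - e).
  - intros q [t Ht]. apply HtD. exists t. eapply Rlt_le_trans; [exact Ht|apply Rmin_l].
  - intros eps Heps. apply HtZ; [split; [exact Hr0|apply Rmin_r]|exact Heps].
  - split; [apply Rmult_le_pos; lra|].
    destruct Hk1 as [Hk1 Hk1'].
    apply (Rmult_le_compat_l (2 * (k2 + 1))) in Hk1'; [|lra].
    rewrite Rinv_r in Hk1' by lra. nra.
  - apply link_compose with (0 + e); [lra|exact Hk2|exact L1|exact L2].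
  - apply (follows_everywhere Z g r0 Hg Hr0); [exact Hbox|lra].
Qed.
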